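(* Let $R\in\mathbb{R}$ and let $u(x),\rho(x)\in C_b([R,\infty))$ (bounded continuous functions) with $\rho(x)>0$. Assume that $u(x)$ is increasing (i.e. $u(x)\le u(y)$ for $x<y$), and let $\rho_0>0$ and $u_0>u(R)$. For $\varepsilon>0$ take a partition $\{Y_i\}_{i\in\mathbb{N}_0}$ of $[R,\infty)$ with $Y_0=R$ and $C\sqrt[3]{\varepsilon}\ge Y_i-Y_{i-1}\ge\sqrt{\varepsilon}$ for every $i=1,2,\ldots$, where $C\ge 1$ is a constant. Let $u_i=u(Y_i)$ for $i\geq 1$ and $\tilde u=\lim_{i\to\infty}u_i$. Then there exists an admissible global solution, in the approximated sense, to the pressureless gas system with initial data $(\rho,u)(x,0)=(\rho_0,u_0)$ for $x\le R$ and $(\rho,u)(x,0)=(\rho(x),u(x))$ for $x>R$; that is, there exists a function $U^\varepsilon=(\rho^\varepsilon,u^\varepsilon)$ (the one produced by the shadow wave tracking procedure) satisfying $$\partial_t\rho^\varepsilon+\partial_x(\rho^\varepsilon u^\varepsilon)\approx 0,\qquad \partial_t(\rho^\varepsilon u^\varepsilon)+\partial_x(\rho^\varepsilon (u^\varepsilon)^2)\approx 0,$$ $\rho^\varepsilon(x,0)\approx\rho(x,0)$, $u^\varepsilon(x,0)\approx u(x,0)$ as $\varepsilon\to 0$, and the admissibility condition. Moreover: (1) If $\tilde u\le u_0$, there are infinitely many interaction points. (2) If $\tilde u>u_0$, the interactions stop with the interaction point $(X_{0,k},T_{0,k})$, where $k\in\mathbb{N}$ is such that $u_k<u_0\le u_{k+1}$.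 In that case the speed $u_s(t)$ of the shadow wave starting at $(R,0)$ satisfies $u_s(t)\to u_0$ as $t\to\infty$.
   Context: System: $\partial_t\rho+\partial_x(\rho u)=0$, $\partial_t(\rho u)+\partial_x(\rho u^2)=0$, $\rho\ge 0$. The letters $\rho,u$ denote both the initial functions of $x$ and the solution. Approximate initial data: given the partition $\{Y_i\}$ (depending on $\varepsilon$), set $(\rho_i,u_i)=(\rho(Y_i),u(Y_i))$ for $i\ge1$; $U^\varepsilon(x,0)=(\rho_{i+1},u_{i+1})$ for $x\in(Y_i,Y_{i+1}]$, $i\in\mathbb{N}_0$, and $U^\varepsilon(x,0)=(\rho_0,u_0)$ for $x\le R$. Riemann problems. At each $(Y_i,0)$, with left state $(\rho_i,u_i)$ and right state $(\rho_{i+1},u_{i+1})$: if $u_i=u_{i+1}$, a contact discontinuity $x=Y_i+u_it$; if $u_i<u_{i+1}$, two contact discontinuities $x=Y_i+u_it$ and $x=Y_i+u_{i+1}t$ (called first and second) separated by a vacuum region $\mathrm{Vac}_{i,i+1}$, in which $\rho=0$ and the velocity is a continuous function equal to $u_i$ and $u_{i+1}$ on the two bounding lines; if $u_i>u_{i+1}$, a simple shadow wave with constant speed $y_{i,i+1}=\frac{\sqrt{\rho_i}u_i+\sqrt{\rho_{i+1}}u_{i+1}}{\sqrt{\rho_i}+\sqrt{\rho_{i+1}}}$ and strength $\sqrt{\rho_i\rho_{i+1}}(u_i-u_{i+1})t$. Shadow waves. A shadow wave starting at $(X,T)$ with adjacent states $(\rho_l,u_l)$, $(\rho_r,u_r)$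 has central line $x=c(t)$, $c(T)=X$, speed $c'(t)=u_s(t)$ and strength $\xi(t)$ solving $\xi'=(\rho_r-\rho_l)u_s-(\rho_ru_r-\rho_lu_l)$, $(\xi u_s)'=(\rho_ru_r-\rho_lu_l)u_s-(\rho_ru_r^2-\rho_lu_l^2)$ for $t>T$. In $U^\varepsilon$ it is represented by an intermediate state $(\rho_\varepsilon(t),u_\varepsilon(t))$ on $|x-c(t)|<\frac{\varepsilon}{2}(t-T)+x_\varepsilon$, where $x_\varepsilon\sim\varepsilon$ ($x_\varepsilon=0$ if $T=0$), $\rho_\varepsilon\sim\varepsilon^{-1}$, $u_\varepsilon(t)\to u_s(t)$ and $(\varepsilon(t-T)+2x_\varepsilon)\rho_\varepsilon(t)\to\xi(t)$ as $\varepsilon\to0$. If the left (right) neighbouring region is a vacuum $\mathrm{Vac}_{l-1,l}$ ($\mathrm{Vac}_{r,r+1}$), then one takes $\rho_l=0$ with velocity $u_l$ ($\rho_r=0$ with velocity $u_r$). Interactions (tracking procedure). Waves propagate until the (central) lines of two or more of them meet at some $(X,T)$, called an interaction point. The interacting waves are replaced by a single shadow wave starting at $(X,T)$, whose left state is the left state of the leftmost and whose right state is the right state of the rightmost incoming wave, with $\xi(T)$ the sum of incoming strengths and $\xi(T)u_s(T)$ the sum of (strength times speed) of incoming waves (contact discontinuities have strength zero); $x_\varepsilon$ is chosen so that the mass is continuous at $t=T$. The overlap areas of order $\varepsilon^2$ near interaction points are neglected. The procedure is repeated. $(X_{0,i},T_{0,i})$ denotes the point where the shadow wave starting at $(R,0)$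 meets the first contact discontinuity $x=Y_i+u_it$ emanating from $(Y_i,0)$. Notation: $\approx$ means that the difference of the two sides tends to $0$ in the sense of distributions as $\varepsilon\to 0$; for the equations this means that for every $\varphi\in C_0^\infty(\mathbb{R}\times[0,\infty))$, $\int_0^\infty\int_{\mathbb{R}}(\rho^\varepsilon\partial_t\varphi+\rho^\varepsilon u^\varepsilon\partial_x\varphi)\,dx\,dt+\int_{\mathbb{R}}(\rho^\varepsilon\varphi)(x,0)\,dx\to0$, and similarly with $(\rho^\varepsilon,\rho^\varepsilon u^\varepsilon)$ replaced by $(\rho^\varepsilon u^\varepsilon,\rho^\varepsilon(u^\varepsilon)^2)$. $a_\varepsilon\sim b_\varepsilon$ means $a_\varepsilon/b_\varepsilon$ tends to a positive constant. Admissibility: every wave in the solution is either a classical contact discontinuity or an overcompressive shadow wave, i.e. $u_l\ge u_s(t)\ge u_r$ for its adjacent velocities as long as it exists.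
   Formalization: If ũ = u_0 and u attains u_0, there are only finitely many interactions, so (1) excludes this case and the conclusion of (2) is proved for it; (1) and (2) are asserted for all sufficiently small ε, since if u(Y_1) ≥ u_0 no k as in (2) exists. *)

(* Defs.v *)
From Stdlib Require Export Reals List.
From Coquelicot Require Export Coquelicot.
Open Scope R_scope.

(* Partition points Y_i, and the states (rho_i, u_i); the state of index 0 is
   the constant state on the left of Y_0. *)
Record states := States { pt : nat -> R; den : nat -> R; vel : nat -> R }.

Definition discretize (Y : nat -> R) (rho0 u0 : R) (rho u : R -> R) : states :=
  States Y
    (fun i => match i with O => rho0 | S _ => rho (Y i) end)
    (fun i => match i with O => u0 | S _ => u (Y i) end).

(* [St i] is the region with constant state (rho_i, u_i), [Vac i] the vacuum
   Vac_{i,i+1}. *)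
Inductive region := St (i : nat) | Vac (i : nat).

Definition rden (d : states) (r : region) : R :=
  match r with St i => den d i | Vac _ => 0 end.

(* Velocity attached to a region lying to the left (right) of a wave: for a
   vacuum it is the velocity of its right (left) bounding line. *)
Definition velL (d : states) (r : region) : R :=
  match r with St i => vel d i | Vac i => vel d (S i) end.

Definition velR (d : states) (r : region) : R :=
  match r with St i => vel d i | Vac i => vel d i end.

(* A wave lives on [birth, death).  The last three fields are x_eps, rho_eps(t)
   and u_eps(t), and are only meaningful for shadow waves.  Only the values of
   the functions at times t >= birth matter. *)
Record wave := Wave {
  shadow : bool;
  birthX : R;
  birthT : R;
  deathT : Rbar;
  lreg : region;
  rreg : region;
  line : R -> R;
  speed : R -> R;
  strength : R -> R;
  halfw : R;
  iden : R -> R;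
  ivel : R -> R
}.

Definition alive (w : wave) (t : R) : Prop :=
  birthT w <= t /\ Rbar_lt t (deathT w).

Definition contact (X s : R) (l r : region) (w : wave) : Prop :=
  shadow w = false /\ birthX w = X /\ birthT w = 0 /\ lreg w = l /\ rreg w = r /\
  forall t, 0 <= t -> line w t = X + s * t /\ speed w t = s /\ strength w t = 0.

Definition simple_speed (d : states) (i : nat) : R :=
  (sqrt (den d i) * vel d i + sqrt (den d (S i)) * vel d (S i)) /
  (sqrt (den d i) + sqrt (den d (S i))).

Definition simple_shadow (d : states) (i : nat) (w : wave) : Prop :=
  shadow w = true /\ birthX w = pt d i /\ birthT w = 0 /\
  lreg w = St i /\ rreg w = St (S i) /\ halfw w = 0 /\
  forall t, 0 <= t ->
    line w t = pt d i + simple_speed d i * t /\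
    speed w t = simple_speed d i /\
    strength w t = sqrt (den d i * den d (S i)) * (vel d i - vel d (S i)) * t.

Definition right_continuous (f : R -> R) (T : R) : Prop :=
  filterlim f (at_right T) (locally (f T)).

(* The equations of a shadow wave of strength xi and speed u_s.  Together with
   right continuity at the time of birth, the initial values are the values of
   the fields at [birthT w]. *)
Definition shadow_ode (d : states) (w : wave) : Prop :=
  let T := birthT w in
  let rl := rden d (lreg w) in let ul := velL d (lreg w) in
  let rr := rden d (rreg w) in let ur := velR d (rreg w) in
  line w T = birthX w /\
  right_continuous (line w) T /\
  right_continuous (speed w) T /\
  right_continuous (strength w) T /\
  forall t, T < t -> Rbar_le t (deathT w) ->
    is_derive (line w) t (speed w t) /\
    is_derive (strength w) t
      ((rr - rl) * speed w t - (rr * ur - rl * ul)) /\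
    is_derive (fun s => strength w s * speed w s) t
      ((rr * ur - rl * ul) * speed w t - (rr * ur ^ 2 - rl * ul ^ 2)).

Definition arrives (W : wave -> Prop) (w : wave) (X T : R) : Prop :=
  W w /\ birthT w < T /\ deathT w = Finite T /\ line w T = X.

Definition interaction (W : wave -> Prop) (X T : R) : Prop :=
  exists v w, v <> w /\ arrives W v X T /\ arrives W w X T.

(* The order of the waves is read off just before they meet. *)
Definition leftmost (v : wave) (ws : list wave) (T : R) : Prop :=
  In v ws /\
  forall v', In v' ws -> v' <> v -> at_left T (fun t => line v t < line v' t).

Definition rightmost (v : wave) (ws : list wave) (T : R) : Prop :=
  In v ws /\
  forall v', In v' ws -> v' <> v -> at_left T (fun t => line v' t < line v t).

Definition sum_over (f : wave -> R) (ws : list wave) : R :=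
  fold_right Rplus 0 (map f ws).

Definition strip_mass (eps : R) (w : wave) (t : R) : R :=
  if shadow w then (eps * (t - birthT w) + 2 * halfw w) * iden w t else 0.

(* [w] is the shadow wave that replaces the incoming waves [ws] at time T. *)
Definition outgoing (d : states) (eps : R) (ws : list wave) (w : wave) : Prop :=
  let T := birthT w in
  shadow w = true /\
  (exists v, leftmost v ws T /\ lreg w = lreg v) /\
  (exists v, rightmost v ws T /\ rreg w = rreg v) /\
  shadow_ode d w /\
  strength w T = sum_over (fun v => strength v T) ws /\
  strength w T * speed w T = sum_over (fun v => strength v T * speed v T) ws /\
  0 < halfw w /\
  strip_mass eps w T = sum_over (fun v => strip_mass eps v T) ws.

(* Waves obtained from the initial ones after finitely many repetitions of the
   interaction step. *)
Inductive generated (W : wave -> Prop) : wave -> Prop :=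
| generated_initial w : W w -> birthT w = 0 -> generated W w
| generated_interaction w :
    W w -> interaction W (birthX w) (birthT w) ->
    (forall v, arrives W v (birthX w) (birthT w) -> generated W v) ->
    generated W w.

(* [W] is the set of all waves, past and present, produced by the procedure. *)
Record tracking (d : states) (eps : R) (W : wave -> Prop) : Prop := {
  tr_riemann_eq : forall i, vel d i = vel d (S i) ->
    exists! w, W w /\ contact (pt d i) (vel d i) (St i) (St (S i)) w;
  tr_riemann_lt : forall i, vel d i < vel d (S i) ->
    (exists! w, W w /\ contact (pt d i) (vel d i) (St i) (Vac i) w) /\
    (exists! w, W w /\ contact (pt d i) (vel d (S i)) (Vac i) (St (S i)) w);
  tr_riemann_gt : forall i, vel d i > vel d (S i) ->
    exists! w, W w /\ simple_shadow d i w;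
  tr_initial : forall w, W w -> birthT w = 0 ->
    exists i,
      (vel d i = vel d (S i) /\
         contact (pt d i) (vel d i) (St i) (St (S i)) w) \/
      (vel d i < vel d (S i) /\
         (contact (pt d i) (vel d i) (St i) (Vac i) w \/
          contact (pt d i) (vel d (S i)) (Vac i) (St (S i)) w)) \/
      (vel d i > vel d (S i) /\ simple_shadow d i w);
  tr_life : forall w, W w -> 0 <= birthT w /\ Rbar_lt (birthT w) (deathT w);
  tr_meet : forall v w t, W v -> W w -> v <> w ->
    birthT v < t -> birthT w < t ->
    Rbar_le t (deathT v) -> Rbar_le t (deathT w) -> line v t = line w t ->
    deathT v = Finite t /\ deathT w = Finite t;
  tr_death : forall w T, W w -> deathT w = Finite T ->
    interaction W (line w T) T;
  tr_interaction : forall X T, interaction W X T ->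
    exists ws w,
      NoDup ws /\ (forall v, In v ws <-> arrives W v X T) /\
      (forall v, (W v /\ birthX v = X /\ birthT v = T) <-> v = w) /\
      outgoing d eps ws w;
  tr_generated : forall w, W w -> generated W w;
  tr_iden_pos : forall w t, W w -> shadow w = true -> alive w t -> 0 < t ->
    0 < iden w t
}.

Definition in_strip (eps : R) (w : wave) (x t : R) : Prop :=
  shadow w = true /\ alive w t /\
  Rabs (x - line w t) < eps / 2 * (t - birthT w) + halfw w.

(* The region containing (x,t), when the strips are ignored: the right region
   of the last living wave on the left of x. *)
Definition region_at (W : wave -> Prop) (x t : R) (r : region) : Prop :=
  (forall w, W w -> alive w t -> line w t <> x) /\
  (((forall w, W w -> alive w t -> x < line w t) /\ r = St 0) \/
   exists w, W w /\ alive w t /\ line w t < x /\ rreg w = r /\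
     forall v, W v -> alive v t -> line v t < x -> line v t <= line w t).

Definition wedge (d : states) (i : nat) (p : R * R) : Prop :=
  0 < snd p /\
  pt d i + vel d i * snd p <= fst p <= pt d i + vel d (S i) * snd p.

Definition vacuum_velocity (d : states) (i : nat) (v : R * R -> R) : Prop :=
  continuous_on (wedge d i) v /\
  forall t, 0 < t ->
    v (pt d i + vel d i * t, t) = vel d i /\
    v (pt d i + vel d (S i) * t, t) = vel d (S i).

(* (rhoE, uE) is the function U^eps represented by the waves [W].  Inside a
   strip the intermediate state is used, also where the strip has already
   crossed a wave that its central line has not met yet.  Nothing is imposed
   on the intersection of two strips, nor on the lines themselves. *)
Record represents (d : states) (eps : R) (W : wave -> Prop)
    (rhoE uE : R -> R -> R) : Prop := {
  rep_left : forall x, x <= pt d 0 -> rhoE x 0 = den d 0 /\ uE x 0 = vel d 0;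
  rep_right : forall i x, pt d i < x <= pt d (S i) ->
    rhoE x 0 = den d (S i) /\ uE x 0 = vel d (S i);
  rep_strip : forall w x t, W w -> 0 < t -> in_strip eps w x t ->
    (forall v, W v -> in_strip eps v x t -> v = w) ->
    rhoE x t = iden w t /\ uE x t = ivel w t;
  rep_state : forall i x t, 0 < t ->
    (forall v, W v -> ~ in_strip eps v x t) -> region_at W x t (St i) ->
    rhoE x t = den d i /\ uE x t = vel d i;
  rep_vacuum : forall i, vel d i < vel d (S i) ->
    exists v, vacuum_velocity d i v /\
      forall x t, 0 < t ->
        (forall w, W w -> ~ in_strip eps w x t) -> region_at W x t (Vac i) ->
        rhoE x t = 0 /\ uE x t = v (x, t)
}.

(* x_eps ~ eps (x_eps = 0 being part of [simple_shadow]),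
   u_eps -> u_s, (eps (t - T) + 2 x_eps) rho_eps -> xi and rho_eps ~ 1/eps.
   As the waves themselves depend on eps, the limits are required uniformly
   over all the waves present up to any given time. *)
Definition shadow_asymptotics (eps0 : R) (W : R -> wave -> Prop) : Prop :=
  (exists kappa, 0 < kappa /\
     forall delta, 0 < delta -> exists eta, 0 < eta /\
       forall eps w, 0 < eps < eps0 -> eps < eta ->
         W eps w -> shadow w = true -> 0 < birthT w ->
         Rabs (halfw w / eps - kappa) < delta) /\
  (forall M delta, 0 < delta -> exists eta, 0 < eta /\
     forall eps w t, 0 < eps < eps0 -> eps < eta ->
       W eps w -> shadow w = true -> alive w t -> t <= M ->
       Rabs (ivel w t - speed w t) < delta /\
       Rabs ((eps * (t - birthT w) + 2 * halfw w) * iden w t - strength w t)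
         < delta /\
       (birthT w < t ->
        Rabs (eps * iden w t
              - strength w t / (t - birthT w + 2 * (halfw w / eps))) < delta)).

Definition classical_contact (d : states) (w : wave) : Prop :=
  shadow w = false /\
  exists s, velL d (lreg w) = s /\ velR d (rreg w) = s /\
    forall t, alive w t ->
      line w t = birthX w + s * (t - birthT w) /\ strength w t = 0.

Definition overcompressive (d : states) (w : wave) : Prop :=
  shadow w = true /\
  forall t, alive w t ->
    velL d (lreg w) >= speed w t /\ speed w t >= velR d (rreg w).

Definition admissible (d : states) (W : wave -> Prop) : Prop :=
  forall w, W w -> classical_contact d w \/ overcompressive d w.

(* C_0^infty(R x [0,oo)): restrictions of smooth functions on R^2. *)
Definition test_function2 (phi : R -> R -> R) : Prop :=
  (forall n x t, ex_diff_n phi n x t) /\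
  exists M, forall x t, 0 <= t -> (M < Rabs x \/ M < t) -> phi x t = 0.

Definition test_function1 (psi : R -> R) : Prop :=
  (forall n x, ex_derive_n psi n x) /\
  exists M, forall x, M < Rabs x -> psi x = 0.

Definition is_int_line (f : R -> R) (v : R) : Prop :=
  is_RInt_gen f (Rbar_locally m_infty) (Rbar_locally p_infty) v.

Definition is_int_half_line (f : R -> R) (v : R) : Prop :=
  is_RInt_gen f (at_point 0) (Rbar_locally p_infty) v.

(* [v] is the value at phi of the distribution -(d_t q + d_x f), initial term
   included. *)
Definition is_weak_value (q f : R -> R -> R) (phi : R -> R -> R) (v : R) : Prop :=
  exists (F : R -> R) (A B : R),
    (forall t, 0 < t ->
       is_int_line (fun x => q x t * Derive (fun s => phi x s) t
                             + f x t * Derive (fun y => phi y t) x) (F t)) /\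
    is_int_half_line F A /\
    is_int_line (fun x => q x 0 * phi x 0) B /\
    v = A + B.

Definition approx_conservation (eps0 : R) (q f : R -> R -> R -> R) : Prop :=
  forall phi, test_function2 phi ->
    exists J : R -> R,
      (forall eps, 0 < eps < eps0 -> is_weak_value (q eps) (f eps) phi (J eps)) /\
      filterlim J (at_right 0) (locally 0).

Definition approx_function (eps0 : R) (g : R -> R -> R) (h : R -> R) : Prop :=
  forall psi, test_function1 psi ->
    exists J : R -> R,
      (forall eps, 0 < eps < eps0 ->
         is_int_line (fun x => (g eps x - h x) * psi x) (J eps)) /\
      filterlim J (at_right 0) (locally 0).

Definition initial_datum (a l : R) (f : R -> R) (x : R) : R :=
  if Rle_dec x a then l else f x.

Definition Cb_from (a : R) (f : R -> R) : Prop :=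
  continuous_on (fun x => a <= x) f /\
  exists B, forall x, a <= x -> Rabs (f x) <= B.

(* The shadow wave starting at (X0,0), followed through its interactions. *)
Inductive front (W : wave -> Prop) (X0 : R) : wave -> Prop :=
| front_start w :
    W w -> shadow w = true -> birthX w = X0 -> birthT w = 0 -> front W X0 w
| front_next v w :
    front W X0 v -> arrives W v (birthX w) (birthT w) -> W w -> front W X0 w.

Definition is_front_speed (W : wave -> Prop) (X0 : R) (us : R -> R) : Prop :=
  forall t, 0 <= t -> exists w, front W X0 w /\ alive w t /\ us t = speed w t.

(* (X,T) = (X_{0,k}, T_{0,k}). *)
Definition front_meets_first_contact
    (d : states) (W : wave -> Prop) (k : nat) (X T : R) : Prop :=
  exists v w, front W (pt d 0) v /\ arrives W v X T /\
    contact (pt d k) (vel d k) (lreg w) (rreg w) w /\ lreg w = St k /\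
    arrives W w X T.

Definition infinitely_many_interactions (W : wave -> Prop) : Prop :=
  forall l : list (R * R), exists X T, interaction W X T /\ ~ In (X, T) l.

Definition last_interaction (W : wave -> Prop) (X T : R) : Prop :=
  interaction W X T /\
  forall X' T', interaction W X' T' -> T' < T \/ (X' = X /\ T' = T).

(* Main.v *)
(* On the right of [Y_0] the velocity increases, so the contact discontinuities
   never meet each other and bound a sequence of regions whose velocities
   increase; all the interactions take place along the single front starting at
   [Y_0], whose left state is always [(rho_0, u_0)].  Between two interactions
   the front obeys an explicitly solvable equation: its mass squared is a
   quadratic polynomial of time.  Its speed stays strictly between the adjacent
   velocities, and the barycenter identity shows that it catches up with every
   contact of speed less than [u_0] and with no other.  Against the last vacuum
   the mass times [u_0 - u_s] is conserved while the mass grows without bound, so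
   that [u_s] tends to [u_0].

   For the weak formulation, the strip of mass [xi] around the front is compared
   with a point mass [xi].  With the point mass the pairing of the solution with
   the test function is differentiable between interactions, continuous across
   them, and its derivative is exactly the integrand of the weak formulation; the
   strip changes that integrand by a multiple of its width, which is O(eps). *)

(* The conservation laws and the initial data are required for every [eps] below [eps0], while
   [u (Y eps 1) < u0] is known only for small [eps]. When no shadow wave starts, the leftmost
   contact is therefore carried along as a front of zero mass and zero width, and the estimates are
   proved for it as well. Numbering the regions from left to right makes the family of waves
   explicit: the [n]-th front separates the left state from region [S n] and ends on the right edge
   of that region. The tracking thus becomes a recursion on [n], which covers all times because the
   feet of the edges tend to infinity while all speeds are bounded by [U]. The intermediate state is
   chosen so that the mass and the velocity of the strip are exactly those of the wave. The numbers
   of cells and of interactions before a given time may grow as [eps] tends to 0, so no estimate may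
   contain them: the front is controlled by [U], [rmax] and the time alone, the errors of the cells
   crossed by the strip telescope, and the errors between interactions are proportional to the
   elapsed time. *)
Require Import Defs.
From Stdlib Require Import Arith Reals Lra Lia Psatz.
From Stdlib Require Import Classical ClassicalEpsilon FunctionalExtensionality.
From Coquelicot Require Import Coquelicot.
Open Scope R_scope.

(** * Explicit trajectory of a front between two constant states *)

Ltac mul_nonneg :=
  repeat match goal with |- 0 <= _ * _ => apply Rmult_le_pos end; try lra.

Lemma is_derive_Rconst (a t : R) : is_derive (fun _ : R => a) t 0.
Proof. exact (is_derive_const (K := R_AbsRing) (V := R_NormedModule) a t). Qed.

Lemma is_derive_Rplus (f g : R -> R) (t lf lg : R) :
  is_derive f t lf -> is_derive g t lg -> is_derive (fun x => f x + g x) t (lf + lg).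
Proof. exact (is_derive_plus (V := R_NormedModule) f g t lf lg). Qed.

Lemma is_derive_Rminus (f g : R -> R) (t lf lg : R) :
  is_derive f t lf -> is_derive g t lg -> is_derive (fun x => f x - g x) t (lf - lg).
Proof. exact (is_derive_minus (V := R_NormedModule) f g t lf lg). Qed.

Lemma is_derive_Rmult (f g : R -> R) (t lf lg : R) :
  is_derive f t lf -> is_derive g t lg ->
  is_derive (fun x => f x * g x) t (lf * g t + f t * lg).
Proof. intros Hf Hg. exact (is_derive_mult f g t lf lg Hf Hg Rmult_comm). Qed.

Record path := Path { pbirth : R; ppos : R -> R; pspd : R -> R; pmass : R -> R }.

(** Interface shared by the simple shadow wave, born without mass, and the fronts born at
    interactions. The equations hold at all times from the birth on, so that a meeting can be sought
    on an unbounded interval. *)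
Record front_path (r0 u0 rr ur : R) (p : path) : Prop := {
  fp_speed : forall t, pbirth p <= t -> ur < pspd p t < u0;
  fp_mass : forall t, pbirth p < t -> 0 < pmass p t;
  fp_mass0 : 0 <= pmass p (pbirth p);
  fp_pos : forall t, pbirth p <= t -> is_derive (ppos p) t (pspd p t);
  fp_mass_derive : forall t, pbirth p <= t ->
    is_derive (pmass p) t ((rr - r0) * pspd p t - (rr * ur - r0 * u0));
  fp_mom_derive : forall t, pbirth p <= t ->
    is_derive (fun s => pmass p s * pspd p s) t
      ((rr * ur - r0 * u0) * pspd p t - (rr * ur ^ 2 - r0 * u0 ^ 2));
  fp_spd_cont : forall t, pbirth p <= t -> continuous (pspd p) t;
  (* The barycenter of the absorbed mass, seen in the frame of speed [ur]. *)
  fp_barycenter : forall t, pbirth p <= t ->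
    let s := t - pbirth p in
    let z := ppos p t - ppos p (pbirth p) - ur * s in
    pmass p (pbirth p) * z + rr * z ^ 2 / 2 =
    pmass p (pbirth p) * (pspd p (pbirth p) - ur) * s + r0 * ((u0 - ur) * s - z) ^ 2 / 2
}.

Section Explicit.

Variables (r0 u0 rr ur T X m0 v0 : R).
Hypotheses (Hr0 : 0 < r0) (Hrr : 0 <= rr) (Hm0 : 0 < m0) (Hv0 : ur < v0 < u0).

Let D := r0 * (u0 - v0) + rr * (v0 - ur).
Let K2 := r0 * rr * (u0 - ur) ^ 2.

(** The mass after time [s]. It is also the square root of the discriminant of the quadratic
    equation that the barycenter identity gives for the displacement. *)
Definition xi_of s := sqrt (m0 ^ 2 + 2 * m0 * (r0 * (u0 - v0) + rr * (v0 - ur)) * s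
  + r0 * rr * (u0 - ur) ^ 2 * s ^ 2).

(** Displacement in the frame of speed [ur]. The root is written with the square root in the
    denominator: this needs no division by [rr - r0] and so includes equal densities. *)
Definition z_of s := (2 * (m0 * (v0 - ur)) * s + r0 * (u0 - ur) ^ 2 * s ^ 2)
  / (m0 + r0 * (u0 - ur) * s + xi_of s).

(** Relative momentum over mass: the initial mass brings [m0 * (v0 - ur)], the left matter
    swallowed, [r0 * ((u0 - ur) * s - z_of s)], has relative speed [u0 - ur], and the right matter
    is at rest in this frame. *)
Definition beta_of s :=
  (m0 * (v0 - ur) + r0 * (u0 - ur) * ((u0 - ur) * s - z_of s)) / xi_of s.

(* Absorbing constant states on both sides conserves mass and momentum; the
   resulting ordinary differential equation integrates to a quadratic equation
   for the position. *)
Definition explicit_path : path :=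
  Path T (fun t => X + ur * (t - T) + z_of (t - T))
    (fun t => ur + beta_of (t - T)) (fun t => xi_of (t - T)).

Let HD : 0 <= D.
Proof. unfold D. nra. Qed.

Let HK2 : 0 <= K2.
Proof. unfold K2. assert (0 <= (u0 - ur) ^ 2) by nra. assert (0 <= r0 * rr) by nra. nra. Qed.

Let arg_ge s : 0 <= s -> m0 ^ 2 <= m0 ^ 2 + 2 * m0 * D * s + K2 * s ^ 2.
Proof.
intros Hs. assert (0 <= 2 * m0 * D * s) by (mul_nonneg).
assert (0 <= K2 * s ^ 2) by (apply Rmult_le_pos; [lra | nra]). lra.
Qed.

Lemma xi_of_ge s : 0 <= s -> m0 <= xi_of s.
Proof.
intros Hs. unfold xi_of. rewrite <- (sqrt_pow2 m0) at 1 by lra.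
apply sqrt_le_1_alt. exact (arg_ge s Hs).
Qed.

Lemma xi_of_sqr s : 0 <= s -> xi_of s ^ 2 =
  m0 ^ 2 + 2 * m0 * (r0 * (u0 - v0) + rr * (v0 - ur)) * s + r0 * rr * (u0 - ur) ^ 2 * s ^ 2.
Proof.
intros Hs. unfold xi_of. rewrite pow2_sqrt; [reflexivity|].
generalize (arg_ge s Hs). unfold D, K2. nra.
Qed.

Lemma xi_of_0 : xi_of 0 = m0.
Proof.
unfold xi_of.
replace (m0 ^ 2 + _ + _) with (m0 ^ 2) by ring. apply sqrt_pow2; lra.
Qed.

Lemma z_of_0 : z_of 0 = 0.
Proof. unfold z_of. rewrite xi_of_0. field. lra. Qed.

Let den_pos s : 0 <= s -> 0 < m0 + r0 * (u0 - ur) * s + xi_of s.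
Proof.
intros Hs. assert (0 <= r0 * (u0 - ur) * s) by (mul_nonneg).
generalize (xi_of_ge s Hs). lra.
Qed.

(** Conservation of mass: initial mass, plus left matter [r0 * ((u0 - ur) * s - z_of s)], plus right
    matter [rr * z_of s]. Algebraically it is the quadratic formula for [z_of s]. *)
Lemma xi_of_linear s : 0 <= s ->
  xi_of s = m0 + r0 * (u0 - ur) * s + (rr - r0) * z_of s.
Proof.
intros Hs. assert (Hd := den_pos s Hs). assert (Hx := xi_of_sqr s Hs).
apply (Rmult_eq_reg_r (m0 + r0 * (u0 - ur) * s + xi_of s)); [|lra].
unfold z_of.
transitivity ((m0 + r0 * (u0 - ur) * s) * (m0 + r0 * (u0 - ur) * s + xi_of s)
  + (rr - r0) * (2 * (m0 * (v0 - ur)) * s + r0 * (u0 - ur) ^ 2 * s ^ 2)).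
- nra.
- field. lra.
Qed.

Lemma z_of_bounds s : 0 <= s -> 0 <= z_of s <= (u0 - ur) * s.
Proof.
intros Hs. assert (Hd := den_pos s Hs). assert (Hx := xi_of_ge s Hs). unfold z_of.
assert (H1 : 0 <= m0 * (v0 - ur) * s) by (mul_nonneg).
assert (H2 : 0 <= r0 * (u0 - ur) ^ 2 * s ^ 2).
{ apply Rmult_le_pos; [apply Rmult_le_pos|]; [lra | nra | nra]. }
split.
- apply Rdiv_le_0_compat; lra.
- apply Rle_div_l; [lra|].
  assert (0 <= m0 * (u0 - v0) * s) by (mul_nonneg).
  assert (0 <= (u0 - ur) * s * (xi_of s - m0)) by (mul_nonneg).
  nra.
Qed.

(** The speed is the mean of [ur], [v0] and [u0] weighted by the masses absorbed, and the positive
    weight [m0] of [v0] keeps it strictly inside. This is where overcompressivity comes from. *)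
Lemma beta_of_bounds s : 0 <= s -> 0 < beta_of s < u0 - ur.
Proof.
intros Hs. assert (Hx := xi_of_ge s Hs). assert (Hz := z_of_bounds s Hs).
assert (Hl := xi_of_linear s Hs). unfold beta_of.
assert (H1 : 0 < m0 * (v0 - ur)) by (apply Rmult_lt_0_compat; lra).
assert (H2 : 0 <= r0 * (u0 - ur) * ((u0 - ur) * s - z_of s)) by (mul_nonneg).
split.
- apply Rdiv_lt_0_compat; lra.
- apply Rlt_div_l; [lra|]. rewrite Hl.
  assert (0 < m0 * (u0 - v0)) by (apply Rmult_lt_0_compat; lra).
  assert (0 <= rr * (u0 - ur) * z_of s) by (mul_nonneg). nra.
Qed.

Lemma is_derive_xi_of s : 0 <= s ->
  is_derive xi_of s (r0 * (u0 - ur) + (rr - r0) * beta_of s).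
Proof.
intros Hs. assert (Hx := xi_of_ge s Hs). assert (Ha := arg_ge s Hs).
assert (Hl := xi_of_linear s Hs).
assert (0 < m0 ^ 2) by nra.
unfold xi_of. auto_derive.
- exact (Rlt_le_trans _ _ _ H Ha).
- change (sqrt _) with (xi_of s). unfold beta_of.
  apply (Rmult_eq_reg_r (xi_of s)); [|lra].
  transitivity (m0 * (r0 * (u0 - v0) + rr * (v0 - ur)) + r0 * rr * (u0 - ur) ^ 2 * s).
  { field. lra. }
  rewrite Rmult_plus_distr_r. rewrite Hl at 1. field. lra.
Qed.

Lemma is_derive_z_of s : 0 <= s -> is_derive z_of s (beta_of s).
Proof.
intros Hs. assert (Hd := den_pos s Hs). assert (Hx := xi_of_ge s Hs).
assert (Hl := xi_of_linear s Hs). assert (Hdx := is_derive_xi_of s Hs).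
assert (Hb : beta_of s * xi_of s =
  m0 * (v0 - ur) + r0 * (u0 - ur) * ((u0 - ur) * s - z_of s)).
{ unfold beta_of. field. lra. }
assert (Hz : z_of s * (m0 + r0 * (u0 - ur) * s + xi_of s) =
  2 * (m0 * (v0 - ur)) * s + r0 * (u0 - ur) ^ 2 * s ^ 2).
{ unfold z_of. field. lra. }
unfold z_of at 1. evar_last.
- apply is_derive_div; [| |lra].
  + auto_derive; [easy|reflexivity].
  + apply is_derive_Rplus; [|exact Hdx].
    auto_derive; [easy|reflexivity].
- unfold plus; simpl. set (den := m0 + r0 * (u0 - ur) * s + xi_of s) in *.
  (* [xi_of_linear] expresses the denominator through [xi_of] and [z_of]; the quotient rule then
     reduces to the momentum relation [Hb]. *)
  assert (E : 2 * (m0 * (v0 - ur)) + 2 * (r0 * (u0 - ur) ^ 2 * s)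
    - z_of s * (2 * (r0 * (u0 - ur)) + (rr - r0) * beta_of s) = beta_of s * den).
  { replace den with (2 * xi_of s - (rr - r0) * z_of s) by (unfold den; lra). lra. }
  simpl in Hz. rewrite <- Hz. unfold Rdiv. apply (Rmult_eq_reg_r (den ^ 2)); [|nra].
  rewrite (Rmult_assoc _ (/ _)), Rinv_l, Rmult_1_r by nra.
  transitivity (beta_of s * den * den); [|ring]. rewrite <- E. simpl. ring.
Qed.

Lemma is_derive_beta_of s : 0 <= s ->
  is_derive beta_of s ((r0 * (u0 - ur - beta_of s) ^ 2 - rr * beta_of s ^ 2) / xi_of s).
Proof.
intros Hs. assert (Hx := xi_of_ge s Hs).
unfold beta_of at 1. evar_last.
- apply is_derive_div; [|exact (is_derive_xi_of s Hs)|lra].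
  apply is_derive_Rplus; [apply is_derive_const|].
  apply is_derive_scal. apply is_derive_Rminus.
  + apply is_derive_scal, is_derive_id.
  + exact (is_derive_z_of s Hs).
- assert (Hb : beta_of s * xi_of s =
    m0 * (v0 - ur) + r0 * (u0 - ur) * ((u0 - ur) * s - z_of s)).
  { unfold beta_of. field. lra. }
  unfold plus, minus, zero, opp, one, plus, opp, one; simpl.
  unfold plus, opp, one; simpl. rewrite <- Hb. field. lra.
Qed.

Lemma explicit_front_path : front_path r0 u0 rr ur explicit_path.
Proof.
assert (shift : forall (f : R -> R) l t, is_derive f (t - T) l -> is_derive (fun t => f (t - T)) t l).
{ intros f l t H. evar_last.
  - apply (is_derive_comp f (fun t => t - T)); [exact H|]. auto_derive; [easy|reflexivity].
  - unfold scal; simpl; unfold mult; simpl. ring. }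
assert (Hd : forall t, T <= t -> 0 <= t - T) by (intros; lra).
split; simpl.
- intros t Ht. generalize (beta_of_bounds _ (Hd t Ht)). lra.
- intros t Ht. generalize (xi_of_ge (t - T)). lra.
- rewrite Rminus_diag, xi_of_0. lra.
- intros t Ht. apply (is_derive_Rplus (fun t => X + ur * (t - T))).
  + auto_derive; [easy|ring].
  + apply shift, is_derive_z_of, Hd, Ht.
- intros t Ht. evar_last; [apply shift, is_derive_xi_of, Hd, Ht|]. ring.
- intros t Ht. assert (Hx := xi_of_ge _ (Hd t Ht)). evar_last.
  + apply is_derive_Rmult.
    * apply shift, is_derive_xi_of, Hd, Ht.
    * apply (is_derive_Rplus (fun _ => ur)); [apply is_derive_const|].
      apply shift, is_derive_beta_of, Hd, Ht.
  + unfold zero; simpl. field. lra.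
- intros t Ht. apply (continuous_plus (V := R_NormedModule) (fun _ => ur)).
  + apply continuous_const.
  + apply ex_derive_continuous. eexists. apply shift, is_derive_beta_of, Hd, Ht.
- intros t Ht. rewrite Rminus_diag, xi_of_0, z_of_0.
  assert (B0 : beta_of 0 = v0 - ur).
  { unfold beta_of. rewrite xi_of_0, z_of_0. field. lra. }
  rewrite B0. set (s := t - T). assert (Hs : 0 <= s) by (unfold s; lra).
  assert (Hx := den_pos s Hs).
  assert (Hz : z_of s * (m0 + r0 * (u0 - ur) * s + xi_of s) =
    2 * (m0 * (v0 - ur)) * s + r0 * (u0 - ur) ^ 2 * s ^ 2).
  { unfold z_of. field. lra. }
  (* With the linear formula for the mass, the definition of [z_of] turns into the barycenter
     identity. *)
  rewrite (xi_of_linear s Hs) in Hz. nra.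
Qed.

Lemma explicit_path_start : pbirth explicit_path = T /\ ppos explicit_path T = X /\
  pspd explicit_path T = v0 /\ pmass explicit_path T = m0.
Proof.
simpl. rewrite Rminus_diag, xi_of_0, z_of_0. repeat split; try ring.
unfold beta_of. rewrite xi_of_0, z_of_0. field. lra.
Qed.

End Explicit.

(** * Consequences of the front equations *)

Lemma increment_le (f df : R -> R) (k a b : R) : a <= b ->
  (forall t, a <= t <= b -> is_derive f t (df t)) ->
  (forall t, a <= t <= b -> df t <= k) -> f b - f a <= k * (b - a).
Proof.
intros Hab Hd Hk.
destruct (MVT_gen f a b df) as [c [Hc E]].
- intros x Hx. rewrite Rmin_left, Rmax_right in Hx by lra. apply Hd. lra.
- intros x Hx. rewrite Rmin_left, Rmax_right in Hx by lra.
  apply continuity_pt_filterlim, (ex_derive_continuous (V := R_NormedModule)).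
  eexists. apply Hd. lra.
- rewrite Rmin_left, Rmax_right in Hc by lra. rewrite E.
  apply Rmult_le_compat_r; [lra | apply Hk; lra].
Qed.

Lemma increment_ge (f df : R -> R) (k a b : R) : a <= b ->
  (forall t, a <= t <= b -> is_derive f t (df t)) ->
  (forall t, a <= t <= b -> k <= df t) -> k * (b - a) <= f b - f a.
Proof.
intros Hab Hd Hk.
assert (H := increment_le (fun t => - f t) (fun t => - df t) (- k) a b Hab).
simpl in H. assert (- f b - - f a <= - k * (b - a)); [|lra]. apply H.
- intros t Ht. apply (is_derive_opp (V := R_NormedModule)), Hd, Ht.
- intros t Ht. specialize (Hk t Ht). lra.
Qed.

(** The zero is the supremum of the times up to which [f] has stayed negative; continuity excludes
    either strict sign there. *)
Lemma first_zero (f : R -> R) (a b : R) : a < b -> f a < 0 -> 0 <= f b ->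
  (forall t, a <= t <= b -> continuity_pt f t) ->
  exists t, a < t <= b /\ f t = 0 /\ forall s, a <= s < t -> f s < 0.
Proof.
intros Hab Ha Hb Hc.
set (E := fun t => a <= t <= b /\ forall s, a <= s <= t -> f s < 0).
destruct (completeness E) as [t [Ht1 Ht2]].
{ exists b. intros t [H _]. lra. }
{ exists a. split; [lra|]. intros s Hs. replace s with a by lra. exact Ha. }
assert (Hat : a <= t).
{ apply Ht1. split; [lra|]. intros s Hs. replace s with a by lra. exact Ha. }
assert (Htb : t <= b) by (apply Ht2; intros s [H _]; lra).
assert (Hneg : forall s, a <= s < t -> f s < 0).
{ intros s Hs. destruct (Rlt_dec (f s) 0) as [|Hn]; [assumption|]. exfalso.
  assert (t <= s); [|lra]. apply Ht2. intros r [Hr1 Hr2].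
  destruct (Rle_lt_dec r s) as [|Hrs]; [assumption|].
  assert (f s < 0) by (apply Hr2; lra). lra. }
assert (Hft : 0 <= f t).
{ destruct (Rle_lt_dec 0 (f t)) as [|Hn]; [assumption|]. exfalso.
  assert (Htb' : t < b) by (destruct Htb as [|Htb]; [assumption | subst; lra]).
  destruct (proj1 (continuity_pt_locally f t) (Hc t (conj Hat Htb))
    (mkposreal (- f t) ltac:(lra))) as [e He]. simpl in He.
  assert (Hd : 0 < Rmin (e / 2) (b - t)).
  { apply Rmin_pos; [|lra]. destruct e; simpl; lra. }
  assert (Hd1 := Rmin_l (e / 2) (b - t)). assert (Hd2 := Rmin_r (e / 2) (b - t)).
  assert (t + Rmin (e / 2) (b - t) <= t); [|lra].
  apply Ht1. split; [lra|]. intros s Hs.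
  destruct (Rlt_le_dec s t) as [Hst|Hst]; [apply Hneg; lra|].
  assert (Rabs (f s - f t) < - f t).
  { apply He. change (Rabs (s - t) < e). rewrite Rabs_pos_eq by lra.
    destruct e; simpl in *; lra. }
  apply Rabs_lt_between in H. lra. }
assert (Ht : a < t).
{ destruct Hat as [|Hat]; [assumption|]. subst t. lra. }
exists t. split; [lra|]. split; [|exact Hneg].
destruct Hft as [Hft|Hft]; [|lra]. exfalso.
destruct (proj1 (continuity_pt_locally f t) (Hc t (conj (Rlt_le _ _ Ht) Htb))
  (mkposreal (f t) Hft)) as [e He]. simpl in He.
assert (Hd : 0 < Rmin (e / 2) (t - a)).
{ apply Rmin_pos; [|lra]. destruct e; simpl; lra. }
assert (Hd1 := Rmin_l (e / 2) (t - a)). assert (Hd2 := Rmin_r (e / 2) (t - a)).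
assert (Hs : f (t - Rmin (e / 2) (t - a)) < 0) by (apply Hneg; lra).
assert (Rabs (f (t - Rmin (e / 2) (t - a)) - f t) < f t).
{ apply He. change (Rabs (t - Rmin (e / 2) (t - a) - t) < e).
  rewrite Rabs_left by lra. destruct e; simpl in *; lra. }
apply Rabs_lt_between in H. lra.
Qed.

(** Starting without mass, a constant speed solves the equations when the momentum fluxes relative
    to the front balance, [r0 * (u0 - y) ^ 2 = r1 * (y - u1) ^ 2]; hence the square roots in [y].
    Writing the densities as [a * a] and [b * b] leaves rational identities. *)
Lemma simple_front_path (r0 u0 r1 u1 X : R) : 0 < r0 -> 0 < r1 -> u1 < u0 ->
  let y := (sqrt r0 * u0 + sqrt r1 * u1) / (sqrt r0 + sqrt r1) in
  front_path r0 u0 r1 u1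
    (Path 0 (fun t => X + y * t) (fun _ => y) (fun t => sqrt (r0 * r1) * (u0 - u1) * t)).
Proof.
intros H0 H1 Hu y.
set (a := sqrt r0) in *. set (b := sqrt r1) in *.
assert (Ha : 0 < a) by (apply sqrt_lt_R0; assumption).
assert (Hb : 0 < b) by (apply sqrt_lt_R0; assumption).
assert (Ea : a * a = r0) by (apply sqrt_sqrt; lra).
assert (Eb : b * b = r1) by (apply sqrt_sqrt; lra).
assert (Eab : sqrt (r0 * r1) = a * b) by (apply sqrt_mult; lra). rewrite Eab.
assert (Hab : 0 < a * b) by (apply Rmult_lt_0_compat; assumption).
assert (Y1 : y - u1 = a * (u0 - u1) / (a + b)) by (unfold y; field; lra).
assert (Y0 : u0 - y = b * (u0 - u1) / (a + b)) by (unfold y; field; lra).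
split; simpl.
- intros _ _. split; apply Rminus_lt_0; rewrite ?Y1, ?Y0;
  apply Rdiv_lt_0_compat; try lra; apply Rmult_lt_0_compat; lra.
- intros t Ht. repeat apply Rmult_lt_0_compat; lra.
- lra.
- intros t _. auto_derive; [easy|ring].
- intros t _. auto_derive; [easy|]. rewrite <- Ea, <- Eb. unfold y. field. lra.
- intros t _. auto_derive; [easy|]. rewrite <- Ea, <- Eb. unfold y. field. lra.
- intros t _. apply continuous_const.
- intros t _. rewrite <- Ea, <- Eb. unfold y. field. lra.
Qed.

Section FrontPath.

Variables (r0 u0 rr ur : R) (p : path).
Hypotheses (Hr0 : 0 < r0) (Hrr : 0 <= rr) (Hp : front_path r0 u0 rr ur p).

Lemma fp_pos_cont t : pbirth p <= t -> continuous (ppos p) t.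
Proof.
intros Ht. apply (ex_derive_continuous (V := R_NormedModule)).
eexists. apply (fp_pos _ _ _ _ _ Hp t Ht).
Qed.

Lemma fp_pos_bounds t : pbirth p <= t ->
  ur * (t - pbirth p) <= ppos p t - ppos p (pbirth p) <= u0 * (t - pbirth p).
Proof.
intros Ht. split.
- apply (increment_ge _ (pspd p)); [lra | |]; intros x Hx.
  + apply (fp_pos _ _ _ _ _ Hp). lra.
  + generalize (fp_speed _ _ _ _ _ Hp x). lra.
- apply (increment_le _ (pspd p)); [lra | |]; intros x Hx.
  + apply (fp_pos _ _ _ _ _ Hp). lra.
  + generalize (fp_speed _ _ _ _ _ Hp x). lra.
Qed.

Lemma fp_mass_incr s t : pbirth p <= s <= t -> pmass p s <= pmass p t.
Proof.
intros Ht. assert (0 * (t - s) <= pmass p t - pmass p s); [|lra].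
eapply increment_ge; [lra | |].
- intros x Hx. apply (fp_mass_derive _ _ _ _ _ Hp). lra.
- intros x Hx. destruct (fp_speed _ _ _ _ _ Hp x) as [H1 H2]; [lra|].
  assert (0 <= rr * (pspd p x - ur)) by (apply Rmult_le_pos; lra).
  assert (0 <= r0 * (u0 - pspd p x)) by (apply Rmult_le_pos; lra). nra.
Qed.

(* Against the vacuum the momentum defect of the front is conserved. *)
Lemma vacuum_defect s t : rr = 0 -> pbirth p <= s <= t ->
  pmass p t * (u0 - pspd p t) = pmass p s * (u0 - pspd p s).
Proof.
intros Hv Ht.
assert (Hd : forall x, s <= x <= t ->
  is_derive (fun x => u0 * pmass p x - pmass p x * pspd p x) x 0).
{ intros x Hx. evar_last.
  - apply is_derive_Rminus.
    + apply is_derive_scal, (fp_mass_derive _ _ _ _ _ Hp). lra.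
    + apply (fp_mom_derive _ _ _ _ _ Hp). lra.
  - rewrite Hv. ring. }
assert (H1 := increment_le _ _ 0 s t (proj2 Ht) Hd (fun _ _ => Rle_refl 0)).
assert (H2 := increment_ge _ _ 0 s t (proj2 Ht) Hd (fun _ _ => Rle_refl 0)).
simpl in H1, H2. nra.
Qed.

Lemma vacuum_speed_incr s t : rr = 0 -> 0 < pmass p (pbirth p) ->
  pbirth p <= s <= t -> pspd p s <= pspd p t.
Proof.
intros Hv Hm Ht. assert (Hd := vacuum_defect s t Hv Ht).
assert (Hi := fp_mass_incr s t Ht).
assert (Hs := fp_mass_incr (pbirth p) s). 
destruct (fp_speed _ _ _ _ _ Hp s) as [H1 H2]; [lra|].
destruct (Rle_lt_dec (pspd p s) (pspd p t)) as [|Hlt]; [assumption|]. exfalso.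
assert (0 < pmass p s) by lra. nra.
Qed.

(** With [k] the conserved defect, the squared mass has the constant derivative [2 * r0 * k]. So the
    mass grows like the square root of time, and [u0 - pspd p t] equals [k / pmass p t]. *)
Lemma vacuum_speed_limit : rr = 0 -> 0 < pmass p (pbirth p) -> is_lim (pspd p) p_infty u0.
Proof.
intros Hv Hm. set (T := pbirth p) in *. set (k := pmass p T * (u0 - pspd p T)).
assert (HT := fp_speed _ _ _ _ _ Hp T (Rle_refl _)).
assert (Hk : 0 < k) by (apply Rmult_lt_0_compat; lra).
assert (Hsq : forall t, T <= t -> 2 * r0 * k * (t - T) <= pmass p t ^ 2 - pmass p T ^ 2).
{ intros t Ht. apply (increment_ge (fun x => pmass p x ^ 2) (fun _ => 2 * r0 * k)); try lra; [|intros; lra].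
  intros x Hx. evar_last.
  - apply is_derive_pow, (fp_mass_derive _ _ _ _ _ Hp). apply Hx.
  - unfold k. rewrite <- (vacuum_defect T x Hv) by (split; [apply Rle_refl | apply Hx]).
    rewrite Hv. simpl. ring. }
apply is_lim_spec. intros e. simpl.
(* After this time the squared mass exceeds [(k / e) ^ 2]. *)
exists (Rmax T (T + (k / e) ^ 2 / (2 * r0 * k))). intros t Ht.
assert (Ht1 := Rmax_l T (T + (k / e) ^ 2 / (2 * r0 * k))).
assert (Ht2 := Rmax_r T (T + (k / e) ^ 2 / (2 * r0 * k))).
assert (HTt : T <= t) by lra.
destruct (fp_speed _ _ _ _ _ Hp t HTt) as [H1 H2].
rewrite Rabs_left by lra.
assert (Hmt : 0 < pmass p t) by (apply Rlt_le_trans with (1 := Hm), fp_mass_incr; split; [apply Rle_refl | exact HTt]).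
assert (He := cond_pos e).
assert (Hke : 0 < k / e) by (apply Rdiv_lt_0_compat; lra).
assert (Hb : k / e < pmass p t).
{ apply Rnot_le_lt. intros Hn.
  assert (2 * r0 * k * (t - T) <= pmass p t ^ 2 - pmass p T ^ 2) by (apply Hsq; lra).
  assert (pmass p t ^ 2 <= (k / e) ^ 2) by (apply pow_incr; lra).
  assert (Hrk : 0 < 2 * r0 * k) by (repeat apply Rmult_lt_0_compat; lra).
  assert ((k / e) ^ 2 / (2 * r0 * k) < t - T) by lra.
  apply Rlt_div_l in H3; [|lra]. nra. }
apply Rlt_div_l in Hb; [|lra].
assert (Hd := vacuum_defect T t Hv). unfold k in Hb.
rewrite <- Hd in Hb by (split; [apply Rle_refl | exact HTt]).
apply (Rmult_lt_reg_l (pmass p t)); lra.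
Qed.

(* A line [P + w t] is caught up: before the meeting the barycenter identity
   would equate a quadratically growing term with a linearly growing one. *)
Lemma front_meets_line (P w : R) : w < u0 -> ur <= w -> rr * (w - ur) = 0 ->
  ppos p (pbirth p) < P + w * pbirth p ->
  exists T, pbirth p < T /\ ppos p T = P + w * T /\
    forall t, pbirth p <= t < T -> ppos p t < P + w * t.
Proof.
intros Hw Hur Hrw Hlt. set (T0 := pbirth p) in *.
set (gap := P + w * T0 - ppos p T0). assert (Hgap : 0 < gap) by (unfold gap; lra).
assert (Hex : exists t, T0 < t /\ P + w * t <= ppos p t).
{ apply NNPP. intros Hn.
  assert (Hall : forall t, T0 < t -> ppos p t < P + w * t).
  { intros t Ht. apply Rnot_le_lt. intros H. apply Hn. exists t. tauto. }
  set (m0 := pmass p T0). assert (Hm0 : 0 <= m0) by apply (fp_mass0 _ _ _ _ _ Hp).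
  (* Behind the line the displacement is at most [gap + (w - ur) * s], so the term of the left
     matter is quadratic in [s], whereas the others are at most linear. The lower bound on [s] keeps
     the quantity to be squared nonnegative. *)
  assert (Hbnd : forall s, gap / (u0 - w) < s ->
    r0 * ((u0 - w) * s - gap) ^ 2 / 2 <= m0 * (gap + (w - ur) * s) + rr * gap ^ 2 / 2).
  { intros s Hs. assert (Hs' := Hs). apply Rlt_div_l in Hs'; [|lra].
    assert (0 < gap / (u0 - w)) by (apply Rdiv_lt_0_compat; lra).
    assert (HT : T0 <= T0 + s) by lra.
    assert (Hb := fp_barycenter _ _ _ _ _ Hp (T0 + s) HT). cbv zeta in Hb.
    fold T0 in Hb. replace (T0 + s - T0) with s in Hb by ring.
    assert (Hz := Hall (T0 + s)).
    destruct (fp_pos_bounds (T0 + s) HT) as [Hz0 _]. fold T0 in Hz0.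
    replace (T0 + s - T0) with s in Hz0 by ring.
    set (z := ppos p (T0 + s) - ppos p T0 - ur * s) in *.
    assert (Hzle : z <= gap + (w - ur) * s) by (unfold z, gap; lra).
    assert (Hz0' : 0 <= z) by (unfold z; lra). fold m0 in Hb.
    destruct (fp_speed _ _ _ _ _ Hp T0 (Rle_refl _)) as [Hv1 Hv2].
    assert (0 <= m0 * (pspd p T0 - ur) * s) by (repeat apply Rmult_le_pos; lra).
    assert (m0 * z <= m0 * (gap + (w - ur) * s)) by (apply Rmult_le_compat_l; lra).
    assert (((u0 - w) * s - gap) ^ 2 <= ((u0 - ur) * s - z) ^ 2) by (apply pow_incr; lra).
    assert (z ^ 2 <= (gap + (w - ur) * s) ^ 2) by (apply pow_incr; lra).
    (* Either the region is empty or its edge moves at speed [ur]; in both cases the part growing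
       with [s] drops out. *)
    assert (rr * (gap + (w - ur) * s) ^ 2 = rr * gap ^ 2).
    { transitivity (rr * gap ^ 2 + rr * (w - ur) * (2 * gap * s + (w - ur) * s ^ 2)); [ring|].
      rewrite Hrw. ring. }
    assert (rr * z ^ 2 <= rr * gap ^ 2) by (rewrite <- H4; apply Rmult_le_compat_l; lra).
    assert (r0 * ((u0 - w) * s - gap) ^ 2 <= r0 * ((u0 - ur) * s - z) ^ 2)
      by (apply Rmult_le_compat_l; lra).
    lra. }
  set (A := r0 * (u0 - w) ^ 2 / 2).
  assert (HA : 0 < A) by (unfold A; assert (0 < (u0 - w) ^ 2) by nra; nra).
  set (B := r0 * (u0 - w) * gap + m0 * (w - ur)).
  assert (HB : 0 <= B).
  { unfold B. assert (0 <= r0 * (u0 - w) * gap) by (repeat apply Rmult_le_pos; lra).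
    assert (0 <= m0 * (w - ur)) by (apply Rmult_le_pos; lra). lra. }
  set (E := m0 * gap + rr * gap ^ 2 / 2).
  assert (HE : 0 <= E).
  { unfold E. assert (0 <= m0 * gap) by (apply Rmult_le_pos; lra).
    assert (0 <= rr * gap ^ 2) by (apply Rmult_le_pos; [lra | nra]). lra. }
  (* The summands give [s > 1], the validity of [Hbnd] at [s], and [A * s > B + E]; together they
     yield [A * s ^ 2 > B * s + E]. *)
  set (s := 1 + gap / (u0 - w) + (B + E) / A).
  assert (H1 : 0 < gap / (u0 - w)) by (apply Rdiv_lt_0_compat; lra).
  assert (H2 : 0 <= (B + E) / A) by (apply Rdiv_le_0_compat; lra).
  assert (Hs : gap / (u0 - w) < s) by (unfold s; lra).
  specialize (Hbnd s Hs).
  assert (Hq : A * s ^ 2 <= B * s + E).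
  { replace (A * s ^ 2) with (r0 * ((u0 - w) * s - gap) ^ 2 / 2 + r0 * (u0 - w) * gap * s
      - r0 * gap ^ 2 / 2) by (unfold A; field).
    assert (0 <= r0 * gap ^ 2) by (apply Rmult_le_pos; [lra | nra]).
    unfold B, E. lra. }
  assert (Hs2 : B + E < A * s).
  { unfold s. replace (A * _) with (A * (1 + gap / (u0 - w)) + (B + E)) by (field; lra).
    assert (0 < A * (1 + gap / (u0 - w))) by (apply Rmult_lt_0_compat; lra). lra. }
  assert (1 < s) by (unfold s; lra). nra. }
destruct Hex as [t1 [Ht1 Hge]].
destruct (first_zero (fun t => ppos p t - (P + w * t)) T0 t1) as [T [HT [Hz Hneg]]];
  [lra | lra | lra | |].
- intros t Ht. apply continuity_pt_minus.
  + apply continuity_pt_filterlim, fp_pos_cont, Ht.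
  + reg.
- exists T. split; [lra|]. split; [lra|]. intros t Ht. specialize (Hneg t Ht). lra.
Qed.

(** Against a vacuum the speed never decreases, so a speed of at most [w] at the meeting would have
    been at most [w] all along, and the gap could not have closed. Against matter [w] is [ur]. After
    the meeting [w] is the new right velocity, so the next front starts strictly overcompressive. *)
Lemma front_speed_at_meeting (P w T : R) : ur <= w -> rr * (w - ur) = 0 ->
  0 < pmass p (pbirth p) \/ 0 < rr -> pbirth p < T ->
  ppos p (pbirth p) < P + w * pbirth p -> ppos p T = P + w * T -> w < pspd p T.
Proof.
intros Hur Hrw Hm HT Hlt Heq.
destruct (Req_dec rr 0) as [Hv|Hv].
- assert (Hm' : 0 < pmass p (pbirth p)) by lra.
  assert (Hinc := vacuum_speed_incr).
  apply Rnot_le_lt. intros Hn.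
  assert (ppos p T - ppos p (pbirth p) <= w * (T - pbirth p)); [|lra].
  apply (increment_le _ (pspd p)); [lra | |]; intros x Hx.
  + apply (fp_pos _ _ _ _ _ Hp). lra.
  + assert (pspd p x <= pspd p T) by (apply Hinc; [exact Hv | exact Hm' | lra]). lra.
- assert (w = ur).
  { apply Rmult_integral in Hrw. destruct Hrw; [contradiction | lra]. }
  subst w. apply (fp_speed _ _ _ _ _ Hp). lra.
Qed.

Lemma front_below_fast_line (P w t : R) : u0 <= w ->
  ppos p (pbirth p) < P + w * pbirth p -> pbirth p <= t -> ppos p t < P + w * t.
Proof.
intros Hw Hlt Ht. destruct (fp_pos_bounds t Ht) as [_ H].
assert (u0 * (t - pbirth p) <= w * (t - pbirth p)) by (apply Rmult_le_compat_r; lra). lra.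
Qed.

End FrontPath.

(** * The regions of the solution without the shadow wave *)

(** Index of the partition point from which the right edge starts: both edges of [Vac i] leave
    [pt d i], as does the right edge of [St i]. *)
Definition ridx (r : region) : nat := match r with St i => i | Vac i => i end.

Definition next_region (d : states) (r : region) : region :=
  match r with
  | St i => if Rlt_dec (vel d i) (vel d (S i)) then Vac i else St (S i)
  | Vac i => St (S i)
  end.

(* The regions met from left to right. *)
Fixpoint reg (d : states) (n : nat) : region :=
  match n with O => St 0 | S n => next_region d (reg d n) end.

Definition vL (d : states) (n : nat) : R := velL d (reg d n).
Definition vR (d : states) (n : nat) : R := velR d (reg d n).
Definition dn (d : states) (n : nat) : R := rden d (reg d n).
Definition foot (d : states) (n : nat) : R := pt d (ridx (reg d n)).

(** The line between regions [n] and [S n], considered at all times, whether or not a contact still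
    runs along it. *)
Definition edge (d : states) (n : nat) (t : R) : R := foot d n + vL d n * t.

(** Monotonicity starts at index 1, since [vel d 0] belongs to the constant left state. [U] and
    [rmax] are parameters because the estimates must be uniform in [eps], while [gap] may shrink
    with it. *)
Record expanding (d : states) (gap U rmax : R) : Prop := {
  ex_gap : 0 < gap;
  ex_pt : forall i, pt d i + gap <= pt d (S i);
  ex_den : forall i, 0 < den d i <= rmax;
  ex_vel : forall i, (1 <= i)%nat -> vel d i <= vel d (S i);
  ex_bound : forall i, Rabs (vel d i) <= U
}.

(* The contact discontinuity at the right edge of the [n]-th region is part of
   the solution, unless a shadow wave starts at [pt d 0]. *)
Definition has_contact (d : states) (n : nat) : Prop :=
  n = O -> vel d 0 <= vel d 1.

Section Regions.

Variables (d : states) (gap U rmax : R).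
Hypothesis (Hd : expanding d gap U rmax).

Lemma reg_Vac_lt n i : reg d n = Vac i -> vel d i < vel d (S i).
Proof.
destruct n; simpl; [discriminate|]. unfold next_region.
destruct (reg d n) as [j|j]; [|discriminate].
destruct (Rlt_dec _ _) as [H|H]; [|discriminate]. intros [= <-]. exact H.
Qed.

Lemma reg_cases n :
  (exists i, reg d n = St i /\ reg d (S n) = St (S i) /\ vel d (S i) <= vel d i) \/
  (exists i, reg d n = St i /\ reg d (S n) = Vac i /\ vel d i < vel d (S i)) \/
  (exists i, reg d n = Vac i /\ reg d (S n) = St (S i) /\ vel d i < vel d (S i)).
Proof.
simpl. destruct (reg d n) as [i|i] eqn:E; simpl.
- destruct (Rlt_dec _ _) as [H|H]; [right; left | left]; exists i; repeat split; lra.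
- right; right. exists i. repeat split. apply (reg_Vac_lt n i E).
Qed.

Lemma reg_St_0 n : reg d n = St 0 -> n = O.
Proof.
destruct n; [easy|]. intros H.
destruct (reg_cases n) as [[i [_ [E _]]]|[[i [_ [E _]]]|[i [_ [E _]]]]]; congruence.
Qed.

(** Allows a contact to be recognised by its left region. *)
Lemma reg_inj m n : reg d m = reg d n -> m = n.
Proof.
revert n. induction m; intros n E.
- symmetry. apply reg_St_0. symmetry. exact E.
- destruct n; [exact (eq_sym (reg_St_0 (S m) E) ) || (apply reg_St_0 in E; lia)|].
  f_equal. apply IHm.
  destruct (reg_cases m) as [[i [E1 [E2 H2]]]|[[i [E1 [E2 H2]]]|[i [E1 [E2 H2]]]]];
  destruct (reg_cases n) as [[j [F1 [F2 H3]]]|[[j [F1 [F2 H3]]]|[j [F1 [F2 H3]]]]];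
  rewrite E1, F1; rewrite E2, F2 in E; try congruence;
  injection E as <-; lra.
Qed.

Lemma reg_St i : exists n, reg d n = St i.
Proof.
induction i as [|i [n IH]]; [exists O; reflexivity|].
destruct (Rlt_dec (vel d i) (vel d (S i))) as [H|H].
- exists (S (S n)). simpl. rewrite IH. simpl. destruct (Rlt_dec _ _); [reflexivity | lra].
- exists (S n). simpl. rewrite IH. simpl. destruct (Rlt_dec _ _); [lra | reflexivity].
Qed.

Lemma reg_Vac i : vel d i < vel d (S i) ->
  exists n, reg d n = St i /\ reg d (S n) = Vac i.
Proof.
intros H. destruct (reg_St i) as [n E]. exists n. split; [exact E|].
simpl. rewrite E. simpl. destruct (Rlt_dec _ _); [reflexivity | lra].
Qed.

Lemma dn_bounds n : 0 <= dn d n <= rmax.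
Proof.
unfold dn. assert (H := ex_den _ _ _ _ Hd 0).
destruct (reg d n) as [i|i]; simpl; [|lra]. assert (H' := ex_den _ _ _ _ Hd i). lra.
Qed.

Lemma vel_abs_bounds n : Rabs (vL d n) <= U /\ Rabs (vR d n) <= U.
Proof. unfold vL, vR. destruct (reg d n); simpl; split; apply (ex_bound _ _ _ _ Hd). Qed.

Lemma vR_le_vL n : vR d n <= vL d n.
Proof.
unfold vL, vR. destruct (reg d n) as [i|i] eqn:E; simpl; [lra|].
apply reg_Vac_lt in E. lra.
Qed.

(** Only empty regions spread. This cancels the flux through a right edge in the weak form, and in
    the catching-up argument it excludes right matter slower than its edge. *)
Lemma dn_gap n : dn d n * (vL d n - vR d n) = 0.
Proof. unfold dn, vL, vR. destruct (reg d n); simpl; ring. Qed.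

Lemma vR_next n : has_contact d n -> vR d (S n) = vL d n.
Proof.
intros Hn. unfold vL, vR.
destruct (reg_cases n) as [[i [E [E' H]]]|[[i [E [E' H]]]|[i [E [E' H]]]]];
  rewrite E, E'; simpl; try reflexivity.
destruct i as [|i].
- apply reg_St_0 in E. specialize (Hn E). lra.
- assert (H' := ex_vel _ _ _ _ Hd (S i) ltac:(lia)). lra.
Qed.

(* Consecutive edges either start [gap] apart or fan out of the same point. *)
Lemma edge_step n : has_contact d n ->
  (foot d n + gap <= foot d (S n) /\ vL d n <= vL d (S n)) \/
  (foot d n = foot d (S n) /\ vL d n < vL d (S n)).
Proof.
intros Hn. assert (Hv := vR_next n Hn). assert (Hl := vR_le_vL (S n)).
assert (Hp := ex_pt _ _ _ _ Hd). unfold foot in *.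
destruct (reg_cases n) as [[i [E [E' H]]]|[[i [E [E' H]]]|[i [E [E' H]]]]].
- left. rewrite E, E'. split; [apply Hp | lra].
- right. unfold vL. rewrite E, E'. split; [reflexivity | exact H].
- left. rewrite E, E'. split; [apply Hp | lra].
Qed.

Lemma foot_incr n : foot d n <= foot d (S n).
Proof.
assert (Hp := ex_pt _ _ _ _ Hd). assert (Hg := ex_gap _ _ _ _ Hd). unfold foot.
destruct (reg_cases n) as [[i [-> [-> H]]]|[[i [-> [-> H]]]|[i [-> [-> H]]]]];
  simpl; try lra; specialize (Hp i); lra.
Qed.

Lemma foot_ge n : pt d 0 <= foot d n.
Proof. induction n; [unfold foot; simpl; lra|]. generalize (foot_incr n). lra. Qed.

(** Two consecutive edges may leave the same point, around a vacuum, but never three. *)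
Lemma foot_growth n : foot d n + gap <= foot d (S (S n)).
Proof.
assert (Hp := ex_pt _ _ _ _ Hd). assert (H1 := foot_incr n). assert (H2 := foot_incr (S n)).
destruct (reg_cases n) as [[i [E [E' H]]]|[[i [E [E' H]]]|[i [E [E' H]]]]].
- assert (foot d n + gap <= foot d (S n)); [|lra]. unfold foot. rewrite E, E'. apply Hp.
- destruct (reg_cases (S n)) as [[j [F [F' H']]]|[[j [F [F' H']]]|[j [F [F' H']]]]];
    rewrite E' in F; try discriminate. injection F as <-.
  unfold foot. rewrite E, F'. apply Hp.
- assert (foot d n + gap <= foot d (S n)); [|lra]. unfold foot. rewrite E, E'. apply Hp.
Qed.

Lemma foot_unbounded x : exists N, forall n, (N <= n)%nat -> x < foot d n.
Proof.
assert (Hg := ex_gap _ _ _ _ Hd).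
assert (Hk : forall k, pt d 0 + INR k * gap <= foot d (2 * k)).
{ induction k.
  - simpl. unfold foot. simpl. lra.
  - replace (2 * S k)%nat with (S (S (2 * k))) by lia. rewrite S_INR.
    generalize (foot_growth (2 * k)). lra. }
destruct (nfloor_ex (Rmax 0 ((x - pt d 0) / gap)) (Rmax_l _ _)) as [k [_ Hk2]].
exists (2 * S k)%nat. intros n Hn.
assert (Hm : foot d (2 * S k) <= foot d n).
{ induction Hn; [lra|]. generalize (foot_incr m). lra. }
specialize (Hk (S k)). rewrite S_INR in Hk.
assert (Hx : (x - pt d 0) / gap < INR k + 1) by (generalize (Rmax_r 0 ((x - pt d 0) / gap)); lra).
apply Rlt_div_l in Hx; lra.
Qed.

Lemma has_contact_S n : has_contact d (S n).
Proof. discriminate. Qed.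

Lemma has_contact_le m n : (m <= n)%nat -> has_contact d m -> has_contact d n.
Proof. intros H Hm ->. apply Hm. lia. Qed.

Lemma vL_incr m n : (m <= n)%nat -> has_contact d m -> vL d m <= vL d n.
Proof.
induction 1 as [|n Hmn IH]; intros Hm; [lra|].
specialize (IH Hm). destruct (edge_step n); [|lra | lra].
apply (has_contact_le m n Hmn Hm).
Qed.

Lemma edge_lt m n t : 0 < t -> (m < n)%nat -> has_contact d m -> edge d m t < edge d n t.
Proof.
intros Ht Hmn Hm. assert (Hg := ex_gap _ _ _ _ Hd).
assert (Hs : forall k, has_contact d k -> edge d k t < edge d (S k) t).
{ intros k Hk. unfold edge. destruct (edge_step k Hk) as [[H1 H2]|[H1 H2]].
  - assert (vL d k * t <= vL d (S k) * t) by (apply Rmult_le_compat_r; lra). lra.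
  - assert (vL d k * t < vL d (S k) * t) by (apply Rmult_lt_compat_r; lra). lra. }
induction Hmn as [|n Hmn IH]; [apply Hs, Hm|].
apply Rlt_trans with (1 := IH), Hs. apply (has_contact_le m n); [lia | exact Hm].
Qed.

Lemma edge_le m n t : 0 <= t -> (m <= n)%nat -> has_contact d m -> edge d m t <= edge d n t.
Proof.
intros Ht Hmn Hm. unfold edge.
assert (foot d m <= foot d n).
{ clear Hm. induction Hmn; [lra|]. generalize (foot_incr m0). lra. }
assert (vL d m * t <= vL d n * t) by (apply Rmult_le_compat_r, vL_incr; assumption). lra.
Qed.

Lemma edge_lower n t : 0 <= t -> foot d n - U * t <= edge d n t.
Proof.
intros Ht. unfold edge. destruct (vel_abs_bounds n) as [H _]. apply Rabs_le_between in H.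
assert (- U * t <= vL d n * t) by (apply Rmult_le_compat_r; lra). lra.
Qed.

End Regions.

(** * The front and its successive meetings *)

Definition first_meeting (d : states) (p : path) (n : nat) (T : R) : Prop :=
  pbirth p < T /\ ppos p T = edge d n T /\
  forall t, pbirth p <= t < T -> ppos p t < edge d n t.

(** The choice is meaningful only if a meeting exists; [front_invariant] proves this for live fronts
    and edges slower than [vel d 0]. *)
Definition meeting_time (d : states) (p : path) (n : nat) : R :=
  epsilon (inhabits 0) (first_meeting d p n).

(* When no shadow wave starts at [pt d 0], the first edge serves as a front
   without mass, so that both cases can be treated alike. *)
Fixpoint front_at (d : states) (n : nat) : path :=
  match n with
  | O =>
    if Rlt_dec (vel d 1) (vel d 0) then
      Path 0 (fun t => pt d 0 + simple_speed d 0 * t) (fun _ => simple_speed d 0)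
        (fun t => sqrt (den d 0 * den d 1) * (vel d 0 - vel d 1) * t)
    else Path 0 (fun t => pt d 0 + vel d 0 * t) (fun _ => vel d 0) (fun _ => 0)
  | S k =>
    let p := front_at d k in
    let T := meeting_time d p n in
    explicit_path (den d 0) (vel d 0) (dn d (S n)) (vR d (S n)) T
      (ppos p T) (pmass p T) (pspd p T)
  end.

Definition front_birth (d : states) (n : nat) : R := pbirth (front_at d n).

(* The front catches up with the right edges of all regions up to the [n]-th. *)
Definition live (d : states) (n : nat) : Prop := n = O \/ vL d n < vel d 0.

(** The [n]-th front faces region [S n], so it ends on the right edge of that region, provided this
    edge is slower than [vel d 0]. *)
Definition front_end (d : states) (n : nat) : Rbar :=
  if Rlt_dec (vL d (S n)) (vel d 0) then Finite (front_birth d (S n)) else p_infty.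

Section Front.

Variables (d : states) (gap U rmax : R).
Hypothesis (Hd : expanding d gap U rmax).

Lemma vL_0 : vL d 0 = vel d 0.
Proof. reflexivity. Qed.

Lemma T_0 : front_birth d 0 = 0.
Proof. unfold front_birth. simpl. destruct (Rlt_dec _ _); reflexivity. Qed.

Lemma reg_1 : reg d 1 = if Rlt_dec (vel d 0) (vel d 1) then Vac 0 else St 1.
Proof. reflexivity. Qed.

Lemma no_front_live n : vel d 0 <= vel d 1 -> live d n -> n = O.
Proof.
intros Hu [H|H]; [exact H|]. exfalso.
assert (H' : vL d 0 <= vL d n).
{ apply (vL_incr d gap U rmax Hd 0 n); [lia|]. intros _. exact Hu. }
rewrite vL_0 in H'. lra.
Qed.

Lemma live_pred n : live d (S n) -> live d n.
Proof.
intros [H|H]; [discriminate|]. destruct n; [left; reflexivity|]. right.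
assert (H' := vL_incr d gap U rmax Hd (S n) (S (S n)) ltac:(lia) (has_contact_S d n)). lra.
Qed.

Lemma live_le m n : (m <= n)%nat -> live d n -> live d m.
Proof. induction 1; [easy|]. intros H'. apply IHle, live_pred, H'. Qed.

Section Shadow.

Hypothesis (Hu : vel d 1 < vel d 0).

(** The last clause feeds the recursion: the right velocity after the meeting is [vL d (S n)], and
    the explicit solution needs an initial speed strictly above it. The alternative between mass and
    density covers the first front, which has no mass but faces matter. *)
Lemma front_invariant n : live d n ->
  let p := front_at d n in
  front_path (den d 0) (vel d 0) (dn d (S n)) (vR d (S n)) p /\
  (0 < pmass p (pbirth p) \/ 0 < dn d (S n)) /\
  ppos p (pbirth p) < edge d (S n) (pbirth p) /\
  (n = O -> pbirth p = 0) /\ (n <> O -> 0 < pbirth p /\ 0 < pmass p (pbirth p)) /\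
  (vL d (S n) < vel d 0 -> first_meeting d p (S n) (front_birth d (S n)) /\
     vL d (S n) < pspd p (front_birth d (S n))).
Proof.
assert (Hden := ex_den _ _ _ _ Hd). assert (Hg := ex_gap _ _ _ _ Hd).
assert (Hmeet : forall k p,
  front_path (den d 0) (vel d 0) (dn d (S k)) (vR d (S k)) p ->
  (0 < pmass p (pbirth p) \/ 0 < dn d (S k)) ->
  ppos p (pbirth p) < edge d (S k) (pbirth p) ->
  vL d (S k) < vel d 0 ->
  first_meeting d p (S k) (meeting_time d p (S k)) /\
  vL d (S k) < pspd p (meeting_time d p (S k))).
{ intros k p Hp Hm Hlt Hw.
  assert (Hr0 := proj1 (Hden O)). assert (Hrr := proj1 (dn_bounds _ _ _ _ Hd (S k))).
  assert (Hv := vR_le_vL d (S k)). assert (Hgp := dn_gap d (S k)).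
  assert (Hex : first_meeting d p (S k) (meeting_time d p (S k))).
  { apply (epsilon_spec (inhabits 0) (first_meeting d p (S k))).
    destruct (front_meets_line _ _ _ _ p Hr0 Hrr Hp (foot d (S k)) (vL d (S k)) Hw Hv Hgp Hlt)
      as [T HT]. exists T. exact HT. }
  split; [exact Hex|]. destruct Hex as [H1 [H2 _]].
  apply (front_speed_at_meeting _ _ _ _ p Hr0 Hrr Hp (foot d (S k))); assumption. }
induction n as [|n IH]; intros Hn.
- assert (E1 : reg d 1 = St 1) by (rewrite reg_1; destruct (Rlt_dec _ _); [lra | reflexivity]).
  assert (Ef : front_at d 0 =
    Path 0 (fun t => pt d 0 + simple_speed d 0 * t) (fun _ => simple_speed d 0)
        (fun t => sqrt (den d 0 * den d 1) * (vel d 0 - vel d 1) * t)).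
  { simpl. destruct (Rlt_dec _ _); [reflexivity | contradiction]. }
  assert (Hp : front_path (den d 0) (vel d 0) (dn d 1) (vR d 1) (front_at d 0)).
  { rewrite Ef. unfold dn, vR. rewrite E1.
    apply simple_front_path; [apply Hden | apply Hden | exact Hu]. }
  assert (Hm : 0 < dn d 1) by (unfold dn; rewrite E1; apply Hden).
  assert (Hlt : ppos (front_at d 0) 0 < edge d 1 0).
  { rewrite Ef. simpl. unfold edge, foot. rewrite E1. simpl.
    assert (H := ex_pt _ _ _ _ Hd 0). lra. }
  assert (H0 : pbirth (front_at d 0) = 0) by apply T_0.
  cbv zeta. rewrite H0. split; [exact Hp|]. split; [tauto|]. split; [exact Hlt|].
  split; [reflexivity|]. split; [contradiction|].
  intros Hw. apply (Hmeet O); rewrite ?H0; tauto.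
- destruct (IH (live_pred n Hn)) as [Hp [_ [_ [H0 [Hpos Hnext]]]]]. clear IH.
  destruct Hn as [Hn|Hn]; [discriminate|].
  destruct (Hnext Hn) as [[HT [Heq _]] Hs]. set (T := front_birth d (S n)) in *.
  assert (Hb : 0 <= pbirth (front_at d n)).
  { destruct n; [rewrite H0 by reflexivity; lra | apply Rlt_le, Hpos; lia]. }
  assert (HmT := fp_mass _ _ _ _ _ Hp T HT).
  assert (HsT := fp_speed _ _ _ _ _ Hp T (Rlt_le _ _ HT)).
  assert (HV : vR d (S (S n)) = vL d (S n)) by apply (vR_next d gap U rmax Hd), has_contact_S.
  set (p := front_at d n) in *.
  assert (Ef : front_at d (S n) = explicit_path (den d 0) (vel d 0) (dn d (S (S n)))
    (vR d (S (S n))) T (ppos p T) (pmass p T) (pspd p T)) by reflexivity.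
  assert (Hr0 := proj1 (Hden O)). assert (Hrr := proj1 (dn_bounds _ _ _ _ Hd (S (S n)))).
  assert (Hv0 : vR d (S (S n)) < pspd p T < vel d 0) by (rewrite HV; lra).
  assert (Hp' := explicit_front_path (den d 0) (vel d 0) (dn d (S (S n)))
    (vR d (S (S n))) T (ppos p T) (pmass p T) (pspd p T) Hr0 Hrr HmT Hv0).
  destruct (explicit_path_start (den d 0) (vel d 0) (dn d (S (S n)))
    (vR d (S (S n))) T (ppos p T) (pmass p T) (pspd p T) HmT) as [_ [S1 [S2 S3]]].
  cbv zeta. rewrite <- Ef in *.
  assert (Eb : pbirth (front_at d (S n)) = T) by reflexivity.
  rewrite Eb.
  assert (Hlt : ppos (front_at d (S n)) T < edge d (S (S n)) T).
  { rewrite S1, Heq. apply (edge_lt d gap U rmax Hd); [lra | lia | apply has_contact_S]. }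
  assert (Hm' : 0 < pmass (front_at d (S n)) T) by (rewrite S3; exact HmT).
  split; [exact Hp'|]. split; [tauto|]. split; [exact Hlt|]. split; [discriminate|].
  split; [split; [lra | exact Hm']|].
  intros Hw. apply (Hmeet (S n)); try assumption; rewrite ?Eb; tauto.
Qed.

Lemma front_start_values n : live d (S n) ->
  let T := front_birth d (S n) in
  ppos (front_at d (S n)) T = ppos (front_at d n) T /\
  pspd (front_at d (S n)) T = pspd (front_at d n) T /\
  pmass (front_at d (S n)) T = pmass (front_at d n) T.
Proof.
intros Hn T. destruct (front_invariant n (live_pred n Hn)) as [Hp [_ [_ [_ [_ Hnext]]]]].
destruct Hn as [Hn|Hn]; [discriminate|]. destruct (Hnext Hn) as [[HT _] _].
assert (HmT := fp_mass _ _ _ _ _ Hp _ HT).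
apply (explicit_path_start (den d 0) (vel d 0) (dn d (S (S n)))
    (vR d (S (S n))) T _ _ _ HmT).
Qed.

End Shadow.

Lemma live_shadow n : live d (S n) -> vel d 1 < vel d 0.
Proof.
intros H. apply Rnot_le_lt. intros Hu. discriminate (no_front_live (S n) Hu H).
Qed.

Lemma front_end_live n : live d (S n) -> front_end d n = Finite (front_birth d (S n)).
Proof.
intros [H|H]; [discriminate|]. unfold front_end. destruct (Rlt_dec _ _); [reflexivity | lra].
Qed.

Lemma T_lt n : live d (S n) -> front_birth d n < front_birth d (S n).
Proof.
intros Hn. destruct (front_invariant (live_shadow n Hn) n (live_pred n Hn))
  as [_ [_ [_ [_ [_ H]]]]].
destruct Hn as [Hn|Hn]; [discriminate|]. apply H, Hn.
Qed.

Lemma T_ge_0 n : live d n -> 0 <= front_birth d n.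
Proof.
induction n; intros Hn; [rewrite T_0; lra|].
generalize (T_lt n Hn) (IHn (live_pred n Hn)). lra.
Qed.

Lemma T_mono m n : (m <= n)%nat -> live d n -> front_birth d m <= front_birth d n.
Proof.
induction 1; intros Hn; [lra|]. generalize (T_lt m0 Hn) (IHle (live_pred m0 Hn)). lra.
Qed.

Lemma T_smono m n : (m < n)%nat -> live d n -> front_birth d m < front_birth d n.
Proof.
intros H Hn. apply Rlt_le_trans with (front_birth d (S m)).
- apply T_lt, (live_le _ n); [lia | exact Hn].
- apply T_mono; [lia | exact Hn].
Qed.

Definition lives_at (n : nat) (t : R) : Prop :=
  live d n /\ front_birth d n <= t /\ Rbar_lt t (front_end d n).

(** The closed lifetime: derivatives and integrals are needed up to and including the meeting. *)
Definition upto (n : nat) (t : R) : Prop :=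
  live d n /\ front_birth d n <= t /\ Rbar_le t (front_end d n).

Lemma lives_upto n t : lives_at n t -> upto n t.
Proof. intros [H1 [H2 H3]]. repeat split; try assumption. apply Rbar_lt_le, H3. Qed.

Lemma upto_pos n t : upto n t -> 0 <= t.
Proof. intros [H1 [H2 _]]. generalize (T_ge_0 n H1). lra. Qed.

Lemma upto_no_front n t : vel d 0 <= vel d 1 -> upto n t -> n = O.
Proof. intros Hu [H _]. apply no_front_live; assumption. Qed.

Lemma front_no_shadow : vel d 0 <= vel d 1 ->
  front_at d 0 = Path 0 (fun t => pt d 0 + vel d 0 * t) (fun _ => vel d 0) (fun _ => 0).
Proof. intros Hu. simpl. destruct (Rlt_dec _ _); [lra | reflexivity]. Qed.

Lemma vR_1_no_shadow : vel d 0 <= vel d 1 -> vR d 1 = vel d 0.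
Proof.
intros Hu. rewrite (vR_next d gap U rmax Hd 0); [reflexivity | intros _; exact Hu].
Qed.

(** Collects the equations with non-strict bounds, in a form that also holds for the massless
    front. *)
Lemma front_mass_jump n t : upto n t ->
  is_derive (ppos (front_at d n)) t (pspd (front_at d n) t) /\
  is_derive (pmass (front_at d n)) t ((dn d (S n) - den d 0) * pspd (front_at d n) t
    - (dn d (S n) * vR d (S n) - den d 0 * vel d 0)) /\
  is_derive (fun s => pmass (front_at d n) s * pspd (front_at d n) s) t
    ((dn d (S n) * vR d (S n) - den d 0 * vel d 0) * pspd (front_at d n) t
    - (dn d (S n) * vR d (S n) ^ 2 - den d 0 * vel d 0 ^ 2)) /\
  continuous (pspd (front_at d n)) t /\
  vR d (S n) <= pspd (front_at d n) t <= vel d 0 /\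
  0 <= pmass (front_at d n) t.
Proof.
intros Hn. destruct (Rlt_le_dec (vel d 1) (vel d 0)) as [Hu|Hu].
- destruct Hn as [Hn [Ht _]]. destruct (front_invariant Hu n Hn) as [Hp _].
  assert (Hs := fp_speed _ _ _ _ _ Hp t Ht).
  split; [apply (fp_pos _ _ _ _ _ Hp t Ht)|].
  split; [apply (fp_mass_derive _ _ _ _ _ Hp t Ht)|].
  split; [apply (fp_mom_derive _ _ _ _ _ Hp t Ht)|].
  split; [apply (fp_spd_cont _ _ _ _ _ Hp t Ht)|]. split; [lra|].
  destruct Ht as [Ht|Ht]; [apply Rlt_le, (fp_mass _ _ _ _ _ Hp t Ht)|].
  rewrite <- Ht. apply (fp_mass0 _ _ _ _ _ Hp).
- rewrite (upto_no_front n t Hu Hn), front_no_shadow by exact Hu. simpl.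
  assert (HV := vR_1_no_shadow Hu). rewrite HV.
  assert (Hz : dn d 1 = 0 \/ vel d 0 = vel d 1).
  { unfold dn. rewrite reg_1. destruct (Rlt_dec _ _); [left; reflexivity | right; lra]. }
  split; [auto_derive; [easy|ring]|].
  split; [auto_derive; [easy|]; destruct Hz as [-> | ->]; ring|].
  split; [auto_derive; [easy|]; destruct Hz as [-> | ->]; ring|].
  split; [apply continuous_const | lra].
Qed.

Lemma front_bracket n t : upto n t ->
  ppos (front_at d n) t <= edge d (S n) t /\
  (lives_at n t -> 0 < t -> ppos (front_at d n) t < edge d (S n) t \/
     vel d 0 <= vel d 1).
Proof.
intros Hn. destruct (Rlt_le_dec (vel d 1) (vel d 0)) as [Hu|Hu].
- destruct Hn as [Hn [Ht He]].
  destruct (front_invariant Hu n Hn) as [Hp [_ [Hlt [_ [_ Hnext]]]]].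
  unfold lives_at, front_end in *.
  destruct (Rlt_dec (vL d (S n)) (vel d 0)) as [Hw|Hw].
  + destruct (Hnext Hw) as [[HT [Heq Hbefore]] _]. simpl in He. split.
    * destruct He as [He|He]; [apply Rlt_le, Hbefore; unfold front_birth in *; lra|].
      subst t. rewrite Heq. lra.
    * intros [_ [_ H]] _. simpl in H. left. apply Hbefore. unfold front_birth in *; lra.
  + assert (ppos (front_at d n) t < edge d (S n) t); [|split; intros; lra].
    apply (front_below_fast_line _ _ _ _ _ Hp (foot d (S n)) (vL d (S n))); try lra; exact Hlt || exact Ht.
- rewrite (upto_no_front n t Hu Hn), front_no_shadow by exact Hu. simpl.
  assert (H := edge_le d gap U rmax Hd 0 1 t (upto_pos n t Hn) ltac:(lia) (fun _ => Hu)).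
  change (edge d 0 t) with (pt d 0 + vel d 0 * t) in H. tauto.
Qed.

Lemma front_at_meeting n : live d (S n) ->
  let T := front_birth d (S n) in
  ppos (front_at d (S n)) T = ppos (front_at d n) T /\
  pspd (front_at d (S n)) T = pspd (front_at d n) T /\
  pmass (front_at d (S n)) T = pmass (front_at d n) T /\
  ppos (front_at d n) T = edge d (S n) T /\
  upto n T.
Proof.
intros Hn T. assert (Hu := live_shadow n Hn).
destruct (front_start_values Hu n Hn) as [H1 [H2 H3]].
destruct (front_invariant Hu n (live_pred n Hn)) as [_ [_ [_ [_ [_ H]]]]].
repeat split; try assumption.
- destruct Hn as [Hn|Hn]; [discriminate|]. apply H, Hn.
- apply live_pred, Hn.
- apply Rlt_le, T_lt, Hn.
- rewrite front_end_live by exact Hn. apply Rle_refl.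
Qed.

Lemma front_increments n s t : front_birth d n <= s <= t -> upto n t ->
  - U * (t - s) <= ppos (front_at d n) t - ppos (front_at d n) s <= vel d 0 * (t - s) /\
  pmass (front_at d n) t - pmass (front_at d n) s <= 4 * rmax * U * (t - s).
Proof.
intros Hs [Hn [Ht He]].
assert (Hup : forall x, s <= x <= t -> upto n x).
{ intros x Hx. split; [exact Hn|]. split; [lra|].
  apply Rbar_le_trans with (2 := He). simpl. lra. }
assert (HV := proj2 (vel_abs_bounds d gap U rmax Hd (S n))). apply Rabs_le_between in HV.
assert (HU0 := ex_bound _ _ _ _ Hd 0). apply Rabs_le_between in HU0.
assert (Hr := ex_den _ _ _ _ Hd 0). assert (Hr' := dn_bounds _ _ _ _ Hd (S n)).
split; [split|].
- apply (increment_ge _ (pspd (front_at d n))); [lra | |]; intros x Hx;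
    destruct (front_mass_jump n x (Hup x Hx)) as [H1 [_ [_ [_ [H2 _]]]]]; [exact H1 | lra].
- apply (increment_le _ (pspd (front_at d n))); [lra | |]; intros x Hx;
    destruct (front_mass_jump n x (Hup x Hx)) as [H1 [_ [_ [_ [H2 _]]]]]; [exact H1 | lra].
- eapply increment_le; [lra | |]; intros x Hx;
    destruct (front_mass_jump n x (Hup x Hx)) as [_ [H1 [_ [_ [H2 _]]]]]; [exact H1|].
  set (v := pspd (front_at d n) x) in *.
  assert (den d 0 * (vel d 0 - v) <= rmax * (2 * U)) by (apply Rmult_le_compat; lra).
  assert (dn d (S n) * (v - vR d (S n)) <= rmax * (2 * U)) by (apply Rmult_le_compat; lra).
  cbv beta. fold v. lra.
Qed.

(** Position and mass are continuous through the meetings and their rates are bounded independently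
    of [n], so the number of past interactions does not enter. *)
Lemma front_range n t : upto n t ->
  pt d 0 - U * t <= ppos (front_at d n) t <= pt d 0 + vel d 0 * t /\
  pmass (front_at d n) t <= 4 * rmax * U * t.
Proof.
revert t. induction n as [|n IH]; intros t Hn.
- assert (Hi := front_increments 0 (front_birth d 0) t).
  assert (E : ppos (front_at d 0) (front_birth d 0) = pt d 0 /\ pmass (front_at d 0) (front_birth d 0) = 0).
  { rewrite T_0. simpl. destruct (Rlt_dec _ _); simpl; lra. }
  destruct E as [E1 E2]. rewrite E1, E2, T_0 in Hi.
  assert (H := upto_pos 0 t Hn). destruct Hi as [Hi1 Hi2]; [lra | exact Hn | lra].
- destruct (front_at_meeting n (proj1 Hn)) as [E1 [_ [E2 [_ Hup]]]].
  destruct (IH _ Hup) as [H1 H2].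
  destruct (front_increments (S n) (front_birth d (S n)) t) as [Hi1 Hi2];
    [split; [lra | apply Hn] | exact Hn|]. lra.
Qed.

(** After swallowing an edge the front has the velocity of that edge as its right velocity, hence
    stays ahead of it. *)
Lemma front_right_of_edge n t : upto n t ->
  (n <> O -> edge d n t <= ppos (front_at d n) t) /\
  pt d 0 + vR d 1 * t <= ppos (front_at d n) t.
Proof.
assert (Hlow : forall n t, upto n t -> ppos (front_at d n) (front_birth d n) +
  vR d (S n) * (t - front_birth d n) <= ppos (front_at d n) t).
{ intros k s Hk. assert (vR d (S k) * (s - front_birth d k) <=
    ppos (front_at d k) s - ppos (front_at d k) (front_birth d k)); [|lra].
  destruct Hk as [Hk [Hs He]].
  apply (increment_ge _ (pspd (front_at d k))); [exact Hs | |]; intros x Hx;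
  assert (Hup : upto k x) by (split; [exact Hk|]; split; [lra|];
    apply Rbar_le_trans with (2 := He); simpl; lra);
  destruct (front_mass_jump k x Hup) as [H1 [_ [_ [_ [H2 _]]]]]; [exact H1 | lra]. }
assert (Hedge : forall n t, upto n t -> n <> O -> edge d n t <= ppos (front_at d n) t).
{ intros k s Hk Hk0. destruct k as [|k]; [contradiction|].
  assert (H := Hlow _ _ Hk). destruct (front_at_meeting k (proj1 Hk)) as [E1 [_ [_ [E2 _]]]].
  rewrite E1, E2, (vR_next d gap U rmax Hd (S k) (has_contact_S d k)) in H.
  unfold edge in *. lra. }
intros Hn. split; [apply Hedge, Hn|].
destruct n as [|n].
- assert (H := Hlow _ _ Hn). rewrite T_0 in H.
  assert (E : ppos (front_at d 0) 0 = pt d 0).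
  { simpl. destruct (Rlt_dec _ _); simpl; lra. }
  rewrite E in H. lra.
- assert (H := Hedge _ _ Hn ltac:(discriminate)).
  assert (H1 := edge_le d gap U rmax Hd 1 (S n) t (upto_pos _ _ Hn) ltac:(lia) (has_contact_S d 0)).
  assert (Hf : pt d 0 <= foot d 1) by apply (foot_ge d gap U rmax Hd).
  assert (vR d 1 * t <= vL d 1 * t).
  { apply Rmult_le_compat_r; [apply (upto_pos _ _ Hn) | apply vR_le_vL]. }
  unfold edge in *. lra.
Qed.

(** Interactions do not accumulate: a meeting with edge [n] at time [t] forces
    [foot d n - U * t <= pt d 0 + U * t], and the feet tend to infinity. *)
Lemma T_unbounded t : exists N, forall n, (N <= n)%nat -> live d n -> t < front_birth d n.
Proof.
assert (HU0 := ex_bound _ _ _ _ Hd 0). apply Rabs_le_between in HU0.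
set (s := Rmax 0 t). assert (Hs1 := Rmax_l 0 t). assert (Hs2 := Rmax_r 0 t). fold s in Hs1, Hs2.
destruct (foot_unbounded d gap U rmax Hd (pt d 0 + 2 * U * s)) as [N HN].
exists (S N). intros n HNn Hn. destruct n as [|n]; [lia|].
destruct (front_at_meeting n Hn) as [_ [_ [_ [E Hup]]]].
destruct (front_range n _ Hup) as [[_ H] _].
assert (H' := edge_lower d gap U rmax Hd (S n) (front_birth d (S n)) (T_ge_0 _ Hn)).
specialize (HN (S n) ltac:(lia)).
apply Rnot_le_lt. intros Hle.
assert (vel d 0 * front_birth d (S n) <= U * front_birth d (S n)).
{ apply Rmult_le_compat_r; [apply T_ge_0, Hn | lra]. }
assert (2 * U * front_birth d (S n) <= 2 * U * s) by (apply Rmult_le_compat_l; lra). lra.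
Qed.

Lemma lives_at_exists t : 0 <= t -> exists n, lives_at n t.
Proof.
intros Ht. destruct (T_unbounded t) as [N HN].
assert (H : forall k, (exists n, lives_at n t) \/ (live d k /\ front_birth d k <= t)).
{ induction k as [|k IH].
  - right. split; [left; reflexivity | rewrite T_0; exact Ht].
  - destruct IH as [IH|[H1 H2]]; [left; exact IH|].
    destruct (Rlt_dec (vL d (S k)) (vel d 0)) as [Hw|Hw].
    + destruct (Rlt_le_dec t (front_birth d (S k))) as [Hlt|Hge].
      * left. exists k. repeat split; try assumption.
        rewrite front_end_live by (right; exact Hw). exact Hlt.
      * right. split; [right; exact Hw | exact Hge].
    + left. exists k. repeat split; try assumption.
      unfold front_end. destruct (Rlt_dec _ _); [contradiction | exact I]. }
destruct (H N) as [H1|[H1 H2]]; [exact H1|].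
specialize (HN N (Nat.le_refl N) H1). lra.
Qed.

Lemma lives_at_unique m n t : lives_at m t -> lives_at n t -> m = n.
Proof.
assert (H : forall m n, lives_at m t -> lives_at n t -> ~ (m < n)%nat).
{ intros i j [Hi1 [Hi2 Hi3]] [Hj1 [Hj2 Hj3]] Hij.
  rewrite front_end_live in Hi3 by (apply (live_le _ j); assumption). simpl in Hi3.
  assert (front_birth d (S i) <= front_birth d j) by (apply T_mono; assumption). lra. }
intros Hm Hn. destruct (Nat.lt_total m n) as [H1|[H1|H1]]; [|exact H1|];
  exfalso; [apply (H m n) | apply (H n m)]; assumption.
Qed.

End Front.

(** * The waves *)

(** Edge [S k] is the one met by front [k]. The contact of index 0 exists only when no shadow wave
    starts at [pt d 0], and then nothing catches up with it. *)
Definition contact_end (d : states) (n : nat) : Rbar :=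
  match n with O => p_infty | S k => front_end d k end.

Definition contact_wave (d : states) (n : nat) : wave :=
  Wave false (foot d n) 0 (contact_end d n) (reg d n) (reg d (S n))
    (edge d n) (fun _ => vL d n) (fun _ => 0) 0 (fun _ => 0) (fun _ => 0).

Definition halfwidth (eps : R) (n : nat) : R := match n with O => 0 | S _ => eps end.

(* The value for [n = 0] is [pmass / (eps t)], extended to [t = 0]. *)
Definition strip_den (d : states) (eps : R) (n : nat) (t : R) : R :=
  match n with
  | O => sqrt (den d 0 * den d 1) * (vel d 0 - vel d 1) / eps
  | S _ => pmass (front_at d n) t / (eps * (t - front_birth d n) + 2 * eps)
  end.

Definition front_wave (d : states) (eps : R) (n : nat) : wave :=
  let p := front_at d n in
  Wave true (ppos p (front_birth d n)) (front_birth d n) (front_end d n) (St 0) (reg d (S n))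
    (ppos p) (pspd p) (pmass p) (halfwidth eps n) (strip_den d eps n) (pspd p).

Inductive waves (d : states) (eps : R) : wave -> Prop :=
| waves_contact n : has_contact d n -> waves d eps (contact_wave d n)
| waves_front n : vel d 1 < vel d 0 -> live d n -> waves d eps (front_wave d eps n).

Lemma continuous_right_continuous (f : R -> R) (T : R) :
  continuous f T -> right_continuous f T.
Proof.
intros H. apply (filterlim_filter_le_1 (F := locally T)); [|exact H].
intros P HP. apply filter_le_within, HP.
Qed.

Section Tracking.

Variables (d : states) (gap U rmax eps : R).
Hypotheses (Hd : expanding d gap U rmax) (Heps : 0 < eps).

Let live_pred := live_pred d gap U rmax Hd.
Let live_shadow := live_shadow d gap U rmax Hd.

Lemma front_0_shadow : vel d 1 < vel d 0 -> front_at d 0 =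
  Path 0 (fun t => pt d 0 + simple_speed d 0 * t) (fun _ => simple_speed d 0)
    (fun t => sqrt (den d 0 * den d 1) * (vel d 0 - vel d 1) * t).
Proof. intros Hu. simpl. destruct (Rlt_dec _ _); [reflexivity | contradiction]. Qed.

(** The density of the strip is defined through its width, so the mass is exact at every time.
    Continuity of mass at an interaction and the limits required of the strip both follow without
    error terms. *)
Lemma strip_mass_front n t : vel d 1 < vel d 0 -> front_birth d n <= t ->
  strip_mass eps (front_wave d eps n) t = pmass (front_at d n) t.
Proof.
intros Hu Ht. unfold strip_mass. cbn [shadow front_wave birthT halfw iden].
destruct n as [|n]; unfold strip_den, halfwidth.
- rewrite (front_0_shadow Hu), T_0. simpl. field. lra.
- field. assert (0 <= eps * (t - front_birth d (S n))) by (apply Rmult_le_pos; lra). lra.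
Qed.

Lemma front_end_finite n T : front_end d n = Finite T -> T = front_birth d (S n) /\ live d (S n).
Proof.
unfold front_end. destruct (Rlt_dec _ _) as [H|H]; [|discriminate].
intros [= <-]. split; [reflexivity | right; exact H].
Qed.

Lemma waves_arrives w X T : arrives (waves d eps) w X T -> exists n,
  live d (S n) /\ T = front_birth d (S n) /\ X = edge d (S n) T /\
  (w = front_wave d eps n \/ w = contact_wave d (S n)).
Proof.
intros [Hw [HbT [HdT HX]]]. destruct Hw as [n Hn|n Hu Hn].
- destruct n as [|n]; [discriminate|]. simpl in HdT, HX.
  destruct (front_end_finite n T HdT) as [E Hl]. exists n.
  split; [exact Hl|]. split; [exact E|]. split; [symmetry; exact HX | tauto].
- simpl in HdT, HX. destruct (front_end_finite n T HdT) as [E Hl].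
  exists n. split; [exact Hl|]. split; [exact E|]. split; [|tauto]. rewrite <- HX, E.
  apply (front_at_meeting d gap U rmax Hd n Hl).
Qed.

Lemma T_S_pos n : live d (S n) -> 0 < front_birth d (S n).
Proof.
intros H. apply Rle_lt_trans with (front_birth d n).
- apply (T_ge_0 d gap U rmax Hd), live_pred, H.
- apply (T_lt d gap U rmax Hd), H.
Qed.

Lemma arrives_front n : live d (S n) ->
  arrives (waves d eps) (front_wave d eps n) (edge d (S n) (front_birth d (S n))) (front_birth d (S n)).
Proof.
intros H. split; [apply waves_front; [apply (live_shadow n), H | apply live_pred, H]|].
split; [apply (T_lt d gap U rmax Hd), H|].
split; [apply front_end_live, H | apply (front_at_meeting d gap U rmax Hd n H)].
Qed.

Lemma arrives_contact n : live d (S n) ->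
  arrives (waves d eps) (contact_wave d (S n)) (edge d (S n) (front_birth d (S n))) (front_birth d (S n)).
Proof.
intros H. split; [apply waves_contact, has_contact_S|].
split; [apply T_S_pos, H|].
split; [apply front_end_live, H | reflexivity].
Qed.

Lemma front_neq_contact n m : front_wave d eps n <> contact_wave d m.
Proof. intros H. apply (f_equal shadow) in H. discriminate H. Qed.

Lemma waves_interaction X T : interaction (waves d eps) X T <->
  exists n, live d (S n) /\ T = front_birth d (S n) /\ X = edge d (S n) T.
Proof.
split.
- intros [v [w [_ [Hv _]]]]. destruct (waves_arrives v X T Hv) as [n Hn].
  exists n. tauto.
- intros [n [Hn [-> ->]]]. exists (front_wave d eps n), (contact_wave d (S n)).
  split; [apply front_neq_contact|].
  split; [apply arrives_front | apply arrives_contact]; exact Hn.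
Qed.

Lemma T_inj m n : live d m -> live d n -> front_birth d m = front_birth d n -> m = n.
Proof.
intros Hm Hn E. destruct (Nat.lt_total m n) as [H|[H|H]]; [exfalso|exact H|exfalso].
- assert (H' := T_smono d gap U rmax Hd m n H Hn). lra.
- assert (H' := T_smono d gap U rmax Hd n m H Hm). lra.
Qed.

Lemma contact_wave_contact n : contact (foot d n) (vL d n) (reg d n) (reg d (S n)) (contact_wave d n).
Proof. repeat split. Qed.

Lemma waves_contact_unique n X s r w :
  waves d eps w -> contact X s (reg d n) r w -> w = contact_wave d n.
Proof.
intros [m Hm|m Hu Hm] [Hs [_ [_ [Hl _]]]]; [|discriminate].
simpl in Hl. apply reg_inj in Hl. subst. reflexivity.
Qed.

Lemma exists_unique_contact n X s r : has_contact d n -> X = foot d n -> s = vL d n ->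
  r = reg d (S n) -> exists! w, waves d eps w /\ contact X s (reg d n) r w.
Proof.
intros Hn -> -> ->. exists (contact_wave d n). split.
- split; [apply waves_contact, Hn | apply contact_wave_contact].
- intros w [Hw Hc]. symmetry. apply (waves_contact_unique n _ _ _ w Hw Hc).
Qed.

Lemma simple_shadow_front : vel d 1 < vel d 0 ->
  simple_shadow d 0 (front_wave d eps 0).
Proof.
intros Hu. unfold simple_shadow, front_wave. rewrite (front_0_shadow Hu), T_0. simpl.
assert (E : reg d 1 = St 1) by (simpl; destruct (Rlt_dec _ _); [lra | reflexivity]).
simpl in E. rewrite E. repeat split; ring.
Qed.

(** Contacts of smaller index are dead when the [n]-th front is born; those of larger index lie
    strictly beyond the edge that bounds the front on the right. *)
Lemma front_meets_contact_only m n t : vel d 1 < vel d 0 -> has_contact d m -> live d n ->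
  front_birth d n < t -> Rbar_le t (contact_end d m) -> Rbar_le t (front_end d n) ->
  edge d m t = ppos (front_at d n) t -> m = S n /\ front_end d n = Finite t.
Proof.
intros Hu Hm Hn Ht He1 He2 E.
assert (Hup : upto d n t) by (split; [exact Hn | split; [lra | exact He2]]).
assert (Ht0 : 0 < t) by (generalize (T_ge_0 d gap U rmax Hd n Hn); lra).
destruct (front_bracket d gap U rmax Hd n t Hup) as [Hb1 Hb2].
destruct (Nat.lt_total m (S n)) as [H|[H|H]].
- exfalso. destruct m as [|k]; [specialize (Hm eq_refl); lra|].
  assert (Hk : live d (S k)) by (apply (live_le d gap U rmax Hd (S k) n); [lia | exact Hn]).
  simpl in He1. rewrite (front_end_live d k Hk) in He1. simpl in He1.
  assert (front_birth d (S k) <= front_birth d n) by (apply (T_mono d gap U rmax Hd); [lia | exact Hn]). lra.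
- subst m. split; [reflexivity|].
  destruct (Rbar_le_lt_or_eq_dec _ _ He2) as [Hlt|Heq]; [|symmetry; exact Heq].
  exfalso. destruct (Hb2 (conj Hn (conj (Rlt_le _ _ Ht) Hlt)) Ht0); lra.
- exfalso. assert (edge d (S n) t < edge d m t); [|lra].
  apply (edge_lt d gap U rmax Hd); [exact Ht0 | exact H | apply has_contact_S].
Qed.

Lemma front_0_birth n : live d n -> front_birth d n = 0 -> n = O.
Proof.
intros Hn E. destruct n as [|n]; [reflexivity|].
generalize (T_S_pos n Hn). lra.
Qed.

Lemma front_right_continuous n : live d n ->
  right_continuous (ppos (front_at d n)) (front_birth d n) /\
  right_continuous (pspd (front_at d n)) (front_birth d n) /\
  right_continuous (pmass (front_at d n)) (front_birth d n).
Proof.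
intros Hn. assert (Hup : upto d n (front_birth d n)).
{ split; [exact Hn|]. split; [apply Rle_refl|].
  destruct (Rlt_dec (vL d (S n)) (vel d 0)) as [Hw|Hw]; unfold front_end;
    destruct (Rlt_dec _ _); try contradiction; [|exact I].
  simpl. apply Rlt_le, (T_lt d gap U rmax Hd). right. exact Hw. }
destruct (front_mass_jump d gap U rmax Hd n _ Hup) as [H1 [H2 [_ [H3 _]]]].
split; [|split]; apply continuous_right_continuous.
- apply (ex_derive_continuous (V := R_NormedModule)). eexists. exact H1.
- exact H3.
- apply (ex_derive_continuous (V := R_NormedModule)). eexists. exact H2.
Qed.

Lemma outgoing_front n : live d (S n) ->
  outgoing d eps (front_wave d eps n :: contact_wave d (S n) :: nil) (front_wave d eps (S n)).
Proof.
intros Hn. assert (Hu := live_shadow n Hn). assert (Hn' := live_pred n Hn).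
assert (HT := T_lt d gap U rmax Hd n Hn). assert (HT0 := T_ge_0 d gap U rmax Hd n Hn').
destruct (front_at_meeting d gap U rmax Hd n Hn) as [E1 [E2 [E3 [E4 Hup]]]].
assert (Hleft : at_left (front_birth d (S n))
  (fun t => line (front_wave d eps n) t < line (contact_wave d (S n)) t)).
{ exists (mkposreal _ (proj1 (Rminus_lt_0 _ _) HT)). intros y Hy Hlt.
  change (Rabs (y - front_birth d (S n)) < front_birth d (S n) - front_birth d n) in Hy.
  apply Rabs_lt_between in Hy. simpl.
  assert (Hl : lives_at d n y).
  { split; [exact Hn'|]. split; [lra|]. rewrite (front_end_live d n Hn). exact Hlt. }
  destruct (front_bracket d gap U rmax Hd n y (lives_upto d n y Hl)) as [_ H].
  destruct (H Hl); lra. }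
unfold outgoing. cbv zeta. change (birthT (front_wave d eps (S n))) with (front_birth d (S n)).
split; [reflexivity|].
split. { exists (front_wave d eps n). split; [|reflexivity]. split; [left; reflexivity|].
  intros v' [<-|[<-|[]]] Hv'; [contradiction | exact Hleft]. }
split. { exists (contact_wave d (S n)). split; [|reflexivity]. split; [right; left; reflexivity|].
  intros v' [<-|[<-|[]]] Hv'; [exact Hleft | contradiction]. }
split. { split; [reflexivity|]. cbn [front_wave birthT line speed strength].
  destruct (front_right_continuous (S n) Hn) as [R1 [R2 R3]].
  split; [exact R1|]. split; [exact R2|]. split; [exact R3|].
  intros t Ht He.
  destruct (front_mass_jump d gap U rmax Hd (S n) t) as [D1 [D2 [D3 _]]].
  { split; [exact Hn | split; [lra | exact He]]. }
  split; [exact D1 | split; [exact D2 | exact D3]]. }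
unfold sum_over. cbn [map fold_right].
split. { cbn [front_wave contact_wave strength]. rewrite E3. ring. }
split. { cbn [front_wave contact_wave strength speed]. rewrite E2, E3. ring. }
split; [exact Heps|].
rewrite !strip_mass_front by lra. rewrite E3. unfold strip_mass. simpl. ring.
Qed.

Lemma waves_tracking : tracking d eps (waves d eps).
Proof.
assert (Hvel := ex_vel _ _ _ _ Hd).
assert (Hc : forall n i, reg d n = St i -> vel d i <= vel d (S i) -> has_contact d n).
{ intros n i E H ->. injection E as <-. exact H. }
assert (Hgt : forall i, vel d i > vel d (S i) -> i = O).
{ intros [|i] H; [reflexivity|]. specialize (Hvel (S i) ltac:(lia)). lra. }
split.
- intros i H. destruct (reg_St d i) as [n E]. rewrite <- E.
  apply exists_unique_contact.
  + apply (Hc n i E). lra.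
  + unfold foot. rewrite E. reflexivity.
  + unfold vL. rewrite E. reflexivity.
  + simpl. rewrite E. simpl. destruct (Rlt_dec _ _); [lra | reflexivity].
- intros i H. destruct (reg_Vac d i H) as [n [E E']]. split.
  + rewrite <- E. apply exists_unique_contact.
    * apply (Hc n i E). lra.
    * unfold foot. rewrite E. reflexivity.
    * unfold vL. rewrite E. reflexivity.
    * symmetry. exact E'.
  + rewrite <- E'. apply exists_unique_contact.
    * apply has_contact_S.
    * unfold foot. rewrite E'. reflexivity.
    * unfold vL. rewrite E'. reflexivity.
    * change (reg d (S (S n))) with (next_region d (reg d (S n))). rewrite E'. reflexivity.
- intros i H. assert (E := Hgt i H). subst i. exists (front_wave d eps 0). split.
  + split; [apply waves_front; [lra | left; reflexivity] | apply simple_shadow_front; lra].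
  + intros w [Hw [Hs [_ [HT _]]]]. destruct Hw as [m Hm|m Hu Hm]; [discriminate|].
    simpl in HT. rewrite (front_0_birth m Hm HT). reflexivity.
- intros w [n Hn|n Hu Hn] HT.
  + assert (Hw := contact_wave_contact n). unfold foot, vL in Hw.
    destruct (reg_cases d n) as [[i [E [E' H]]]|[[i [E [E' H]]]|[i [E [E' H]]]]];
      exists i; rewrite E, E' in Hw; cbn [ridx velL] in Hw.
    * left. split; [|exact Hw]. apply Rle_antisym; [|exact H].
      destruct i as [|i]; [|apply Hvel; lia].
      apply Hn. apply (reg_St_0 d n E).
    * right; left. split; [exact H | left; exact Hw].
    * right; left. split; [exact H | right; exact Hw].
  + rewrite (front_0_birth n Hn HT). exists O. right; right.
    split; [exact Hu | apply simple_shadow_front, Hu].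
- intros w [n Hn|n Hu Hn].
  + split; [apply Rle_refl|]. destruct n as [|n]; [exact I|]. simpl. unfold front_end.
    destruct (Rlt_dec _ _) as [H|H]; [|exact I]. apply T_S_pos. right. exact H.
  + split; [apply (T_ge_0 d gap U rmax Hd), Hn|]. simpl. unfold front_end.
    destruct (Rlt_dec _ _) as [H|H]; [|exact I]. apply (T_lt d gap U rmax Hd). right. exact H.
- intros v w t Hv Hw Hne Hbv Hbw Hev Hew E.
  destruct Hv as [m Hm|m Hu Hm]; destruct Hw as [n Hn|n Hu' Hn]; simpl in *.
  + exfalso. destruct (Nat.lt_total m n) as [H|[H|H]].
    * assert (H' := edge_lt d gap U rmax Hd m n t Hbv H Hm). lra.
    * subst. contradiction.
    * assert (H' := edge_lt d gap U rmax Hd n m t Hbv H Hn). lra.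
  + destruct (front_meets_contact_only m n t) as [-> H]; try assumption. split; exact H.
  + destruct (front_meets_contact_only n m t) as [-> H]; try assumption; [lra|].
    split; exact H.
  + exfalso.
    (* Two fronts never live together: the earlier one dies no later than the birth of the later
       one. *)
    assert (Hord : forall i j, (i < j)%nat -> live d j -> front_birth d j < t ->
      Rbar_le t (front_end d i) -> False).
    { intros i j Hij Hj HT He.
      assert (Hi : live d (S i)) by (apply (live_le d gap U rmax Hd (S i) j); assumption).
      rewrite (front_end_live d i Hi) in He. simpl in He.
      assert (front_birth d (S i) <= front_birth d j) by (apply (T_mono d gap U rmax Hd); assumption). lra. }
    destruct (Nat.lt_total m n) as [H|[H|H]].
    * apply (Hord m n); assumption.
    * subst. contradiction.
    * apply (Hord n m); assumption.
- intros w T Hw HT. apply waves_interaction.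
  assert (Ha : arrives (waves d eps) w (line w T) T).
  { split; [exact Hw|]. split; [|split; [exact HT | reflexivity]].
    destruct Hw as [[|n] Hn|n Hu Hn]; simpl in *; [discriminate | |];
      destruct (front_end_finite n T HT) as [-> H]; [apply T_S_pos, H|].
    apply (T_lt d gap U rmax Hd), H. }
  destruct (waves_arrives _ _ _ Ha) as [n Hn]. exists n. tauto.
- intros X T HI. apply waves_interaction in HI. destruct HI as [n [Hn [-> ->]]].
  exists (front_wave d eps n :: contact_wave d (S n) :: nil), (front_wave d eps (S n)).
  split. { constructor; [|constructor; [easy | constructor]].
    intros [H|[]]. apply (front_neq_contact n (S n)). symmetry. exact H. }
  split.
  { intros v. split.
    - intros [<-|[<-|[]]]; [apply arrives_front | apply arrives_contact]; exact Hn.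
    - intros Hv. destruct (waves_arrives _ _ _ Hv) as [m [Hm [ET [_ Ew]]]].
      apply (T_inj _ _ Hn Hm) in ET. injection ET as <-.
      destruct Ew as [->| ->]; simpl; tauto. }
  split; [|apply outgoing_front, Hn].
  intros v. split.
  + intros [Hv [HX HT]]. assert (Hp := T_S_pos n Hn).
    destruct Hv as [m Hm|m Hu Hm]; simpl in HT; [lra|].
    rewrite (T_inj _ _ Hm Hn HT). reflexivity.
  + intros ->. split; [apply waves_front; [apply (live_shadow n), Hn | exact Hn]|].
    split; [|reflexivity]. simpl birthX.
    destruct (front_at_meeting d gap U rmax Hd n Hn) as [E1 [_ [_ [E4 _]]]].
    change (ppos (front_at d (S n)) (front_birth d (S n)) = edge d (S n) (front_birth d (S n))). congruence.
(* Each front is traced back through its predecessors to the initial one; the other incoming wave is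
   always an initial contact. *)
- assert (Hfront : forall n, vel d 1 < vel d 0 -> live d n ->
    generated (waves d eps) (front_wave d eps n)).
  { intros n Hu. induction n as [|n IH]; intros Hn.
    - apply generated_initial; [apply waves_front; assumption | apply T_0].
    - destruct (front_at_meeting d gap U rmax Hd n Hn) as [E1 [_ [_ [E4 _]]]].
      apply generated_interaction; [apply waves_front; assumption | |].
      + apply waves_interaction. exists n. split; [exact Hn|]. split; [reflexivity|].
        change (ppos (front_at d (S n)) (front_birth d (S n)) = edge d (S n) (front_birth d (S n))). congruence.
      + intros v Hv. destruct (waves_arrives _ _ _ Hv) as [m [Hm [ET [_ Ew]]]].
        apply (T_inj _ _ Hn Hm) in ET. injection ET as <-.
        destruct Ew as [->| ->].
        * apply IH, live_pred, Hn.
        * apply generated_initial; [apply waves_contact, has_contact_S | reflexivity]. }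
  intros w [n Hn|n Hu Hn]; [|apply Hfront; assumption].
  apply generated_initial; [apply waves_contact, Hn | reflexivity].
- intros w t Hw Hs [Hb He] Ht. destruct Hw as [n Hn|n Hu Hn]; [discriminate|]. simpl in *.
  destruct n as [|n]; simpl.
  + assert (Hden := ex_den _ _ _ _ Hd). assert (H0 := Hden O). assert (H1 := Hden 1%nat).
    apply Rdiv_lt_0_compat; [|exact Heps]. apply Rmult_lt_0_compat; [|lra].
    apply sqrt_lt_R0, Rmult_lt_0_compat; lra.
  + destruct (front_invariant d gap U rmax Hd Hu (S n) Hn) as [Hp [_ [_ [_ [Hm _]]]]].
    assert (Hm' := proj2 (Hm ltac:(discriminate))).
    assert (Hr0 := proj1 (ex_den _ _ _ _ Hd 0)).
    assert (Hrr := proj1 (dn_bounds _ _ _ _ Hd (S (S n)))).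
    assert (Hi := fp_mass_incr _ _ _ _ _ Hr0 Hrr Hp (front_birth d (S n)) t).
    change (pbirth (front_at d (S n))) with (front_birth d (S n)) in *.
    apply Rdiv_lt_0_compat.
    * apply Rlt_le_trans with (1 := Hm'), Hi. lra.
    * assert (0 <= eps * (t - front_birth d (S n))) by (apply Rmult_le_pos; lra). lra.
Qed.

Lemma waves_admissible : admissible d (waves d eps).
Proof.
intros w [n Hn|n Hu Hn].
- left. split; [reflexivity|]. exists (vL d n). split; [reflexivity|].
  split; [apply (vR_next d gap U rmax Hd), Hn|].
  intros t _. split; [|reflexivity]. simpl. unfold edge. ring.
- right. split; [reflexivity|]. intros t [Hb He]. simpl in *.
  destruct (front_mass_jump d gap U rmax Hd n t) as [_ [_ [_ [_ [H _]]]]].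
  + apply lives_upto. split; [exact Hn | split; [exact Hb | exact He]].
  + fold (vR d (S n)). change (velR d (next_region d (reg d n))) with (vR d (S n)). lra.
Qed.

End Tracking.

(** * The represented function *)

Definition front_index (d : states) (t : R) : nat :=
  epsilon (inhabits O) (fun n => lives_at d n t).

(* [x] lies in the [n]-th region of the solution without the shadow wave. *)
Definition in_cell (d : states) (x t : R) (n : nat) : Prop :=
  match n with
  | O => False
  | S O => pt d 0 + vR d 1 * t < x < edge d 1 t
  | S ((S _) as k) => edge d k t < x < edge d n t
  end.

(** Cells are disjoint at positive times, so the choice is forced inside a cell; on the edges it is
    arbitrary, which affects no integral. The first cell begins at slope [vR d 1], because the line
    of slope [vel d 0] need not bound a region. *)
Definition cell_index (d : states) (x t : R) : nat :=
  epsilon (inhabits O) (in_cell d x t).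

Definition state_index (d : states) (x : R) : nat :=
  epsilon (inhabits O) (fun i => pt d i < x <= pt d (S i)).

Definition strip_halfwidth (d : states) (eps : R) (n : nat) (t : R) : R :=
  if Rlt_dec (vel d 1) (vel d 0) then eps / 2 * (t - front_birth d n) + halfwidth eps n else 0.

(** In a vacuum the centred fan interpolates continuously between the velocities of the two bounding
    lines. *)
Definition region_vel (d : states) (r : region) (x t : R) : R :=
  match r with St i => vel d i | Vac i => (x - pt d i) / t end.

(** A single case distinction serves density and velocity, so that their products can be evaluated
    place by place. *)
Definition by_place {A : Type} (d : states) (eps x t : R) (strip left : A) (right : nat -> A) : A :=
  let n := front_index d t in
  if Rlt_dec (Rabs (x - ppos (front_at d n) t)) (strip_halfwidth d eps n t) then strip
  else if Rlt_dec x (ppos (front_at d n) t) then left else right (cell_index d x t).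

Definition field_den (d : states) (eps x t : R) : R :=
  if Rle_dec t 0 then
    if Rle_dec x (pt d 0) then den d 0 else den d (S (state_index d x))
  else by_place d eps x t (strip_den d eps (front_index d t) t) (den d 0) (dn d).

Definition field_vel (d : states) (eps x t : R) : R :=
  if Rle_dec t 0 then
    if Rle_dec x (pt d 0) then vel d 0 else vel d (S (state_index d x))
  else by_place d eps x t (pspd (front_at d (front_index d t)) t) (vel d 0)
    (fun n => region_vel d (reg d n) x t).

Section Fields.

Variables (d : states) (gap U rmax eps : R).
Hypotheses (Hd : expanding d gap U rmax) (Heps : 0 < eps).

Lemma front_index_eq n t : lives_at d n t -> front_index d t = n.
Proof.
intros Hn. apply (lives_at_unique d gap U rmax Hd _ _ t); [|exact Hn].
apply (epsilon_spec (inhabits O) (fun n => lives_at d n t)). exists n. exact Hn.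
Qed.

Lemma in_cell_lt m n x t : 0 < t -> in_cell d x t m -> in_cell d x t n -> (m < n)%nat -> False.
Proof.
intros Ht Hm Hn Hmn. destruct n as [|[|k]]; [lia | destruct m; [exact Hm | lia] |].
destruct m as [|j]; [exact Hm|].
assert (H : edge d (S j) t <= edge d (S k) t).
{ apply (edge_le d gap U rmax Hd); [lra | lia | apply has_contact_S]. }
simpl in Hn. destruct j as [|j]; simpl in Hm; lra.
Qed.

Lemma cell_index_eq n x t : 0 < t -> in_cell d x t n -> cell_index d x t = n.
Proof.
intros Ht Hn. assert (H : in_cell d x t (cell_index d x t)).
{ apply (epsilon_spec (inhabits O) (in_cell d x t)). exists n. exact Hn. }
destruct (Nat.lt_total (cell_index d x t) n) as [H'|[H'|H']]; [exfalso|exact H'|exfalso].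
- apply (in_cell_lt (cell_index d x t) n x t); assumption.
- apply (in_cell_lt n (cell_index d x t) x t); assumption.
Qed.

Lemma pt_incr i j : (i <= j)%nat -> pt d i <= pt d j.
Proof.
assert (Hg := ex_gap _ _ _ _ Hd).
induction 1; [lra|]. assert (H' := ex_pt _ _ _ _ Hd m). lra.
Qed.

Lemma state_index_eq i x : pt d i < x <= pt d (S i) -> state_index d x = i.
Proof.
intros Hi. assert (H : (fun i => pt d i < x <= pt d (S i)) (state_index d x)).
{ apply (epsilon_spec (inhabits O) (fun i => pt d i < x <= pt d (S i))). exists i. exact Hi. }
simpl in H. destruct (Nat.lt_total (state_index d x) i) as [H'|[H'|H']]; [exfalso|exact H'|exfalso].
- assert (Hp := pt_incr (S (state_index d x)) i H'). lra.
- assert (Hp := pt_incr (S i) (state_index d x) H'). lra.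
Qed.

Lemma by_place_strip (A : Type) n x t (s l : A) r : lives_at d n t ->
  Rabs (x - ppos (front_at d n) t) < strip_halfwidth d eps n t ->
  by_place d eps x t s l r = s.
Proof.
intros Hn Hx. unfold by_place. rewrite (front_index_eq n t Hn).
cbv zeta. destruct (Rlt_dec _ _); [reflexivity | contradiction].
Qed.

Lemma by_place_left (A : Type) n x t (s l : A) r : lives_at d n t ->
  strip_halfwidth d eps n t <= ppos (front_at d n) t - x -> x < ppos (front_at d n) t ->
  by_place d eps x t s l r = l.
Proof.
intros Hn Hx Hlt. unfold by_place. rewrite (front_index_eq n t Hn). cbv zeta.
destruct (Rlt_dec _ _) as [H|_].
- rewrite Rabs_left in H; lra.
- destruct (Rlt_dec _ _); [reflexivity | contradiction].
Qed.

Lemma by_place_right (A : Type) n k x t (s l : A) r : 0 < t -> lives_at d n t ->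
  strip_halfwidth d eps n t <= x - ppos (front_at d n) t -> ppos (front_at d n) t < x ->
  in_cell d x t k -> by_place d eps x t s l r = r k.
Proof.
intros Ht Hn Hx Hlt Hk. unfold by_place. rewrite (front_index_eq n t Hn). cbv zeta.
destruct (Rlt_dec _ _) as [H|_].
- rewrite Rabs_pos_eq in H; lra.
- destruct (Rlt_dec _ _) as [H|_]; [lra|]. f_equal. apply cell_index_eq; assumption.
Qed.

Lemma in_cell_right_of_front n x t : upto d n t ->
  ppos (front_at d n) t < x < edge d (S n) t -> in_cell d x t (S n).
Proof.
intros Hn Hx. destruct (front_right_of_edge d gap U rmax Hd n t Hn) as [H1 H2].
destruct n as [|n]; simpl; [lra|]. specialize (H1 ltac:(discriminate)). lra.
Qed.

Lemma in_cell_between n k x t : 0 < t -> upto d n t -> (n < k)%nat ->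
  edge d k t < x < edge d (S k) t -> in_cell d x t (S k) /\ ppos (front_at d n) t < x.
Proof.
intros Ht Hn Hk Hx. destruct k as [|k]; [lia|]. split; [exact Hx|].
destruct (front_bracket d gap U rmax Hd n t Hn) as [H _].
assert (edge d (S n) t <= edge d (S k) t); [|lra].
apply (edge_le d gap U rmax Hd); [lra | lia | apply has_contact_S].
Qed.

Lemma strip_halfwidth_eq n t : vel d 1 < vel d 0 ->
  strip_halfwidth d eps n t = eps / 2 * (t - front_birth d n) + halfwidth eps n.
Proof. intros Hu. unfold strip_halfwidth. destruct (Rlt_dec _ _); [reflexivity | contradiction]. Qed.

Lemma strip_halfwidth_nonneg n t : front_birth d n <= t -> 0 <= strip_halfwidth d eps n t.
Proof.
intros Ht. unfold strip_halfwidth. destruct (Rlt_dec _ _); [|lra].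
assert (0 <= eps / 2 * (t - front_birth d n)) by (apply Rmult_le_pos; lra).
destruct n; simpl; lra.
Qed.

Lemma waves_lives w t : waves d eps w -> alive w t -> shadow w = true ->
  exists n, lives_at d n t /\ vel d 1 < vel d 0 /\ w = front_wave d eps n.
Proof.
intros [n Hn|n Hu Hn] [H1 H2] Hs; [discriminate|].
exists n. repeat split; try assumption.
Qed.

(* Off the lines and the strip, the region read off the waves is the left state
   or the cell containing the point. *)
Lemma region_at_cases x t r : 0 < t ->
  (forall v, waves d eps v -> ~ in_strip eps v x t) -> region_at (waves d eps) x t r ->
  exists n, lives_at d n t /\ ((r = St 0 /\ strip_halfwidth d eps n t <= ppos (front_at d n) t - x /\
      x < ppos (front_at d n) t) \/
    (exists k, in_cell d x t k /\ r = reg d k /\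
      strip_halfwidth d eps n t <= x - ppos (front_at d n) t /\ ppos (front_at d n) t < x)).
Proof.
intros Ht Hstrip [Hoff Hreg].
destruct (lives_at_exists d gap U rmax Hd t (Rlt_le _ _ Ht)) as [n Hn]. exists n.
split; [exact Hn|]. assert (Hup := lives_upto d n t Hn).
set (c := ppos (front_at d n) t).
assert (Hh : strip_halfwidth d eps n t <= Rabs (x - c)).
{ unfold strip_halfwidth. destruct (Rlt_dec _ _) as [Hu|_]; [|apply Rabs_pos].
  apply Rnot_lt_le. intros H. apply (Hstrip (front_wave d eps n)).
  - apply waves_front; [exact Hu | apply Hn].
  - split; [reflexivity|]. split; [|exact H]. split; apply Hn. }
(* Contacts beyond the front are alive and can be compared with [x]; those behind it are dead, apart
   from the contact that plays the massless front. *)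
assert (Hcontact : forall m, (n < m)%nat -> waves d eps (contact_wave d m) /\ alive (contact_wave d m) t).
{ intros m Hm. destruct m as [|m]; [lia|].
  split; [apply waves_contact, has_contact_S|]. split; [simpl; lra|]. simpl.
  unfold front_end. destruct (Rlt_dec _ _) as [Hw|Hw]; [|exact I]. simpl.
  assert (Hl : live d (S m)) by (right; exact Hw).
  assert (Hln : live d (S n)) by (apply (live_le d gap U rmax Hd (S n) (S m)); [lia | exact Hl]).
  destruct Hn as [_ [_ He]]. rewrite (front_end_live d n Hln) in He. simpl in He.
  apply Rlt_le_trans with (1 := He), (T_mono d gap U rmax Hd); [lia | exact Hl]. }
assert (Hdead : forall m, alive (contact_wave d m) t -> has_contact d m ->
  (n < m)%nat \/ (m = O /\ n = O /\ vel d 0 <= vel d 1)).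
{ intros m [_ He] Hm. destruct (le_lt_dec m n) as [H|H]; [right | left; exact H].
  destruct m as [|m].
  - assert (Hu := Hm eq_refl). split; [reflexivity|]. split; [|exact Hu].
    apply (upto_no_front d gap U rmax Hd n t Hu Hup).
  - exfalso. assert (Hl : live d (S m)).
    { apply (live_le d gap U rmax Hd (S m) n); [exact H | apply Hn]. }
    simpl in He. rewrite (front_end_live d m Hl) in He. simpl in He.
    assert (front_birth d (S m) <= front_birth d n) by (apply (T_mono d gap U rmax Hd); [exact H | apply Hn]).
    destruct Hn as [_ [Hn _]]. lra. }
assert (Hphantom : vel d 0 <= vel d 1 -> n = O /\ waves d eps (contact_wave d 0) /\
  alive (contact_wave d 0) t /\ c = edge d 0 t).
{ intros Hu. assert (E := upto_no_front d gap U rmax Hd n t Hu Hup).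
  split; [exact E|]. split; [apply waves_contact; intros _; exact Hu|].
  split; [split; [simpl; lra | exact I]|].
  unfold c. rewrite E, front_no_shadow by exact Hu. reflexivity. }
(* If [x] lay beyond this edge, its contact would be further right than the last wave on the left of
   [x]. *)
assert (Hedge_after : forall k, (n < k)%nat ->
  (forall v, waves d eps v -> alive v t -> line v t < x -> line v t < edge d k t) -> x < edge d k t).
{ intros k Hk Hmax. destruct (Hcontact k Hk) as [Hw Ha].
  destruct (Rtotal_order x (edge d k t)) as [H|[H|H]]; [exact H | |].
  - exfalso. apply (Hoff _ Hw Ha). symmetry. exact H.
  - exfalso. generalize (Hmax _ Hw Ha H). simpl. lra. }
destruct Hreg as [[Hall ->]|[w [Hw [Ha [Hlt [<- Hmax]]]]]].
- left. assert (Hc : x < c).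
  { destruct (Rlt_le_dec (vel d 1) (vel d 0)) as [Hu|Hu].
    - apply (Hall (front_wave d eps n)).
      + apply waves_front; [exact Hu | apply Hn].
      + split; apply Hn.
    - destruct (Hphantom Hu) as [_ [Hw [Ha E]]]. rewrite E. apply (Hall _ Hw Ha). }
  split; [reflexivity|]. split; [|exact Hc]. rewrite Rabs_left in Hh; lra.
- right.
  (* Common conclusion for the possible last waves on the left of [x]: the front, its massless
     substitute, or a contact beyond it. *)
  assert (Hcore : forall k, (n <= k)%nat -> rreg w = reg d (S k) ->
    (k = n /\ line w t = c \/ (n < k)%nat /\ line w t = edge d k t) ->
    exists k, in_cell d x t k /\ rreg w = reg d k /\
      strip_halfwidth d eps n t <= x - c /\ c < x).
  { intros k Hk Er Hl. exists (S k).
    assert (Hx : x < edge d (S k) t).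
    { apply Hedge_after; [lia|]. intros v Hv Hav Hlv. specialize (Hmax v Hv Hav Hlv).
      apply Rle_lt_trans with (1 := Hmax). destruct Hl as [[-> Hl]|[Hnk Hl]]; rewrite Hl.
      - destruct (front_bracket d gap U rmax Hd n t Hup) as [_ Hb].
        destruct (Hb Hn Ht) as [H|H]; [exact H|].
        destruct (Hphantom H) as [E [_ [_ ->]]]. rewrite E.
        apply (edge_lt d gap U rmax Hd); [exact Ht | lia | intros _; exact H].
      - apply (edge_lt d gap U rmax Hd); [exact Ht | lia |].
        destruct k; [lia | apply has_contact_S]. }
    assert (Hcell : in_cell d x t (S k) /\ c < x).
    { destruct Hl as [[-> Hl]|[Hnk Hl]]; rewrite Hl in Hlt.
      - split; [|exact Hlt]. apply in_cell_right_of_front; [exact Hup | split; assumption].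
      - apply in_cell_between; try assumption. split; assumption. }
    split; [apply Hcell|]. split; [exact Er|]. split; [|apply Hcell].
    rewrite Rabs_pos_eq in Hh; lra. }
  destruct Hw as [m Hm|m Hu Hm].
  + destruct (Hdead m Ha Hm) as [H|[-> [E Hu]]].
    * apply (Hcore m); [lia | reflexivity | right; split; [exact H | reflexivity]].
    * destruct (Hphantom Hu) as [_ [_ [_ Ec]]].
      apply (Hcore O); [lia | reflexivity | left; split; [symmetry; exact E | symmetry; exact Ec]].
  + assert (E : m = n).
    { apply (lives_at_unique d gap U rmax Hd m n t); [|exact Hn]. split; [exact Hm | exact Ha]. }
    subst m. apply (Hcore n); [lia | reflexivity | left; split; reflexivity].
Qed.

Lemma waves_represents : represents d eps (waves d eps) (field_den d eps) (field_vel d eps).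
Proof.
split.
- intros x Hx. unfold field_den, field_vel.
  destruct (Rle_dec 0 0); [|lra]. destruct (Rle_dec x (pt d 0)); [|lra]. split; reflexivity.
- intros i x Hx. unfold field_den, field_vel.
  destruct (Rle_dec 0 0); [|lra]. rewrite (state_index_eq i x Hx).
  assert (Hp := pt_incr 0 i ltac:(lia)).
  destruct (Rle_dec x (pt d 0)); [lra|]. split; reflexivity.
- intros w x t Hw Ht [Hs [Ha Hx]] _. unfold field_den, field_vel.
  destruct (Rle_dec t 0) as [|_]; [lra|].
  destruct (waves_lives w t Hw Ha Hs) as [n [Hn [Hu ->]]].
  rewrite !(by_place_strip _ n) by (try rewrite strip_halfwidth_eq by exact Hu; assumption).
  rewrite (front_index_eq n t Hn). split; reflexivity.
- intros i x t Ht Hstrip Hreg. unfold field_den, field_vel.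
  destruct (Rle_dec t 0) as [|_]; [lra|].
  destruct (region_at_cases x t _ Ht Hstrip Hreg) as [n [Hn [[E [H1 H2]]|[k [Hk [E [H1 H2]]]]]]].
  + injection E as ->. rewrite !(by_place_left _ n) by assumption. split; reflexivity.
  + rewrite !(by_place_right _ n k) by assumption.
    unfold dn. rewrite <- E. split; reflexivity.
- intros i Hi. exists (fun p => (fst p - pt d i) / snd p). split.
  + split.
    * intros [x t] [Ht _]. simpl in Ht.
      apply (filterlim_filter_le_1 (F := locally (x, t))).
      { intros P HP. apply filter_le_within, HP. }
      apply (continuous_mult (K := R_AbsRing) (fun p : R * R => fst p - pt d i) (fun p => / snd p)).
      -- apply (continuous_minus (V := R_NormedModule)); [apply continuous_fst | apply continuous_const].
      -- apply continuous_comp; [apply continuous_snd|]. apply continuous_Rinv. simpl. lra.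
    * intros t Ht. simpl. split; field; lra.
  + intros x t Ht Hstrip Hreg. unfold field_den, field_vel.
    destruct (Rle_dec t 0) as [|_]; [lra|].
    destruct (region_at_cases x t _ Ht Hstrip Hreg) as [n [Hn [[E _]|[k [Hk [E [H1 H2]]]]]]];
      [discriminate|].
    rewrite !(by_place_right _ n k) by assumption.
    unfold dn. rewrite <- E. split; reflexivity.
Qed.

End Fields.

(** All the differences vanish identically, so any [eta] serves; [kappa] is 1 because the initial
    half-width after an interaction is [eps]. *)
Lemma waves_asymptotics (eps0 : R) (d : R -> states) (gap : R -> R) (U rmax : R) :
  (forall eps, 0 < eps < eps0 -> expanding (d eps) (gap eps) U rmax) ->
  shadow_asymptotics eps0 (fun eps => waves (d eps) eps).
Proof.
intros Hd. split.
- exists 1. split; [lra|]. intros delta Hdelta. exists 1. split; [lra|].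
  intros eps w He _ Hw Hs HT. destruct Hw as [n Hn|n Hu Hn]; [discriminate|].
  destruct n as [|n].
  + simpl in HT. rewrite T_0 in HT. lra.
  + simpl. replace (eps / eps - 1) with 0 by (field; lra). rewrite Rabs_R0. exact Hdelta.
- intros M delta Hdelta. exists 1. split; [lra|].
  intros eps w t He _ Hw Hs Ha _.
  destruct (waves_lives (d eps) eps w t Hw Ha Hs) as [n [[_ [Ht _]] [Hu ->]]].
  assert (Hm := strip_mass_front (d eps) eps (proj1 He) n t Hu Ht).
  unfold strip_mass in Hm. cbn [shadow front_wave] in Hm. split; [|split].
  + simpl. rewrite Rminus_diag, Rabs_R0. exact Hdelta.
  + cbn [front_wave strength] in *. rewrite Hm, Rminus_diag, Rabs_R0. exact Hdelta.
  + intros HT. cbn [front_wave strength iden halfw birthT] in *. rewrite <- Hm.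
    assert (Hh : 0 <= halfwidth eps n) by (destruct n; simpl; lra).
    assert (0 <= halfwidth eps n / eps) by (apply Rdiv_le_0_compat; lra).
    replace (_ - _) with 0; [rewrite Rabs_R0; exact Hdelta|].
    assert (0 < eps * (t - front_birth (d eps) n)) by (apply Rmult_lt_0_compat; lra).
    field. split; lra.
Qed.

(** * Test functions *)

Definition smooth (f : R -> R -> R) : Prop := forall n x t, ex_diff_n f n x t.

Definition dx (f : R -> R -> R) (x t : R) : R := Derive (fun y => f y t) x.
Definition dt (f : R -> R -> R) (x t : R) : R := Derive (fun s => f x s) t.

Lemma smooth_dx f : smooth f -> smooth (dx f).
Proof. intros H n x t. apply (H (S n) x t). Qed.

Lemma smooth_dt f : smooth f -> smooth (dt f).
Proof. intros H n x t. apply (H (S n) x t). Qed.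

Lemma smooth_cont f x t : smooth f -> continuity_2d_pt f x t.
Proof. intros H. apply (H O x t). Qed.

Lemma smooth_is_derive_x f x t : smooth f -> is_derive (fun y => f y t) x (dx f x t).
Proof. intros H. apply Derive_correct, (H 1%nat x t). Qed.

Lemma smooth_is_derive_t f x t : smooth f -> is_derive (fun s => f x s) t (dt f x t).
Proof. intros H. apply Derive_correct, (H 1%nat x t). Qed.

Lemma continuity_2d_pt_swap f x y :
  continuity_2d_pt f x y -> continuity_2d_pt (fun u v => f v u) y x.
Proof. intros H e. destruct (H e) as [del Hd]. exists del. intros u v Hu Hv. apply Hd; assumption. Qed.

Lemma smooth_cont_x f x t : smooth f -> continuous (fun y => f y t) x.
Proof.
intros H. apply (ex_derive_continuous (V := R_NormedModule)).
eexists. apply smooth_is_derive_x, H.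
Qed.

Lemma smooth_ex_RInt f a b t : smooth f -> ex_RInt (fun y => f y t) a b.
Proof. intros H. apply (ex_RInt_continuous (V := R_CompleteNormedModule)). intros z _. apply smooth_cont_x, H. Qed.

(** The segment from the corner [(a, c)] is cut into [N + 1] steps, each short enough that uniform
    continuity changes [f] by less than 1. *)
Lemma bounded_on_rectangle f a b c d : a <= b -> c <= d ->
  (forall x y, a <= x <= b -> c <= y <= d -> continuity_2d_pt f x y) ->
  exists B, 0 <= B /\ forall x y, a <= x <= b -> c <= y <= d -> Rabs (f x y) <= B.
Proof.
intros Hab Hcd Hc.
destruct (uniform_continuity_2d f a b c d Hc (mkposreal 1 Rlt_0_1)) as [del Hdel].
destruct (nfloor_ex ((b - a + (d - c)) / del)) as [N [_ HN]].
{ apply Rdiv_le_0_compat; [lra | apply cond_pos]. }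
assert (HN0 := pos_INR N). assert (Hdp := cond_pos del).
apply Rlt_div_l in HN; [|exact Hdp].
exists (Rabs (f a c) + (INR N + 1)). split; [generalize (Rabs_pos (f a c)); lra|].
intros x y Hx Hy.
assert (Hk : forall k, INR k <= INR N + 1 -> Rabs (f (a + INR k / (INR N + 1) * (x - a))
  (c + INR k / (INR N + 1) * (y - c))) <= Rabs (f a c) + INR k).
{ induction k as [|k IH]; intros Hk.
  - simpl INR. replace (a + 0 / (INR N + 1) * (x - a)) with a by (field; lra).
    replace (c + 0 / (INR N + 1) * (y - c)) with c by (field; lra). lra.
  - rewrite S_INR in Hk. specialize (IH ltac:(lra)). assert (Hk0 := pos_INR k).
    assert (Hr : forall j, 0 <= j <= INR N + 1 -> 0 <= j / (INR N + 1) <= 1).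
    { intros j Hj. split; [apply Rdiv_le_0_compat; lra|]. apply Rle_div_l; lra. }
    assert (R1 := Hr (INR k) ltac:(lra)). assert (R2 := Hr (INR (S k)) ltac:(rewrite S_INR; lra)).
    assert (Hstep : forall r z w, 0 <= r <= 1 -> z <= w -> z <= z + r * (w - z) <= w) by (intros; nra).
    assert (Hq : INR (S k) / (INR N + 1) - INR k / (INR N + 1) = / (INR N + 1)).
    { rewrite S_INR. field. lra. }
    assert (Hsm : forall w, 0 <= w <= b - a + (d - c) -> 0 <= / (INR N + 1) * w < del).
    { intros w Hw. rewrite Rmult_comm. split.
      - apply Rdiv_le_0_compat; lra.
      - apply Rlt_div_l; lra. }
    assert (H := Hdel (a + INR k / (INR N + 1) * (x - a)) (c + INR k / (INR N + 1) * (y - c))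
      (a + INR (S k) / (INR N + 1) * (x - a)) (c + INR (S k) / (INR N + 1) * (y - c))).
    assert (H' : Rabs (f (a + INR (S k) / (INR N + 1) * (x - a))
      (c + INR (S k) / (INR N + 1) * (y - c)) - f (a + INR k / (INR N + 1) * (x - a))
      (c + INR k / (INR N + 1) * (y - c))) < 1).
    { apply H.
      - generalize (Hstep _ a x R1 ltac:(lra)). lra.
      - generalize (Hstep _ c y R1 ltac:(lra)). lra.
      - generalize (Hstep _ a x R2 ltac:(lra)). lra.
      - generalize (Hstep _ c y R2 ltac:(lra)). lra.
      - replace (_ - _) with (/ (INR N + 1) * (x - a)) by (rewrite <- Hq; ring).
        destruct (Hsm (x - a)) as [S1 S2]; [lra|]. rewrite Rabs_pos_eq; lra.
      - replace (_ - _) with (/ (INR N + 1) * (y - c)) by (rewrite <- Hq; ring).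
        destruct (Hsm (y - c)) as [S1 S2]; [lra|]. rewrite Rabs_pos_eq; lra. }
    rewrite S_INR at 3. rewrite S_INR in H'. rewrite S_INR.
    match goal with |- Rabs ?p <= _ => match type of H' with Rabs (?p - ?q) < _ =>
      generalize (Rabs_triang (p - q) q); replace (p - q + q) with p by ring end end. lra. }
specialize (Hk (S N)). rewrite S_INR in Hk. specialize (Hk ltac:(lra)).
replace (a + (INR N + 1) / (INR N + 1) * (x - a)) with x in Hk by (field; lra).
replace (c + (INR N + 1) / (INR N + 1) * (y - c)) with y in Hk by (field; lra).
exact Hk.
Qed.

Definition prim (f : R -> R -> R) (x t : R) : R := RInt (fun y => f y t) 0 x.

Lemma prim_is_RInt f a b t : smooth f -> is_RInt (fun y => f y t) a b (prim f b t - prim f a t).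
Proof.
intros H. unfold prim.
assert (E : RInt (fun y => f y t) 0 b = RInt (fun y => f y t) 0 a + RInt (fun y => f y t) a b).
{ symmetry. apply (RInt_Chasles (V := R_CompleteNormedModule)); apply smooth_ex_RInt, H. }
assert (E' : forall p q r : R, p = q + r -> p - q = r) by (intros; lra).
rewrite (E' _ _ _ E).
apply (RInt_correct (V := R_CompleteNormedModule)), smooth_ex_RInt, H.
Qed.

Lemma dx_is_RInt f a b t : smooth f -> is_RInt (fun y => dx f y t) a b (f b t - f a t).
Proof.
intros H. apply (is_RInt_derive (V := R_CompleteNormedModule) (fun y => f y t)).
- intros x _. apply smooth_is_derive_x, H.
- intros x _. apply smooth_cont_x, smooth_dx, H.
Qed.

Lemma prim_derive_along f (c : R -> R) t c' : smooth f -> is_derive c t c' ->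
  is_derive (fun s => prim f (c s) s) t (prim (dt f) (c t) t + f (c t) t * c').
Proof.
intros H Hc. unfold prim.
apply (is_derive_RInt_param_bound_comp_aux3 (fun s y => f y s) 0 c t c').
- exists (mkposreal 1 Rlt_0_1). intros; apply smooth_ex_RInt, H.
- exists (mkposreal 1 Rlt_0_1). exists (mkposreal 1 Rlt_0_1). intros; apply smooth_ex_RInt, H.
- exact Hc.
- exists (mkposreal 1 Rlt_0_1). exists (mkposreal 1 Rlt_0_1). intros.
  eexists. apply smooth_is_derive_t, H.
- intros y _. apply (continuity_2d_pt_swap (dt f) y t), smooth_cont, smooth_dt, H.
- exists (mkposreal 1 Rlt_0_1). intros u v _ _.
  apply (continuity_2d_pt_swap (dt f) v u), smooth_cont, smooth_dt, H.
- apply continuity_pt_filterlim, smooth_cont_x, H.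
Qed.

Lemma f_continuous_along f (c : R -> R) t : smooth f -> continuous c t ->
  continuous (fun s => f (c s) s) t.
Proof.
intros H Hc. apply (continuous_comp_2 c (fun s => s) f).
- exact Hc.
- apply continuous_id.
- apply continuity_2d_pt_filterlim, smooth_cont, H.
Qed.

Lemma RInt_abs_le f K a b t : smooth f ->
  (forall y, Rmin a b <= y <= Rmax a b -> Rabs (f y t) <= K) ->
  Rabs (prim f b t - prim f a t) <= K * Rabs (b - a).
Proof.
intros H HK. destruct (Rle_lt_dec a b) as [Hab|Hab].
- rewrite (Rabs_pos_eq (b - a)), Rmult_comm by lra.
  apply (norm_RInt_le_const (V := R_NormedModule) (fun y => f y t) a b); [exact Hab | |].
  + intros y Hy. apply HK. rewrite Rmin_left, Rmax_right by lra. exact Hy.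
  + apply prim_is_RInt, H.
- rewrite (Rabs_left (b - a)), Rmult_comm, Ropp_minus_distr by lra.
  rewrite Rabs_minus_sym.
  apply (norm_RInt_le_const (V := R_NormedModule) (fun y => f y t) b a); [lra | |].
  + intros y Hy. apply HK. rewrite Rmin_right, Rmax_left by lra. exact Hy.
  + apply prim_is_RInt, H.
Qed.

(** Needed for ends that are only continuous, such as a maximum, where the Leibniz rule does not
    apply. Moving the end costs a local bound of [f] times the displacement; with the end fixed the
    integral is differentiable in time. *)
Lemma prim_continuous_along f (c : R -> R) t : smooth f -> continuous c t ->
  continuous (fun s => prim f (c s) s) t.
Proof.
intros H Hc. set (x0 := c t).
destruct (bounded_on_rectangle f (x0 - 1) (x0 + 1) (t - 1) (t + 1)) as [B [HB0 HB]]; try lra.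
{ intros. apply smooth_cont, H. }
assert (H1 : continuous (fun s => prim f x0 s) t).
{ apply (ex_derive_continuous (V := R_NormedModule)). eexists.
  apply (prim_derive_along f (fun _ => x0) t 0 H). apply is_derive_Rconst. }
apply continuity_pt_filterlim. apply continuity_pt_filterlim in H1.
apply continuity_pt_filterlim in Hc.
apply continuity_pt_locally. intros e.
assert (He2 : 0 < e / 2) by (generalize (cond_pos e); lra).
assert (He3 : 0 < Rmin 1 (e / (2 * (B + 1)))).
{ apply Rmin_pos; [lra|]. apply Rdiv_lt_0_compat; [apply cond_pos | lra]. }
assert (L1 := proj1 (continuity_pt_locally _ _) H1 (mkposreal _ He2)).
assert (L2 := proj1 (continuity_pt_locally _ _) Hc (mkposreal _ He3)).
assert (Ht : locally t (fun s => Rabs (s - t) < 1)) by (exists (mkposreal 1 Rlt_0_1); intros s Hs; exact Hs).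
generalize (filter_and _ _ Ht (filter_and _ _ L2 L1)). apply filter_imp.
intros s [Hs [Hcs Hps]]. simpl in Hcs, Hps.
assert (M1 := Rmin_l 1 (e / (2 * (B + 1)))). assert (M2 := Rmin_r 1 (e / (2 * (B + 1)))).
fold x0 in Hcs. apply Rabs_lt_between in Hs.
assert (Hl : Rabs (prim f (c s) s - prim f x0 s) <= B * Rabs (c s - x0)).
{ apply RInt_abs_le; [exact H|]. intros y Hy. apply HB; [|lra].
  apply Rabs_lt_between in Hcs. unfold Rmin, Rmax in Hy. destruct (Rle_dec x0 (c s)); lra. }
assert (Rabs (c s - x0) <= e / (2 * (B + 1))) by lra.
assert (B * Rabs (c s - x0) <= e / 2).
{ apply Rle_trans with ((B + 1) * (e / (2 * (B + 1)))).
  - apply Rmult_le_compat; try lra. apply Rabs_pos.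
  - apply Req_le. field. lra. }
fold x0. replace (prim f (c s) s - prim f x0 t) with
  ((prim f (c s) s - prim f x0 s) + (prim f x0 s - prim f x0 t)) by ring.
apply Rle_lt_trans with (1 := Rabs_triang _ _). lra.
Qed.

(* [chi V] is a primitive in space of the transport derivative [phi_t + V phi_x]. *)
Definition chi (phi : R -> R -> R) (V x t : R) : R := prim (dt phi) x t + V * phi x t.

Lemma chi_is_RInt phi V a b t : smooth phi ->
  is_RInt (fun x => dt phi x t + V * dx phi x t) a b (chi phi V b t - chi phi V a t).
Proof.
intros H. evar_last.
- apply (is_RInt_plus (V := R_NormedModule) (fun x => dt phi x t)).
  + apply prim_is_RInt, smooth_dt, H.
  + apply (is_RInt_scal (V := R_NormedModule) (fun x => dx phi x t)), dx_is_RInt, H.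
- unfold chi, plus, scal; simpl. unfold mult; simpl. ring.
Qed.

Lemma chi_continuous_along phi (V c : R -> R) t : smooth phi -> continuous V t ->
  continuous c t -> continuous (fun s => chi phi (V s) (c s) s) t.
Proof.
intros H HV Hc. apply (continuous_plus (V := R_NormedModule) (fun s => prim (dt phi) (c s) s)).
- apply prim_continuous_along; [apply smooth_dt, H | exact Hc].
- apply (continuous_mult (K := R_AbsRing) V); [exact HV | apply f_continuous_along; assumption].
Qed.

Record supported (phi : R -> R -> R) (M : R) : Prop := {
  sup_pos : 0 < M;
  sup_zero : forall x t, 0 <= t -> (M < Rabs x \/ M < t) -> phi x t = 0
}.

Lemma is_derive_locally_zero (f : R -> R) x l :
  locally x (fun y => f y = 0) -> is_derive f x l -> l = 0.
Proof.
intros Hz Hf. rewrite <- (is_derive_unique f x l Hf).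
apply is_derive_unique, (is_derive_ext_loc (fun _ => 0)).
- revert Hz. apply filter_imp. intros y Hy. symmetry. exact Hy.
- apply is_derive_Rconst.
Qed.

Lemma locally_gt (a x : R) : a < x -> locally x (fun y => a < y).
Proof.
intros H. exists (mkposreal _ (proj1 (Rminus_lt_0 _ _) H)). intros y Hy.
change (Rabs (y - x) < x - a) in Hy. apply Rabs_lt_between in Hy. lra.
Qed.

Lemma locally_Rabs_gt (a x : R) : a < Rabs x -> locally x (fun y => a < Rabs y).
Proof.
intros H. exists (mkposreal _ (proj1 (Rminus_lt_0 _ _) H)). intros y Hy.
change (Rabs (y - x) < Rabs x - a) in Hy.
assert (H' := Rabs_triang_inv x y). rewrite Rabs_minus_sym in H'. lra.
Qed.

Lemma supported_dx phi M : smooth phi -> supported phi M -> supported (dx phi) M.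
Proof.
intros H [HM Hs]. split; [exact HM|]. intros x t Ht Hxt.
apply (is_derive_locally_zero (fun y => phi y t) x); [|apply smooth_is_derive_x, H].
destruct Hxt as [Hx|Ht'].
- generalize (locally_Rabs_gt _ _ Hx). apply filter_imp. intros y Hy. apply Hs; tauto.
- exists (mkposreal 1 Rlt_0_1). intros y _. apply Hs; tauto.
Qed.

Lemma supported_dt phi M : smooth phi -> supported phi M -> supported (dt phi) M.
Proof.
intros H [HM Hs].
assert (Hpos : forall x t, 0 < t -> (M < Rabs x \/ M < t) -> dt phi x t = 0).
{ intros x t Ht Hxt.
  apply (is_derive_locally_zero (fun s => phi x s) t); [|apply smooth_is_derive_t, H].
  destruct Hxt as [Hx|Ht'].
  - generalize (locally_gt _ _ Ht). apply filter_imp. intros s Hs'. apply Hs; [lra | tauto].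
  - generalize (locally_gt _ _ Ht'). apply filter_imp. intros s Hs'. apply Hs; [lra | tauto]. }
split; [exact HM|]. intros x t [Ht|<-] Hxt; [apply Hpos; assumption|].
(* The vanishing of [phi] is known only at nonnegative times, so at time 0 the derivative is
   obtained by continuity from positive times. *)
destruct (Req_dec (dt phi x 0) 0) as [E|E]; [exact E|]. exfalso.
destruct (smooth_cont (dt phi) x 0 (smooth_dt _ H) (mkposreal _ (Rabs_pos_lt _ E))) as [del Hdel].
assert (Hd := cond_pos del).
specialize (Hdel x (del / 2)). simpl in Hdel.
rewrite (Hpos x (del / 2)), Rminus_0_l, Rabs_Ropp in Hdel; [|lra | destruct Hxt; [tauto | lra]].
apply (Rlt_irrefl (Rabs (dt phi x 0))), Hdel.
- rewrite Rminus_diag, Rabs_R0. exact Hd.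
- rewrite Rminus_0_r, Rabs_pos_eq; lra.
Qed.

Lemma supported_bounded f M : smooth f -> supported f M ->
  exists K, 0 <= K /\ forall x t, 0 <= t -> Rabs (f x t) <= K.
Proof.
intros H [HM Hs].
destruct (bounded_on_rectangle f (- M) M 0 M) as [K [HK0 HK]]; try lra.
{ intros. apply smooth_cont, H. }
exists K. split; [exact HK0|]. intros x t Ht.
destruct (Rle_lt_dec (Rabs x) M) as [Hx|Hx]; [destruct (Rle_lt_dec t M) as [Ht'|Ht']|].
- apply HK; [apply Rabs_le_between, Hx | lra].
- rewrite Hs, Rabs_R0 by tauto. exact HK0.
- rewrite Hs, Rabs_R0 by tauto. exact HK0.
Qed.

Lemma lipschitz_x f K t : smooth f -> (forall x, Rabs (dx f x t) <= K) ->
  forall x y, Rabs (f y t - f x t) <= K * Rabs (y - x).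
Proof.
intros H HK x y. destruct (MVT_gen (fun y => f y t) x y (fun y => dx f y t)) as [z [_ E]].
- intros; apply smooth_is_derive_x, H.
- intros; apply continuity_pt_filterlim, smooth_cont_x, H.
- rewrite E, Rabs_mult. apply Rmult_le_compat_r; [apply Rabs_pos | apply HK].
Qed.

Record controlled (phi : R -> R -> R) (K : R) : Prop := {
  ctl_pos : 0 <= K;
  ctl_phi : forall x t, 0 <= t -> Rabs (phi x t) <= K;
  ctl_dt : forall x t, 0 <= t -> Rabs (dt phi x t) <= K;
  ctl_dx : forall x t, 0 <= t -> Rabs (dx phi x t) <= K;
  ctl_dt_lip : forall x y t, 0 <= t -> Rabs (dt phi y t - dt phi x t) <= K * Rabs (y - x);
  ctl_dx_lip : forall x y t, 0 <= t -> Rabs (dx phi y t - dx phi x t) <= K * Rabs (y - x)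
}.

Lemma supported_controlled phi M : smooth phi -> supported phi M -> exists K, controlled phi K.
Proof.
intros H Hs. assert (Hsx := supported_dx phi M H Hs). assert (Hst := supported_dt phi M H Hs).
assert (Hx := smooth_dx phi H). assert (Ht := smooth_dt phi H).
destruct (supported_bounded phi M H Hs) as [K0 [P0 B0]].
destruct (supported_bounded _ M Hx Hsx) as [K1 [P1 B1]].
destruct (supported_bounded _ M Ht Hst) as [K2 [P2 B2]].
destruct (supported_bounded _ M (smooth_dx _ Hx) (supported_dx _ _ Hx Hsx)) as [K3 [P3 B3]].
destruct (supported_bounded _ M (smooth_dx _ Ht) (supported_dx _ _ Ht Hst)) as [K4 [P4 B4]].
exists (K0 + K1 + K2 + K3 + K4).
split; [lra | | | | |].
- intros x t Hxt. specialize (B0 x t Hxt). lra.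
- intros x t Hxt. specialize (B2 x t Hxt). lra.
- intros x t Hxt. specialize (B1 x t Hxt). lra.
- intros x y t Hxt. apply lipschitz_x; [exact Ht|]. intros z. specialize (B4 z t Hxt). lra.
- intros x y t Hxt. apply lipschitz_x; [exact Hx|]. intros z. specialize (B3 z t Hxt). lra.
Qed.

Lemma chi_lipschitz phi K V a b t : smooth phi -> controlled phi K -> 0 <= t ->
  Rabs (chi phi V b t - chi phi V a t) <= K * (1 + Rabs V) * Rabs (b - a).
Proof.
intros H HK Ht. unfold chi.
replace (_ - _) with ((prim (dt phi) b t - prim (dt phi) a t) + V * (phi b t - phi a t)) by ring.
apply Rle_trans with (1 := Rabs_triang _ _). rewrite Rabs_mult.
assert (H1 : Rabs (prim (dt phi) b t - prim (dt phi) a t) <= K * Rabs (b - a)).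
{ apply RInt_abs_le; [apply smooth_dt, H|]. intros y _. apply (ctl_dt _ _ HK y t Ht). }
assert (H2 : Rabs (phi b t - phi a t) <= K * Rabs (b - a)).
{ apply lipschitz_x; [exact H|]. intros y. apply (ctl_dx _ _ HK y t Ht). }
assert (Rabs V * Rabs (phi b t - phi a t) <= Rabs V * (K * Rabs (b - a))).
{ apply Rmult_le_compat_l; [apply Rabs_pos | exact H2]. }
lra.
Qed.

(** Over half-length [h] the integrand differs from its value at the centre by a Lipschitz constant
    times [h]. Multiplied by the density, the factor [2 * h] becomes the mass, which leaves an error
    of order [h]. *)
Lemma chi_strip phi K V c h t : smooth phi -> controlled phi K -> 0 <= t -> 0 <= h ->
  Rabs (chi phi V (c + h) t - chi phi V (c - h) t - 2 * h * (dt phi c t + V * dx phi c t))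
  <= 2 * h * (K * (1 + Rabs V) * h).
Proof.
intros H HK Ht Hh. replace (2 * h) with (c + h - (c - h)) by ring.
apply (norm_RInt_le_const (V := R_NormedModule)
  (fun x => (dt phi x t + V * dx phi x t) - (dt phi c t + V * dx phi c t)) (c - h) (c + h)).
- lra.
- intros x Hx. change (Rabs ((dt phi x t + V * dx phi x t) - (dt phi c t + V * dx phi c t))
    <= K * (1 + Rabs V) * h).
  replace (_ - _) with ((dt phi x t - dt phi c t) + V * (dx phi x t - dx phi c t)) by ring.
  apply Rle_trans with (1 := Rabs_triang _ _). rewrite Rabs_mult.
  assert (Hxc : Rabs (x - c) <= h) by (apply Rabs_le_between; lra).
  assert (KP := ctl_pos _ _ HK). assert (VP := Rabs_pos V).
  assert (H1 := ctl_dt_lip _ _ HK c x t Ht). assert (H2 := ctl_dx_lip _ _ HK c x t Ht).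
  assert (K * Rabs (x - c) <= K * h) by (apply Rmult_le_compat_l; assumption).
  assert (Rabs V * Rabs (dx phi x t - dx phi c t) <= Rabs V * (K * h)).
  { apply Rmult_le_compat_l; lra. }
  lra.
- apply (is_RInt_minus (V := R_NormedModule)); [apply chi_is_RInt, H|].
  evar_last; [apply is_RInt_const|]. reflexivity.
Qed.

(** * The weak formulation between two interactions *)

Lemma f_derive_along f (c : R -> R) t c' : smooth f -> is_derive c t c' ->
  is_derive (fun s => f (c s) s) t (dt f (c t) t + c' * dx f (c t) t).
Proof.
intros H Hc. apply is_derive_Reals.
replace (dt f (c t) t + c' * dx f (c t) t) with (dx f (c t) t * c' + dt f (c t) t * 1) by ring.
apply (derivable_pt_lim_comp_2d f c (fun s => s)).
- apply filterdiff_differentiable_pt_lim. apply is_derive_filterdiff.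
  + exists (mkposreal 1 Rlt_0_1). intros u _. apply (smooth_is_derive_x f _ _ H).
  + apply smooth_is_derive_t, H.
  + apply continuity_2d_pt_filterlim, smooth_cont, smooth_dx, H.
- apply is_derive_Reals, Hc.
- apply derivable_pt_lim_id.
Qed.

Lemma continuous_Rmax_fun (f g : R -> R) t : continuous f t -> continuous g t ->
  continuous (fun s => Rmax (f s) (g s)) t.
Proof.
intros Hf Hg. apply (continuous_ext (fun s => (f s + g s + Rabs (f s - g s)) / 2)).
- intros s. unfold Rmax. destruct (Rle_dec (f s) (g s)).
  + rewrite Rabs_left1 by lra. lra.
  + rewrite Rabs_pos_eq by lra. lra.
- apply (continuous_mult (K := R_AbsRing)); [|apply continuous_const].
  apply (continuous_plus (V := R_NormedModule)).
  + apply (continuous_plus (V := R_NormedModule)); assumption.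
  + apply continuous_comp; [|apply continuous_Rabs].
    apply (continuous_minus (V := R_NormedModule)); assumption.
Qed.

(* The increment of a Lipschitz function over the part of [a, b] to the right of
   a point changes little when the point moves from [y] to [z]; the right-hand
   side telescopes over consecutive intervals. *)
Lemma clipped_increment (X : R -> R) L a b y z : 0 <= L -> a <= b -> y <= z ->
  (forall p q, Rabs (X q - X p) <= L * Rabs (q - p)) ->
  Rabs ((X (Rmax b z) - X (Rmax a z)) - (X (Rmax b y) - X (Rmax a y))) <=
  L * ((Rmax a z - Rmax a y) - (Rmax b z - Rmax b y)).
Proof.
intros HL Hab Hyz HX.
assert (H0 : Rabs 0 <= L * 0) by (rewrite Rabs_R0; lra).
assert (HX' : forall p q, p <= q -> Rabs (X q - X p) <= L * (q - p)).
{ intros p q Hpq. specialize (HX p q). rewrite (Rabs_pos_eq (q - p)) in HX by lra. exact HX. }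
assert (HX'' : forall p q, p <= q -> Rabs (X p - X q) <= L * (q - p)).
{ intros p q Hpq. rewrite Rabs_minus_sym. apply HX', Hpq. }
unfold Rmax. destruct (Rle_dec b z), (Rle_dec a z), (Rle_dec b y), (Rle_dec a y); try lra;
match goal with
| |- Rabs ?e <= L * ?f => try (replace e with 0 by ring; replace f with 0 by lra; exact H0)
end.
- replace (X z - X z - (X b - X y)) with (X y - X b) by ring.
  replace (z - y - (z - b)) with (b - y) by ring. apply HX''. lra.
- replace (X z - X z - (X b - X a)) with (X a - X b) by ring.
  replace (z - a - (z - b)) with (b - a) by ring. apply HX''. lra.
- replace (X b - X z - (X b - X y)) with (X y - X z) by ring.
  replace (z - y - (b - b)) with (z - y) by ring. apply HX''. lra.
- replace (X b - X z - (X b - X a)) with (X a - X z) by ring.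
  replace (z - a - (b - b)) with (z - a) by ring. apply HX''. lra.
Qed.

Section Pieces.

Variables (phi : R -> R -> R) (K M : R) (q V w : nat -> R) (E : nat -> R -> R) (q0 u0 Q U : R).
Hypotheses (Hphi : smooth phi) (HK : controlled phi K) (Hsup : supported phi M).
Hypotheses (HQ : forall k, Rabs (q k) <= Q) (HQ0 : Rabs q0 <= Q).
Hypotheses (HV : forall k, Rabs (V k) <= U) (Hu0 : Rabs u0 <= U).
Hypotheses (HE : forall k t, is_derive (E k) t (w k)).
Hypotheses (HEinc : forall k t, (1 <= k)%nat -> 0 <= t -> E k t <= E (S k) t).
Hypotheses (HqV : forall k, q k * (w k - V k) = 0).
Hypotheses (HwV : forall k, (1 <= k)%nat -> V (S k) = w k).

(* Integrals over [j] consecutive cells, starting with the [n]-th one, whose left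
   end is moved to [a]; in [cells_flux] only the part beyond [y] counts. *)
Fixpoint cells_mass (n j : nat) (a t : R) : R :=
  match j with
  | O => 0
  | S j => q n * (prim phi (E n t) t - prim phi a t) + cells_mass (S n) j (E n t) t
  end.

Fixpoint cells_flux (n j : nat) (a y t : R) : R :=
  match j with
  | O => 0
  | S j => q n * (chi phi (V n) (Rmax (E n t) y) t - chi phi (V n) (Rmax a y) t)
    + cells_flux (S n) j (E n t) y t
  end.

Let HU : 0 <= U.
Proof. apply Rle_trans with (2 := Hu0), Rabs_pos. Qed.

Let HQp : 0 <= Q.
Proof. apply Rle_trans with (2 := HQ0), Rabs_pos. Qed.

Let L := Q * (K * (1 + U)).

Lemma weight_pos : 0 <= Q * (K * (1 + U)).
Proof. apply Rmult_le_pos; [exact HQp|]. apply Rmult_le_pos; [apply (ctl_pos _ _ HK) | lra]. Qed.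

Lemma chi_lipschitz_U v t : 0 <= t -> Rabs v <= U -> forall a b,
  Rabs (chi phi v b t - chi phi v a t) <= K * (1 + U) * Rabs (b - a).
Proof.
intros Ht Hv a b. apply Rle_trans with (1 := chi_lipschitz phi K v a b t Hphi HK Ht).
apply Rmult_le_compat_r; [apply Rabs_pos|].
apply Rmult_le_compat_l; [apply (ctl_pos _ _ HK) | lra].
Qed.

(** The clipped increments telescope, so the bound does not contain the number [j] of cells, several
    of which the strip may cross. *)
Lemma cells_flux_shift n j a y z t : (1 <= n)%nat -> 0 <= t -> a <= E n t -> y <= z ->
  Rabs (cells_flux n j a z t - cells_flux n j a y t) <= L * (Rmax a z - Rmax a y).
Proof.
intros Hn Ht Ha Hyz. revert n a Hn Ha. induction j as [|j IH]; intros n a Hn Ha.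
- simpl. rewrite Rminus_diag, Rabs_R0. apply Rmult_le_pos; [apply weight_pos|].
  unfold Rmax. destruct (Rle_dec a z), (Rle_dec a y); lra.
- simpl. assert (Hr := IH (S n) (E n t) ltac:(lia) (HEinc n t Hn Ht)).
  match goal with |- Rabs ((q n * ?A + ?R1) - (q n * ?B + ?R2)) <= _ =>
    replace ((q n * A + R1) - (q n * B + R2)) with (q n * (A - B) + (R1 - R2)) by ring end.
  apply Rle_trans with (1 := Rabs_triang _ _). rewrite Rabs_mult.
  assert (Hc := clipped_increment (fun x => chi phi (V n) x t) (K * (1 + U)) a (E n t) y z
    ltac:(apply Rmult_le_pos; [apply (ctl_pos _ _ HK) | lra]) Ha Hyz
    (chi_lipschitz_U (V n) t Ht (HV n))). cbv beta in Hc.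
  match goal with |- Rabs (q n) * ?A + _ <= _ =>
    assert (Rabs (q n) * A <= Q * (K * (1 + U) *
      ((Rmax a z - Rmax a y) - (Rmax (E n t) z - Rmax (E n t) y)))) end.
  { apply Rmult_le_compat; [apply Rabs_pos | apply Rabs_pos | apply HQ | exact Hc]. }
  unfold L in *. lra.
Qed.

Lemma cells_flux_continuous n j (a y : R -> R) t : continuous a t -> continuous y t ->
  continuous (fun s => cells_flux n j (a s) (y s) s) t.
Proof.
intros Ha Hy. revert n a Ha. induction j as [|j IH]; intros n a Ha; simpl.
- apply continuous_const.
- assert (HEc : continuous (E n) t).
  { apply (ex_derive_continuous (V := R_NormedModule)). eexists. apply HE. }
  apply (continuous_plus (V := R_NormedModule)
    (fun s => q n * (chi phi (V n) (Rmax (E n s) (y s)) s - chi phi (V n) (Rmax (a s) (y s)) s))).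
  + apply (continuous_mult (K := R_AbsRing) (fun _ => q n)); [apply continuous_const|].
    apply (continuous_minus (V := R_NormedModule));
    apply (chi_continuous_along phi (fun _ => V n)); try exact Hphi; try apply continuous_const;
    apply continuous_Rmax_fun; assumption.
  + apply (IH (S n) (E n)), HEc.
Qed.

(** At an inner edge the boundary terms cancel: on its left by [HqV], on its right because [HwV]
    makes the edge move with the next cell. Only the left end [a] contributes. *)
Lemma cells_mass_derive n j (a : R -> R) a' t : (1 <= n)%nat -> 0 <= t ->
  is_derive a t a' -> a t <= E n t ->
  is_derive (fun s => cells_mass n (S j) (a s) s) t
    (cells_flux n (S j) (a t) (a t) t + q n * (V n - a') * phi (a t) t).
Proof.
intros Hn Ht Ha Hle.
(* With [y] below the left end no clipping is active. This form passes to the next cell, whose left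
   end is no longer [y]. *)
assert (Hy : forall y, y <= a t -> is_derive (fun s => cells_mass n (S j) (a s) s) t
    (cells_flux n (S j) (a t) y t + q n * (V n - a') * phi (a t) t)); [|apply Hy, Rle_refl].
intros y Hy. revert n a a' Hn Ha Hle Hy. induction j as [|j IH]; intros n a a' Hn Ha Hle Hy.
all: assert (H1 : is_derive (fun s => q n * (prim phi (E n s) s - prim phi (a s) s)) t
    (q n * (chi phi (V n) (Rmax (E n t) y) t - chi phi (V n) (Rmax (a t) y) t)
     + q n * (V n - a') * phi (a t) t)).
1,3: evar_last; [apply is_derive_scal, is_derive_Rminus;
  apply prim_derive_along; try exact Hphi; [apply HE | exact Ha]|];
  rewrite !Rmax_left by lra; unfold chi; specialize (HqV n); simpl; unfold mult; simpl;
  assert (Hw : q n * w n = q n * V n) by lra;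
  match goal with |- ?l = ?r => transitivity (l - (q n * w n - q n * V n) * phi (E n t) t); [|ring] end;
  rewrite Hw; ring.
- simpl. evar_last; [apply is_derive_Rplus; [exact H1 | apply is_derive_Rconst]|]. simpl. ring.
- assert (H2 := IH (S n) (E n) (w n) ltac:(lia) (HE n t) (HEinc n t Hn Ht) ltac:(lra)).
  rewrite (HwV n Hn), Rminus_diag in H2.
  change (is_derive (fun s => q n * (prim phi (E n s) s - prim phi (a s) s)
    + cells_mass (S n) (S j) (E n s) s) t
    (q n * (chi phi (V n) (Rmax (E n t) y) t - chi phi (V n) (Rmax (a t) y) t)
     + cells_flux (S n) (S j) (E n t) y t + q n * (V n - a') * phi (a t) t)).
  evar_last; [apply is_derive_Rplus; [exact H1 | exact H2]|]. simpl. ring.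
Qed.

(* Total charge of the measure made of the cells and a point mass [m] at [c]. *)
Definition charge (n j : nat) (A c m t : R) : R :=
  q0 * (prim phi c t - prim phi A t) + m * phi c t + cells_mass n j c t.

(* Space integral of the weak formulation, with the point mass spread with
   density [iota] over the strip of half-width [h]. *)
Definition strip_flux (n j : nat) (A c v h iota t : R) : R :=
  q0 * (chi phi u0 (c - h) t - chi phi u0 A t)
  + iota * (chi phi v (c + h) t - chi phi v (c - h) t) + cells_flux n j c (c + h) t.

(** At [c] the boundary terms [q0 * (v - u0) * phi] and [q n * (V n - v) * phi] are compensated by
    the derivative of [m], which is the shadow wave equation. So [Fbar] is the derivative of
    [charge], and only the spreading of the point mass has to be estimated. *)
Lemma strip_flux_integral n j A (c v m h iota : R -> R) (eta mu a b : R) :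
  0 <= a <= b -> A < - M -> 0 <= eta -> 0 <= mu -> (1 <= n)%nat ->
  (forall t, a <= t <= b ->
    is_derive c t (v t) /\
    is_derive m t ((q n - q0) * v t - (q n * V n - q0 * u0)) /\
    continuous v t /\ continuous h t /\ continuous iota t /\
    0 <= h t <= eta /\ 2 * h t * iota t = m t /\ Rabs (v t) <= U /\ Rabs (m t) <= mu /\
    c t <= E n t) ->
  exists I,
    is_RInt (fun t => strip_flux n (S j) A (c t) (v t) (h t) (iota t) t) a b I /\
    Rabs (I - (charge n (S j) A (c b) (m b) b - charge n (S j) A (c a) (m a) a))
      <= (2 * Q + mu) * (K * (1 + U)) * eta * (b - a).
Proof.
intros Hab HA Heta Hmu Hn Hall.
assert (Hcc : forall t, a <= t <= b -> continuous c t).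
{ intros t Ht. apply (ex_derive_continuous (V := R_NormedModule)). eexists. apply (Hall t Ht). }
assert (Hmc : forall t, a <= t <= b -> continuous m t).
{ intros t Ht. apply (ex_derive_continuous (V := R_NormedModule)). eexists. apply (Hall t Ht). }
assert (HAz : forall t, 0 <= t -> phi A t = 0).
{ intros t Ht. apply (sup_zero _ _ Hsup); [exact Ht|]. left.
  rewrite Rabs_left; generalize (sup_pos _ _ Hsup); lra. }
set (Fbar := fun t => q0 * (chi phi u0 (c t) t - chi phi u0 A t)
  + m t * (dt phi (c t) t + v t * dx phi (c t) t) + cells_flux n (S j) (c t) (c t) t).
assert (HG : is_RInt Fbar a b (charge n (S j) A (c b) (m b) b - charge n (S j) A (c a) (m a) a)).
{ apply (is_RInt_derive (V := R_CompleteNormedModule) (fun t => charge n (S j) A (c t) (m t) t)).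
  - intros t Ht. rewrite Rmin_left, Rmax_right in Ht by lra.
    destruct (Hall t Ht) as [D1 [D2 [_ [_ [_ [_ [_ [_ [_ Hle]]]]]]]]].
    unfold charge. evar_last.
    + apply is_derive_Rplus; [apply is_derive_Rplus|].
      * apply is_derive_scal, is_derive_Rminus.
        -- apply prim_derive_along; [exact Hphi | exact D1].
        -- apply (prim_derive_along phi (fun _ => A)); [exact Hphi | apply is_derive_Rconst].
      * apply is_derive_Rmult; [exact D2 | apply f_derive_along; [exact Hphi | exact D1]].
      * apply (cells_mass_derive n j c (v t) t Hn); [lra | exact D1 | exact Hle].
    + unfold Fbar, chi. rewrite (HAz t) by lra. change (@scal R_AbsRing R_NormedModule) with Rmult.
      cbv beta. simpl. ring.
  - intros t Ht. rewrite Rmin_left, Rmax_right in Ht by lra.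
    destruct (Hall t Ht) as [_ [_ [Cv _]]]. assert (Cc := Hcc t Ht). unfold Fbar.
    apply (continuous_plus (V := R_NormedModule));
      [apply (continuous_plus (V := R_NormedModule))|].
    + apply (continuous_mult (K := R_AbsRing) (fun _ => q0)); [apply continuous_const|].
      apply (continuous_minus (V := R_NormedModule)).
      * apply (chi_continuous_along phi (fun _ => u0)); [exact Hphi | apply continuous_const | exact Cc].
      * apply (chi_continuous_along phi (fun _ => u0) (fun _ => A)); [exact Hphi | |]; apply continuous_const.
    + apply (continuous_mult (K := R_AbsRing)); [apply Hmc, Ht|].
      apply (continuous_plus (V := R_NormedModule)).
      * apply f_continuous_along; [apply smooth_dt, Hphi | exact Cc].
      * apply (continuous_mult (K := R_AbsRing)); [exact Cv|].
        apply f_continuous_along; [apply smooth_dx, Hphi | exact Cc].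
    + apply cells_flux_continuous; exact Cc. }
set (F := fun t => strip_flux n (S j) A (c t) (v t) (h t) (iota t) t).
assert (HF : ex_RInt F a b).
{ apply (ex_RInt_continuous (V := R_CompleteNormedModule)).
  intros t Ht. rewrite Rmin_left, Rmax_right in Ht by lra.
  destruct (Hall t Ht) as [_ [_ [Cv [Ch [Ci _]]]]]. assert (Cc := Hcc t Ht).
  assert (Cm : continuous (fun s => c s - h s) t) by (apply (continuous_minus (V := R_NormedModule)); assumption).
  assert (Cp : continuous (fun s => c s + h s) t) by (apply (continuous_plus (V := R_NormedModule)); assumption).
  unfold F, strip_flux.
  apply (continuous_plus (V := R_NormedModule));
    [apply (continuous_plus (V := R_NormedModule))|].
  - apply (continuous_mult (K := R_AbsRing) (fun _ => q0)); [apply continuous_const|].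
    apply (continuous_minus (V := R_NormedModule)).
    + apply (chi_continuous_along phi (fun _ => u0) (fun s => c s - h s)); [exact Hphi | apply continuous_const | exact Cm].
    + apply (chi_continuous_along phi (fun _ => u0) (fun _ => A)); [exact Hphi | |]; apply continuous_const.
  - apply (continuous_mult (K := R_AbsRing)); [exact Ci|].
    apply (continuous_minus (V := R_NormedModule)).
    + apply (chi_continuous_along phi v (fun s => c s + h s)); assumption.
    + apply (chi_continuous_along phi v (fun s => c s - h s)); assumption.
  - apply (cells_flux_continuous n (S j) c (fun s => c s + h s)); assumption. }
destruct HF as [I HI]. exists I. split; [exact HI|].
rewrite (Rmult_comm _ (b - a)).
apply (norm_RInt_le_const (V := R_NormedModule) (fun t => F t - Fbar t) a b); [lra | |].
2: { apply (is_RInt_minus (V := R_NormedModule)); assumption. }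
intros t Ht. change (Rabs (F t - Fbar t) <= (2 * Q + mu) * (K * (1 + U)) * eta).
destruct (Hall t Ht) as [_ [_ [_ [_ [_ [Hh [Hm [Hv [Hmb Hle]]]]]]]]].
assert (Ht0 : 0 <= t) by lra.
assert (KU : 0 <= K * (1 + U)) by (apply Rmult_le_pos; [apply (ctl_pos _ _ HK) | lra]).
(* The strip replaces the left state over one half, the cells over the other, and the point mass by
   a density; each replacement costs a multiple of [eta]. *)
assert (B1 : Rabs (q0 * (chi phi u0 (c t - h t) t - chi phi u0 (c t) t)) <= Q * (K * (1 + U)) * eta).
{ rewrite Rabs_mult, Rmult_assoc. apply Rmult_le_compat; try apply Rabs_pos; [exact HQ0|].
  apply Rle_trans with (1 := chi_lipschitz_U u0 t Ht0 Hu0 _ _).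
  apply Rmult_le_compat_l; [exact KU|].
  replace (c t - h t - c t) with (- h t) by ring. rewrite Rabs_Ropp, Rabs_pos_eq; lra. }
assert (B2 : Rabs (cells_flux n (S j) (c t) (c t + h t) t - cells_flux n (S j) (c t) (c t) t)
  <= Q * (K * (1 + U)) * eta).
{ apply Rle_trans with (1 := cells_flux_shift n (S j) (c t) (c t) (c t + h t) t Hn Ht0 Hle ltac:(lra)).
  apply Rmult_le_compat_l; [apply weight_pos|]. rewrite Rmax_right, Rmax_left; lra. }
assert (B3 : Rabs (iota t * (chi phi (v t) (c t + h t) t - chi phi (v t) (c t - h t) t)
  - m t * (dt phi (c t) t + v t * dx phi (c t) t)) <= mu * (K * (1 + U)) * eta).
{ rewrite <- Hm.
  replace (_ - _) with (iota t * (chi phi (v t) (c t + h t) t - chi phi (v t) (c t - h t) t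
    - 2 * h t * (dt phi (c t) t + v t * dx phi (c t) t))) by ring.
  rewrite Rabs_mult.
  apply Rle_trans with (Rabs (iota t) * (2 * h t * (K * (1 + U) * h t))).
  - apply Rmult_le_compat_l; [apply Rabs_pos|].
    apply Rle_trans with (1 := chi_strip phi K (v t) (c t) (h t) t Hphi HK Ht0 (proj1 Hh)).
    apply Rmult_le_compat_l; [lra|]. apply Rmult_le_compat_r; [lra|].
    apply Rmult_le_compat_l; [apply (ctl_pos _ _ HK) | lra].
  - replace (_ * _) with (Rabs (m t) * (K * (1 + U)) * h t).
    + apply Rmult_le_compat; [|lra| |lra].
      * apply Rmult_le_pos; [apply Rabs_pos | exact KU].
      * apply Rmult_le_compat_r; [exact KU | exact Hmb].
    + rewrite <- Hm, !Rabs_mult, (Rabs_pos_eq 2), (Rabs_pos_eq (h t)) by lra. ring. }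
replace (F t - Fbar t) with
  (q0 * (chi phi u0 (c t - h t) t - chi phi u0 (c t) t)
   + (iota t * (chi phi (v t) (c t + h t) t - chi phi (v t) (c t - h t) t)
      - m t * (dt phi (c t) t + v t * dx phi (c t) t))
   + (cells_flux n (S j) (c t) (c t + h t) t - cells_flux n (S j) (c t) (c t) t))
  by (unfold F, Fbar, strip_flux; ring).
apply Rle_trans with (1 := Rabs_triang _ _).
apply Rle_trans with (1 := Rplus_le_compat_r _ _ _ (Rabs_triang _ _)). lra.
Qed.

End Pieces.

(** * The weak formulation for one value of eps *)

Lemma is_RInt_zero (f : R -> R) a b : (forall x, Rmin a b < x < Rmax a b -> f x = 0) ->
  is_RInt f a b 0.
Proof.
intros H. apply (is_RInt_ext (fun _ => 0)).
- intros x Hx. symmetry. apply H, Hx.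
- evar_last; [apply (is_RInt_const (V := R_NormedModule))|].
  unfold scal; simpl. unfold mult; simpl. ring.
Qed.

Lemma is_RInt_add (f : R -> R) a b c l1 l2 :
  is_RInt f a b l1 -> is_RInt f b c l2 -> is_RInt f a c (l1 + l2).
Proof. exact (is_RInt_Chasles (V := R_NormedModule) f a b c l1 l2). Qed.

Lemma is_int_line_intro (f : R -> R) a b l : a <= b ->
  (forall x, x < a -> f x = 0) -> (forall x, b < x -> f x = 0) ->
  is_RInt f a b l -> is_int_line f l.
Proof.
intros Hab Ha Hb Hf P HP.
exists (fun x => x < a) (fun y => b < y).
- exists a. easy.
- exists b. easy.
- intros x y Hx Hy. exists l. split; [|apply locally_singleton, HP]. simpl.
  replace l with (0 + l + 0) by ring.
  apply is_RInt_add with b; [apply is_RInt_add with a|]; [|exact Hf|]; apply is_RInt_zero; intros z Hz.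
  + rewrite Rmin_left, Rmax_right in Hz by lra. apply Ha. lra.
  + rewrite Rmin_left, Rmax_right in Hz by lra. apply Hb. lra.
Qed.

Lemma is_int_half_line_intro (f : R -> R) b l : 0 <= b ->
  (forall x, b < x -> f x = 0) -> is_RInt f 0 b l -> is_int_half_line f l.
Proof.
intros Hb Hz Hf P HP.
exists (fun x => x = 0) (fun y => b < y).
- reflexivity.
- exists b. easy.
- intros x y -> Hy. exists l. split; [|apply locally_singleton, HP]. simpl.
  replace l with (l + 0) by ring. apply is_RInt_add with b; [exact Hf|].
  apply is_RInt_zero. intros z Hzz. rewrite Rmin_left, Rmax_right in Hzz by lra. apply Hz. lra.
Qed.

Section WeakForm.

Variables (d : states) (gap U rmax eps : R).
Hypotheses (Hd : expanding d gap U rmax) (Heps : 0 < eps).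
Variables (phi : R -> R -> R) (K M : R).
Hypotheses (Hphi : smooth phi) (HK : controlled phi K) (Hsup : supported phi M).

(* [p = 0] is the balance of mass, [p = 1] the balance of momentum. *)
Variables (p : nat) (qE fE : R -> R -> R).
Hypotheses (Hp : p = 0%nat \/ p = 1%nat).
Hypotheses (HqE : forall x t, qE x t = field_den d eps x t * field_vel d eps x t ^ p).
Hypotheses (HfE : forall x t, fE x t = field_den d eps x t * field_vel d eps x t ^ S p).

Let q k := dn d k * vR d k ^ p.
Let q0 := den d 0 * vel d 0 ^ p.
Let u0 := vel d 0.
Let Q := rmax * (1 + U).
(** The test function vanishes at time [H]; up to then [mu] bounds the mass or momentum of the front
    and [eta] its half-width. *)
Let H := M + 1.
Let mu := 4 * rmax * U * H * (1 + U).
Let eta := eps * (H / 2 + 1).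
Let c n := ppos (front_at d n).
Let v n := pspd (front_at d n).
Let h n := strip_halfwidth d eps n.
Let m n t := pmass (front_at d n) t * v n t ^ p.
Let iota n t := strip_den d eps n t * v n t ^ p.

Let HM : 0 < M.
Proof. apply (sup_pos _ _ Hsup). Qed.

Let HU : 0 <= U.
Proof. apply Rle_trans with (2 := ex_bound _ _ _ _ Hd 0), Rabs_pos. Qed.

Let Hrmax : 0 < rmax.
Proof. assert (H' := ex_den _ _ _ _ Hd 0). lra. Qed.

Let pow_bound x : Rabs x <= U -> Rabs (x ^ p) <= 1 + U.
Proof.
intros Hx. destruct Hp as [-> | ->]; simpl.
- rewrite Rabs_R1. lra.
- rewrite Rmult_1_r. lra.
Qed.

Let HQ k : Rabs (q k) <= Q.
Proof.
unfold q, Q. rewrite Rabs_mult. assert (H' := dn_bounds _ _ _ _ Hd k).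
apply Rmult_le_compat; try apply Rabs_pos.
- rewrite Rabs_pos_eq; lra.
- apply pow_bound, (vel_abs_bounds d gap U rmax Hd).
Qed.

Let HQ0 : Rabs q0 <= Q.
Proof.
unfold q0, Q. rewrite Rabs_mult. assert (H' := ex_den _ _ _ _ Hd 0).
apply Rmult_le_compat; try apply Rabs_pos.
- rewrite Rabs_pos_eq; lra.
- apply pow_bound, (ex_bound _ _ _ _ Hd).
Qed.

Let HV k : Rabs (vR d k) <= U.
Proof. apply (vel_abs_bounds d gap U rmax Hd). Qed.

Let HE k t : is_derive (edge d k) t (vL d k).
Proof. unfold edge. auto_derive; [easy | ring]. Qed.

Let HEinc k t : (1 <= k)%nat -> 0 <= t -> edge d k t <= edge d (S k) t.
Proof.
intros Hk Ht. apply (edge_le d gap U rmax Hd); [exact Ht | lia|].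
destruct k; [lia | apply has_contact_S].
Qed.

Let HqV k : q k * (vL d k - vR d k) = 0.
Proof.
unfold q. replace (_ * _) with (vR d k ^ p * (dn d k * (vL d k - vR d k))) by ring.
rewrite dn_gap. ring.
Qed.

Let HwV k : (1 <= k)%nat -> vR d (S k) = vL d k.
Proof. intros Hk. apply (vR_next d gap U rmax Hd). destruct k; [lia | apply has_contact_S]. Qed.

Let region_vel_weight k x t e : dn d k * region_vel d (reg d k) x t ^ e = dn d k * vR d k ^ e.
Proof. unfold dn, vR. destruct (reg d k); simpl; ring. Qed.

Lemma strip_density_mass n t : upto d n t -> 2 * h n t * iota n t = m n t.
Proof.
intros Hn. unfold h, iota, m.
assert (E : 2 * strip_halfwidth d eps n t * strip_den d eps n t = pmass (front_at d n) t);
  [|rewrite <- E; ring].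
destruct (Rlt_le_dec (vel d 1) (vel d 0)) as [Hu|Hu].
- rewrite (strip_halfwidth_eq d eps n t Hu).
  assert (E := strip_mass_front d eps Heps n t Hu (proj1 (proj2 Hn))).
  unfold strip_mass in E. simpl in E. rewrite <- E. field.
- unfold strip_halfwidth. destruct (Rlt_dec _ _) as [H'|_]; [lra|].
  rewrite (upto_no_front d gap U rmax Hd n t Hu Hn), front_no_shadow by exact Hu. simpl. ring.
Qed.

Lemma momentum_jump n t : upto d n t ->
  is_derive (m n) t ((q (S n) - q0) * v n t - (q (S n) * vR d (S n) - q0 * u0)).
Proof.
intros Hn. destruct (front_mass_jump d gap U rmax Hd n t Hn) as [_ [D1 [D2 _]]].
unfold m, q, q0, u0, v. destruct Hp as [-> | ->].
- apply (is_derive_ext (pmass (front_at d n))); [intros s; simpl; ring|].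
  evar_last; [exact D1|]. simpl. ring.
- apply (is_derive_ext (fun s => pmass (front_at d n) s * pspd (front_at d n) s));
    [intros s; simpl; ring|].
  evar_last; [exact D2|]. simpl. ring.
Qed.

Lemma front_speed_bound n t : upto d n t -> Rabs (v n t) <= U.
Proof.
intros Hn. destruct (front_mass_jump d gap U rmax Hd n t Hn) as [_ [_ [_ [_ [Hv _]]]]].
assert (H1 := HV (S n)). assert (H2 := ex_bound _ _ _ _ Hd 0).
apply Rabs_le_between in H1. apply Rabs_le_between in H2.
apply Rabs_le_between. unfold v. lra.
Qed.

Lemma front_momentum_bound n t : upto d n t -> t <= H -> Rabs (m n t) <= mu.
Proof.
intros Hn Ht. destruct (front_mass_jump d gap U rmax Hd n t Hn) as [_ [_ [_ [_ [_ Hm]]]]].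
destruct (front_range d gap U rmax Hd n t Hn) as [_ Hm'].
assert (Ht0 := upto_pos d gap U rmax Hd n t Hn).
unfold m, mu. rewrite Rabs_mult. apply Rmult_le_compat; try apply Rabs_pos.
- rewrite Rabs_pos_eq by exact Hm. apply Rle_trans with (1 := Hm').
  apply Rmult_le_compat_l; [|exact Ht]. repeat apply Rmult_le_pos; lra.
- apply pow_bound, front_speed_bound, Hn.
Qed.

Lemma strip_halfwidth_bound n t : upto d n t -> t <= H -> 0 <= h n t <= eta.
Proof.
intros Hn Ht. split; [apply strip_halfwidth_nonneg; [exact Heps | apply Hn]|].
assert (HT := T_ge_0 d gap U rmax Hd n (proj1 Hn)).
unfold h, strip_halfwidth, eta. destruct (Rlt_dec _ _).
- assert (eps / 2 * (t - front_birth d n) <= eps / 2 * H) by (apply Rmult_le_compat_l; lra).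
  assert (halfwidth eps n <= eps) by (destruct n; simpl; lra). lra.
- apply Rmult_le_pos; [lra|]. unfold H. lra.
Qed.

Lemma strip_continuous n t : upto d n t ->
  continuous (v n) t /\ continuous (h n) t /\ continuous (iota n) t.
Proof.
intros Hn. destruct (front_mass_jump d gap U rmax Hd n t Hn) as [_ [D1 [_ [Cv _]]]].
split; [exact Cv|]. split.
- unfold h, strip_halfwidth. destruct (Rlt_dec _ _); [|apply continuous_const].
  apply (ex_derive_continuous (V := R_NormedModule)). auto_derive. easy.
- apply (continuous_mult (K := R_AbsRing)).
  + destruct n as [|n]; [apply continuous_const|].
    apply (continuous_mult (K := R_AbsRing) (pmass (front_at d (S n)))).
    * apply (ex_derive_continuous (V := R_NormedModule)). eexists. exact D1.
    * apply (ex_derive_continuous (V := R_NormedModule)). auto_derive.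
      destruct Hn as [_ [Ht _]].
      assert (0 <= eps * (t - front_birth d (S n))) by (apply Rmult_le_pos; lra).
      unfold Rminus in *. lra.
  + destruct Hp as [-> | ->]; simpl; [apply continuous_const|].
    apply (continuous_mult (K := R_AbsRing)); [exact Cv | apply continuous_const].
Qed.

Let integrand t x := qE x t * dt phi x t + fE x t * dx phi x t.

(** Clipping at [y] discards what the strip covers; a cell covered entirely gives an integral from
    [y] to [y]. *)
Lemma cells_flux_is_RInt (f : R -> R) y t : 0 <= t -> forall j k a, (1 <= k)%nat ->
  (forall x, Rmax a y < x < edge d k t -> f x = q k * (dt phi x t + vR d k * dx phi x t)) ->
  (forall i x, (k <= i)%nat -> Rmax (edge d i t) y < x < edge d (S i) t ->
    f x = q (S i) * (dt phi x t + vR d (S i) * dx phi x t)) ->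
  a <= edge d k t ->
  is_RInt f (Rmax a y) (Rmax (edge d (k + j) t) y)
    (cells_flux phi q (vR d) (edge d) k (S j) a y t).
Proof.
intros Ht.
assert (Hone : forall k a, (forall x, Rmax a y < x < edge d k t ->
    f x = q k * (dt phi x t + vR d k * dx phi x t)) -> a <= edge d k t ->
    is_RInt f (Rmax a y) (Rmax (edge d k t) y)
      (q k * (chi phi (vR d k) (Rmax (edge d k t) y) t - chi phi (vR d k) (Rmax a y) t))).
{ intros k a Hf Ha.
  assert (Hle : Rmax a y <= Rmax (edge d k t) y) by (apply Rle_max_compat_r, Ha).
  apply (is_RInt_ext (fun x => scal (q k) (dt phi x t + vR d k * dx phi x t))).
  - intros x Hx. rewrite (Rmin_left _ _ Hle), (Rmax_right _ _ Hle) in Hx.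
    rewrite Hf; [reflexivity|]. split; [apply Hx|].
    apply Rnot_le_lt. intros Hn. destruct Hx as [Hx1 Hx2].
    assert (Hya := Rmax_r a y). unfold Rmax in Hx2 at 1. destruct (Rle_dec _ _); lra.
  - apply (is_RInt_scal (V := R_NormedModule)), chi_is_RInt, Hphi. }
induction j as [|j IH]; intros k a Hk Hf Hfi Ha.
- rewrite Nat.add_0_r. simpl. rewrite Rplus_0_r. apply Hone; assumption.
- rewrite <- Nat.add_succ_comm.
  change (is_RInt f (Rmax a y) (Rmax (edge d (S k + j) t) y)
    (q k * (chi phi (vR d k) (Rmax (edge d k t) y) t - chi phi (vR d k) (Rmax a y) t)
     + cells_flux phi q (vR d) (edge d) (S k) (S j) (edge d k t) y t)).
  apply is_RInt_add with (Rmax (edge d k t) y); [apply Hone; assumption|].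
  apply IH; [lia | | |].
  + intros x Hx. apply (Hfi k); [lia | exact Hx].
  + intros i x Hi Hx. apply (Hfi i); [lia | exact Hx].
  + apply HEinc; assumption.
Qed.

Lemma space_integral n j A t : 0 < t -> lives_at d n t -> A <= c n t - h n t ->
  c n t + h n t <= edge d (S n + j) t ->
  is_RInt (integrand t) A (edge d (S n + j) t)
    (strip_flux phi q (vR d) (edge d) q0 u0 (S n) (S j) A (c n t) (v n t) (h n t) (iota n t) t).
Proof.
intros Ht Hl HA HB. assert (Hup := lives_upto d n t Hl).
assert (Hh : 0 <= h n t) by (apply strip_halfwidth_nonneg; [exact Heps | apply Hl]).
assert (Hf : forall x e, 0 < t -> field_den d eps x t * field_vel d eps x t ^ e =
  by_place d eps x t (strip_den d eps n t * v n t ^ e) (den d 0 * vel d 0 ^ e)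
    (fun k => dn d k * vR d k ^ e)).
{ intros x e _. unfold field_den, field_vel. destruct (Rle_dec t 0) as [|_]; [lra|].
  rewrite (front_index_eq d gap U rmax Hd n t Hl). unfold by_place.
  destruct (Rlt_dec _ _); [reflexivity|]. destruct (Rlt_dec _ _); [reflexivity|].
  apply region_vel_weight. }
unfold strip_flux. apply is_RInt_add with (c n t + h n t); [apply is_RInt_add with (c n t - h n t)|].
- apply (is_RInt_ext (fun x => scal q0 (dt phi x t + u0 * dx phi x t))).
  + intros x Hx. rewrite Rmin_left, Rmax_right in Hx by exact HA.
    unfold integrand. rewrite HqE, HfE, !Hf by exact Ht.
    rewrite !(by_place_left d gap U rmax eps Hd _ n) by (fold (c n) (h n); try assumption; lra).
    unfold scal, q0, u0; simpl. unfold mult; simpl. ring.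
  + apply (is_RInt_scal (V := R_NormedModule)), chi_is_RInt, Hphi.
- apply (is_RInt_ext (fun x => scal (iota n t) (dt phi x t + v n t * dx phi x t))).
  + intros x Hx. rewrite Rmin_left, Rmax_right in Hx by lra.
    unfold integrand. rewrite HqE, HfE, !Hf by exact Ht.
    rewrite !(by_place_strip d gap U rmax eps Hd _ n)
      by (try assumption; apply Rabs_lt_between'; exact Hx).
    unfold scal, iota; simpl. unfold mult; simpl. ring.
  + apply (is_RInt_scal (V := R_NormedModule)), chi_is_RInt, Hphi.
- replace (c n t + h n t) with (Rmax (c n t) (c n t + h n t)) at 1 by (apply Rmax_right; lra).
  replace (edge d (S n + j) t) with (Rmax (edge d (S n + j) t) (c n t + h n t))
    by (apply Rmax_left; exact HB).
  assert (Hcell : forall k x, in_cell d x t k -> c n t + h n t < x ->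
    integrand t x = q k * (dt phi x t + vR d k * dx phi x t)).
  { intros k x Hk Hx. unfold integrand. rewrite HqE, HfE, !Hf by exact Ht.
    rewrite !(by_place_right d gap U rmax eps Hd _ n k) by (fold (c n) (h n); try assumption; lra).
    unfold q. simpl. ring. }
  apply cells_flux_is_RInt; [lra | lia | | |].
  + intros x Hx. rewrite Rmax_right in Hx by lra. apply Hcell; [|lra].
    apply (in_cell_right_of_front d gap U rmax Hd n x t Hup). fold (c n). lra.
  + intros i x Hi Hx. assert (M1 := Rmax_l (edge d i t) (c n t + h n t)).
    assert (M2 := Rmax_r (edge d i t) (c n t + h n t)). apply Hcell; [|lra].
    apply (in_cell_between d gap U rmax Hd n i x t Ht Hup); [lia | lra].
  + apply (front_bracket d gap U rmax Hd n t Hup).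
Qed.

Lemma cells_mass_is_RInt (f : R -> R) t : 0 <= t -> forall j k a, (1 <= k)%nat ->
  (forall x, a < x < edge d k t -> f x = q k * phi x t) ->
  (forall i x, (k <= i)%nat -> edge d i t < x < edge d (S i) t -> f x = q (S i) * phi x t) ->
  a <= edge d k t ->
  is_RInt f a (edge d (k + j) t) (cells_mass phi q (edge d) k (S j) a t).
Proof.
intros Ht.
assert (Hone : forall k a, (forall x, a < x < edge d k t -> f x = q k * phi x t) ->
    a <= edge d k t -> is_RInt f a (edge d k t) (q k * (prim phi (edge d k t) t - prim phi a t))).
{ intros k a Hf Ha. apply (is_RInt_ext (fun x => scal (q k) (phi x t))).
  - intros x Hx. rewrite Rmin_left, Rmax_right in Hx by exact Ha. rewrite Hf by exact Hx. reflexivity.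
  - apply (is_RInt_scal (V := R_NormedModule)), prim_is_RInt, Hphi. }
induction j as [|j IH]; intros k a Hk Hf Hfi Ha.
- rewrite Nat.add_0_r. simpl. rewrite Rplus_0_r. apply Hone; assumption.
- rewrite <- Nat.add_succ_comm.
  change (is_RInt f a (edge d (S k + j) t) (q k * (prim phi (edge d k t) t - prim phi a t)
     + cells_mass phi q (edge d) (S k) (S j) (edge d k t) t)).
  apply is_RInt_add with (edge d k t); [apply Hone; assumption|].
  apply IH; [lia | | |].
  + intros x Hx. apply (Hfi k); [lia | exact Hx].
  + intros i x Hi Hx. apply (Hfi i); [lia | exact Hx].
  + apply HEinc; assumption.
Qed.

Let charge_n j A n t := charge phi q (edge d) q0 (S n) (S j) A (c n t) (m n t) t.

(** At time 0 the edges stand at their feet, each vacuum cell shrinks to a point, and the front has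
    no mass. *)
Lemma initial_charge j A : A <= pt d 0 ->
  is_RInt (fun x => qE x 0 * phi x 0) A (edge d (S j) 0) (charge_n j A 0 0).
Proof.
intros HA.
assert (E : c 0 0 = pt d 0 /\ m 0 0 = 0).
{ unfold c, m. simpl. destruct (Rlt_dec _ _); simpl; split; ring. }
destruct E as [E1 E2]. unfold charge_n, charge. rewrite E1, E2, Rmult_0_l, Rplus_0_r.
assert (Hedge : forall k, edge d k 0 = foot d k) by (intros; unfold edge; ring).
assert (Hcell : forall k x, foot d k < x < foot d (S k) -> qE x 0 * phi x 0 = q (S k) * phi x 0).
{ intros k x Hx. rewrite HqE. f_equal. unfold field_den, field_vel, q, dn, vR.
  destruct (Rle_dec 0 0) as [_|]; [|lra]. unfold foot in Hx.
  destruct (reg_cases d k) as [[i [E [E' _]]]|[[i [E [E' _]]]|[i [E [E' _]]]]];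
    rewrite E, E' in Hx; cbn [ridx] in Hx; rewrite ?E'; [|lra|];
  (destruct (Rle_dec x (pt d 0)) as [Hn|_];
    [generalize (pt_incr d gap U rmax Hd 0 i ltac:(lia)); lra|]);
  rewrite (state_index_eq d gap U rmax Hd i x) by lra; reflexivity. }
apply is_RInt_add with (pt d 0).
- apply (is_RInt_ext (fun x => scal q0 (phi x 0))).
  + intros x Hx. rewrite Rmin_left, Rmax_right in Hx by exact HA.
    rewrite HqE. unfold field_den, field_vel. destruct (Rle_dec 0 0) as [_|]; [|lra].
    destruct (Rle_dec x (pt d 0)); [reflexivity | lra].
  + apply (is_RInt_scal (V := R_NormedModule)), prim_is_RInt, Hphi.
- apply (cells_mass_is_RInt (fun x => qE x 0 * phi x 0) 0 (Rle_refl 0) j 1 (pt d 0)); [lia | | |].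
  + intros x Hx. rewrite Hedge in Hx. apply (Hcell O). exact Hx.
  + intros i x _ Hx. rewrite !Hedge in Hx. apply Hcell, Hx.
  + rewrite Hedge. apply (foot_ge d gap U rmax Hd).
Qed.

(** The cell just crossed has zero width at the meeting and drops out, while position, speed and
    mass of the front are continuous. *)
Lemma charge_at_meeting n j A : live d (S n) ->
  charge_n (S j) A n (front_birth d (S n)) = charge_n j A (S n) (front_birth d (S n)).
Proof.
intros Hn. destruct (front_at_meeting d gap U rmax Hd n Hn) as [E1 [E2 [E3 [E4 _]]]].
unfold charge_n, charge, m, c, v. rewrite E1, E2, E3, E4.
change (cells_mass phi q (edge d) (S n) (S (S j)) (edge d (S n) (front_birth d (S n))) (front_birth d (S n)))
  with (q (S n) * (prim phi (edge d (S n) (front_birth d (S n))) (front_birth d (S n))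
    - prim phi (edge d (S n) (front_birth d (S n))) (front_birth d (S n)))
    + cells_mass phi q (edge d) (S (S n)) (S j) (edge d (S n) (front_birth d (S n))) (front_birth d (S n))).
ring.
Qed.

Lemma charge_after n j A t : 0 <= t -> M < t -> charge_n j A n t = 0.
Proof.
intros Ht0 Ht.
assert (Hz : forall x, phi x t = 0) by (intros x; apply (sup_zero _ _ Hsup); tauto).
assert (Hpr : forall x, prim phi x t = 0).
{ intros x. unfold prim. apply is_RInt_unique, is_RInt_zero. intros; apply Hz. }
unfold charge_n, charge. rewrite !Hpr, Hz.
assert (Hc : forall j k a, cells_mass phi q (edge d) k j a t = 0).
{ induction j0 as [|i IH]; intros k a; simpl; [reflexivity|]. rewrite !Hpr, IH. ring. }
rewrite Hc. ring.
Qed.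

(** The charges telescope over the interactions: the charge at time 0 cancels the initial term, and
    the one at time [H] is zero. The spreading errors are proportional to the elapsed times and add
    up to at most [Kc * H]. *)
Lemma weak_value_bound : exists J, is_weak_value qE fE phi J /\
  Rabs J <= (2 * Q + mu) * (K * (1 + U)) * (H / 2 + 1) * H * eps.
Proof.
assert (HH : 0 < H) by (unfold H; lra).
assert (Heta : 0 <= eta) by (unfold eta; apply Rmult_le_pos; lra).
assert (Hmu : 0 <= mu) by (unfold mu; repeat apply Rmult_le_pos; lra).
destruct (lives_at_exists d gap U rmax Hd H (Rlt_le _ _ HH)) as [n1 Hn1].
(* [A] and the edge [S N] enclose the support of [phi] and the strip up to time [H]. Adding [n1],
   the index of the front present at time [H], to [N0] leaves cells on the right of every front
   involved. *)
set (A := - (M + 1) - Rabs (pt d 0) - U * H - eta).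
destruct (foot_unbounded d gap U rmax Hd (M + Rabs (pt d 0) + U * H + eta + U * H)) as [N0 HN0].
set (N := (n1 + N0)%nat).
assert (HA0 := Rabs_pos (pt d 0)). assert (HUH : 0 <= U * H) by (apply Rmult_le_pos; lra).
assert (Hpt : - Rabs (pt d 0) <= pt d 0 <= Rabs (pt d 0)) by (apply Rabs_le_between, Rle_refl).
assert (HN : forall t, 0 <= t <= H -> M + Rabs (pt d 0) + U * H + eta <= edge d (S N) t).
{ intros t Ht. assert (H1 := edge_lower d gap U rmax Hd (S N) t (proj1 Ht)).
  assert (H2 := HN0 (S N) ltac:(unfold N; lia)).
  assert (U * t <= U * H) by (apply Rmult_le_compat_l; lra). lra. }
assert (Hrange : forall n t, upto d n t -> t <= H -> A <= c n t - h n t /\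
  c n t + h n t <= edge d (S N) t).
{ intros n t Hn Ht. assert (Ht0 := upto_pos d gap U rmax Hd n t Hn).
  destruct (front_range d gap U rmax Hd n t Hn) as [Hc _].
  assert (Hh := strip_halfwidth_bound n t Hn Ht). specialize (HN t (conj Ht0 Ht)).
  assert (U * t <= U * H) by (apply Rmult_le_compat_l; lra).
  assert (Hv := ex_bound _ _ _ _ Hd 0). apply Rabs_le_between in Hv.
  assert (vel d 0 * t <= U * t) by (apply Rmult_le_compat_r; lra).
  unfold c, A in *. lra. }
(* Cut off at [H], after which the integrand is zero, since the enclosing edge is controlled only up
   to [H]. *)
set (F := fun t => if Rle_dec t H then RInt (integrand t) A (edge d (S N) t) else 0).
assert (HF : forall n j t, 0 < t <= H -> lives_at d n t -> (S n + j = S N)%nat ->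
  is_RInt (integrand t) A (edge d (S N) t) (strip_flux phi q (vR d) (edge d) q0 u0 (S n) (S j) A
    (c n t) (v n t) (h n t) (iota n t) t)).
{ intros n j t Ht Hn Hj. destruct (Hrange n t (lives_upto d n t Hn) (proj2 Ht)) as [R1 R2].
  rewrite <- Hj in *. apply space_integral; try assumption. apply Ht. }
assert (Hn_le : forall n t, upto d n t -> t <= H -> (n <= n1)%nat).
{ intros n t Hn Ht. destruct (le_lt_dec n n1) as [|Hlt]; [assumption|]. exfalso.
  assert (Hl : live d (S n1)) by (apply (live_le d gap U rmax Hd (S n1) n); [lia | apply Hn]).
  destruct Hn1 as [_ [_ He]]. rewrite (front_end_live d n1 Hl) in He. simpl in He.
  assert (front_birth d (S n1) <= front_birth d n) by (apply (T_mono d gap U rmax Hd); [lia | apply Hn]).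
  destruct Hn as [_ [Hn _]]. lra. }
set (Kc := (2 * Q + mu) * (K * (1 + U)) * eta).
assert (Hpiece : forall n j t, upto d n t -> t <= H -> (S n + j = S N)%nat -> exists I,
  is_RInt F (front_birth d n) t I /\
  Rabs (I - (charge_n j A n t - charge_n j A n (front_birth d n))) <= Kc * (t - front_birth d n)).
{ intros n j t Hn Ht Hj. assert (HT0 := T_ge_0 d gap U rmax Hd n (proj1 Hn)).
  assert (HTt := proj1 (proj2 Hn)).
  destruct (strip_flux_integral phi K M q (vR d) (vL d) (edge d) q0 u0 Q U Hphi HK Hsup HQ HQ0
    HV (ex_bound _ _ _ _ Hd 0) HE HEinc HqV HwV (S n) j A (c n) (v n) (m n) (h n) (iota n)
    eta mu (front_birth d n) t) as [I [HI1 HI2]].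
  - lra.
  - unfold A. lra.
  - exact Heta.
  - exact Hmu.
  - lia.
  - intros s Hs. assert (Hsn : upto d n s).
    { split; [apply Hn|]. split; [lra|]. apply Rbar_le_trans with t; [simpl; lra | apply Hn]. }
    destruct (front_mass_jump d gap U rmax Hd n s Hsn) as [D1 _].
    destruct (strip_continuous n s Hsn) as [C1 [C2 C3]].
    split; [exact D1|]. split; [apply momentum_jump, Hsn|].
    split; [exact C1|]. split; [exact C2|]. split; [exact C3|].
    split; [apply strip_halfwidth_bound; [exact Hsn | lra]|].
    split; [apply strip_density_mass, Hsn|].
    split; [apply front_speed_bound, Hsn|].
    split; [apply front_momentum_bound; [exact Hsn | lra]|].
    apply (front_bracket d gap U rmax Hd n s Hsn).
  - exists I. split; [|exact HI2]. revert HI1. apply is_RInt_ext.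
    intros s Hs. rewrite Rmin_left, Rmax_right in Hs by exact HTt.
    unfold F. destruct (Rle_dec s H) as [_|]; [|lra]. symmetry.
    apply is_RInt_unique, HF; [lra | | exact Hj].
    split; [apply Hn|]. split; [lra|].
    apply Rbar_lt_le_trans with t; [simpl; lra | apply Hn]. }
assert (Hall : forall n j t, upto d n t -> t <= H -> (S n + j = S N)%nat -> exists I,
  is_RInt F 0 t I /\ Rabs (I - (charge_n j A n t - charge_n N A 0 0)) <= Kc * t).
{ induction n as [|n IH]; intros j t Hn Ht Hj.
  - replace j with N in * by lia. generalize (Hpiece O N t Hn Ht eq_refl).
    rewrite T_0, Rminus_0_r. tauto.
  - destruct (front_at_meeting d gap U rmax Hd n (proj1 Hn)) as [_ [_ [_ [_ Hup]]]].
    assert (HTt := proj1 (proj2 Hn)).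
    destruct (IH (S j) (front_birth d (S n)) Hup ltac:(lra) ltac:(lia)) as [I1 [HI1 HB1]].
    destruct (Hpiece (S n) j t Hn Ht Hj) as [I2 [HI2 HB2]].
    exists (I1 + I2). split; [apply is_RInt_add with (front_birth d (S n)); assumption|].
    rewrite (charge_at_meeting n j A (proj1 Hn)) in HB1.
    replace (_ - _) with ((I1 - (charge_n j A (S n) (front_birth d (S n)) - charge_n N A 0 0))
      + (I2 - (charge_n j A (S n) t - charge_n j A (S n) (front_birth d (S n))))) by ring.
    apply Rle_trans with (1 := Rabs_triang _ _). lra. }
destruct (Hall n1 (N - n1)%nat H (lives_upto d n1 H Hn1) (Rle_refl H) ltac:(unfold N; lia))
  as [I [HI HB]].
rewrite charge_after in HB by (unfold H; lra).
exists (I + charge_n N A 0 0). split.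
- exists F, I, (charge_n N A 0 0).
  assert (Hzero : forall x t, 0 <= t -> (M < Rabs x \/ M < t) -> integrand t x = 0).
  { intros x t Ht Hx. unfold integrand.
    rewrite (sup_zero _ _ (supported_dt phi M Hphi Hsup) x t Ht Hx).
    rewrite (sup_zero _ _ (supported_dx phi M Hphi Hsup) x t Ht Hx). ring. }
  assert (Hfar : forall x, x < A -> M < Rabs x).
  { intros x Hx. rewrite Rabs_left; unfold A in Hx; lra. }
  assert (Hfar' : forall x t, 0 <= t <= H -> edge d (S N) t < x -> M < Rabs x).
  { intros x t Ht Hx. specialize (HN t Ht). rewrite Rabs_pos_eq; lra. }
  assert (HAN : forall t, 0 <= t <= H -> A <= edge d (S N) t).
  { intros t Ht. specialize (HN t Ht). unfold A. lra. }
  split; [|split; [|split]].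
  + intros t Ht. change (is_int_line (integrand t) (F t)). unfold F.
    destruct (Rle_dec t H) as [HtH|HtH].
    * assert (Ht' : 0 <= t <= H) by lra.
      apply is_int_line_intro with A (edge d (S N) t); [apply HAN, Ht' | | |].
      -- intros x Hx. apply Hzero; [lra | left; apply Hfar, Hx].
      -- intros x Hx. apply Hzero; [lra | left; apply (Hfar' x t Ht' Hx)].
      -- destruct (lives_at_exists d gap U rmax Hd t (Rlt_le _ _ Ht)) as [n Hn].
         assert (Hnn := Hn_le n t (lives_upto d n t Hn) HtH).
         assert (HR := HF n (N - n)%nat t (conj Ht HtH) Hn ltac:(unfold N; lia)).
         apply (RInt_correct (V := R_CompleteNormedModule)). eexists. exact HR.
    * apply is_int_line_intro with 0 0; try lra.
      -- intros x Hx. apply Hzero; [lra | right; unfold H in HtH; lra].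
      -- intros x Hx. apply Hzero; [lra | right; unfold H in HtH; lra].
      -- apply is_RInt_zero. intros x Hx. apply Hzero; [lra | right; unfold H in HtH; lra].
  + apply is_int_half_line_intro with H; [lra | | exact HI].
    intros t Ht. unfold F. destruct (Rle_dec t H); [lra | reflexivity].
  + apply is_int_line_intro with A (edge d (S N) 0); [apply HAN; lra | | |].
    * intros x Hx. rewrite (sup_zero _ _ Hsup x 0 (Rle_refl 0) (or_introl (Hfar x Hx))). ring.
    * intros x Hx. rewrite (sup_zero _ _ Hsup x 0 (Rle_refl 0) (or_introl (Hfar' x 0 ltac:(lra) Hx))). ring.
    * apply initial_charge. unfold A. lra.
  + reflexivity.
- replace (I + charge_n N A 0 0) with (I - (0 - charge_n N A 0 0)) by ring.
  apply Rle_trans with (1 := HB). unfold Kc, eta. right. ring.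
Qed.

End WeakForm.

(** * Convergence of the data and proof of the theorem *)

Lemma vanishes_at_right_0 (J : R -> R) (eps0 : R) : 0 < eps0 ->
  (forall delta, 0 < delta -> exists eta, 0 < eta /\
    forall eps, 0 < eps < eps0 -> eps < eta -> Rabs (J eps) < delta) ->
  filterlim J (at_right 0) (locally 0).
Proof.
intros He HJ. apply filterlim_locally. intros delta.
destruct (HJ delta (cond_pos delta)) as [eta [Heta H]].
assert (Hm : 0 < Rmin eta eps0) by (apply Rmin_pos; assumption).
exists (mkposreal _ Hm). intros y Hy Hy0.
change (Rabs (y - 0) < Rmin eta eps0) in Hy. rewrite Rminus_0_r, Rabs_pos_eq in Hy by lra.
assert (H1 := Rmin_l eta eps0). assert (H2 := Rmin_r eta eps0).
change (Rabs (J y - 0) < delta). rewrite Rminus_0_r. apply H; lra.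
Qed.

(** The threshold [(delta / C) ^ 3] inverts the cube root. *)
Lemma mesh_vanishes (C delta : R) : 1 <= C -> 0 < delta -> exists eta, 0 < eta /\
  forall eps, 0 < eps < eta -> C * Rpower eps (1 / 3) < delta.
Proof.
intros HC Hdelta. assert (Hq : 0 < delta / C) by (apply Rdiv_lt_0_compat; lra).
exists ((delta / C) ^ 3). split; [apply pow_lt, Hq|]. intros eps He.
rewrite Rmult_comm. apply Rlt_div_r; [lra|].
replace (delta / C) with (Rpower ((delta / C) ^ 3) (1 / 3)).
- apply Rlt_Rpower_l; lra.
- rewrite <- Rpower_pow, Rpower_mult by exact Hq. simpl INR.
  replace ((1 + 1 + 1) * (1 / 3)) with 1 by field. apply Rpower_1, Hq.
Qed.

(** Continuing by the value at [a] gives a function continuous on the whole line, to which the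
    results on integrability and uniform continuity apply. *)
Lemma Cb_extension_continuous a f x : Cb_from a f -> continuous (fun y => f (Rmax a y)) x.
Proof.
intros [Hf _]. assert (Ha : a <= Rmax a x) by apply Rmax_l.
assert (Hm : continuous (fun y => Rmax a y) x).
{ apply (continuous_Rmax_fun (fun _ => a) (fun y => y)); [apply continuous_const | apply continuous_id]. }
intros P HP. specialize (Hf (Rmax a x) Ha P HP). unfold filtermap, within in Hf.
specialize (Hm _ Hf). unfold filtermap in *. revert Hm. apply filter_imp.
intros y Hy. apply Hy, Rmax_l.
Qed.

Definition step_datum (d : states) (l : R) (f : R -> R) (x : R) : R :=
  if Rle_dec x (pt d 0) then l else f (pt d (S (state_index d x))).

Lemma continuous_bounded (f : R -> R) a b : (forall x, continuous f x) ->
  exists B, 0 <= B /\ forall x, a <= x <= b -> Rabs (f x) <= B.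
Proof.
intros Hf. destruct (bounded_continuity (V := R_NormedModule) f a b) as [B HB].
- intros x _. apply Hf.
- exists (Rabs B). split; [apply Rabs_pos|]. intros x Hx. specialize (HB x Hx).
  change (Rabs (f x) < B) in HB. generalize (Rle_abs B). lra.
Qed.

Lemma approx_function_ext eps0 (g g' : R -> R -> R) h : (forall eps x, g' eps x = g eps x) ->
  approx_function eps0 g h -> approx_function eps0 g' h.
Proof.
intros E Hg psi Hpsi. destruct (Hg psi Hpsi) as [J [H1 H2]]. exists J. split; [|exact H2].
intros eps He. specialize (H1 eps He).
replace (fun x => (g' eps x - h x) * psi x) with (fun x => (g eps x - h x) * psi x); [exact H1|].
apply functional_extensionality. intros x. rewrite E. reflexivity.
Qed.

(** * Approximation of the initial data by step functions *)

Section InitialData.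

Variables (a C eps0 l U rmax : R) (d : R -> states) (f : R -> R).
Hypotheses (HC : 1 <= C) (Heps0 : 0 < eps0) (Hf : Cb_from a f).
Hypothesis Hd : forall eps, 0 < eps < eps0 -> expanding (d eps) (sqrt eps) U rmax.
Hypothesis Hpt0 : forall eps, 0 < eps < eps0 -> pt (d eps) 0 = a.
Hypothesis Hmesh : forall eps i, 0 < eps < eps0 ->
  pt (d eps) (S i) - pt (d eps) i <= C * Rpower eps (1 / 3).

Lemma pt_bracket eps x : 0 < eps < eps0 -> a < x ->
  exists i, pt (d eps) i < x <= pt (d eps) (S i).
Proof.
intros He Hx. assert (Hg := ex_gap _ _ _ _ (Hd eps He)).
assert (Hgrow : forall i, a + INR i * sqrt eps <= pt (d eps) i).
{ induction i as [|i IH]; [rewrite Hpt0 by exact He; simpl; lra|].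
  assert (H := ex_pt _ _ _ _ (Hd eps He) i). rewrite S_INR. lra. }
destruct (nfloor_ex ((x - a) / sqrt eps)) as [N [_ HN]].
{ apply Rdiv_le_0_compat; lra. }
apply Rlt_div_l in HN; [|exact Hg].
assert (HxN : x <= pt (d eps) (S N)).
{ generalize (Hgrow (S N)). rewrite S_INR. lra. }
clear HN. induction N as [|N IH].
- exists O. rewrite (Hpt0 eps He). tauto.
- destruct (Rle_lt_dec x (pt (d eps) (S N))) as [H|H]; [apply IH, H|]. exists (S N). tauto.
Qed.

(** On a bounded interval the extended datum is uniformly continuous, and the step function takes
    its value at a point no further away than the mesh. *)
Lemma step_datum_approx : approx_function eps0 (fun eps => step_datum (d eps) l f) (initial_datum a l f).
Proof.
intros psi [Hpsi [M Hsup]].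
assert (Cpsi : forall x, continuous psi x).
{ intros x. apply (ex_derive_continuous (V := R_NormedModule)). apply (Hpsi 1%nat x). }
set (g := fun y => f (Rmax a y)).
assert (Cg : forall x, continuous g x) by (intros; apply Cb_extension_continuous, Hf).
set (e := fun eps x => (step_datum (d eps) l f x - initial_datum a l f x) * psi x).
set (B := Rmax a M + 1). assert (B1 := Rmax_l a M). assert (B2 := Rmax_r a M).
assert (Hleft : forall eps x, 0 < eps < eps0 -> x <= a -> e eps x = 0).
{ intros eps x He Hx. unfold e, step_datum, initial_datum. rewrite (Hpt0 eps He).
  destruct (Rle_dec x a); [ring | contradiction]. }
assert (Hcell : forall eps i x, 0 < eps < eps0 -> pt (d eps) i < x <= pt (d eps) (S i) ->
  e eps x = (g (pt (d eps) (S i)) - g x) * psi x).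
{ intros eps i x He Hx. assert (Hi := pt_incr _ _ _ _ (Hd eps He) 0 i ltac:(lia)).
  rewrite (Hpt0 eps He) in Hi.
  unfold e, step_datum, initial_datum. rewrite (Hpt0 eps He).
  destruct (Rle_dec x a); [lra|].
  rewrite (state_index_eq _ _ _ _ (Hd eps He) i x Hx). unfold g.
  rewrite !Rmax_right by lra. reflexivity. }
assert (Hint : forall eps, 0 < eps < eps0 -> ex_RInt (e eps) a B).
{ intros eps He. assert (HaB : a < B) by (unfold B; lra).
  destruct (pt_bracket eps B He HaB) as [N [_ HN]].
  apply (ex_RInt_Chasles_1 (V := R_CompleteNormedModule)) with (pt (d eps) (S N)); [lra|].
  generalize (S N). intros k. induction k as [|k IH].
  - rewrite (Hpt0 eps He). apply ex_RInt_point.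
  - apply (ex_RInt_Chasles (V := R_NormedModule)) with (pt (d eps) k); [exact IH|].
    assert (Hk := ex_pt _ _ _ _ (Hd eps He) k). assert (Hg := ex_gap _ _ _ _ (Hd eps He)).
    apply (ex_RInt_ext (fun x => (g (pt (d eps) (S k)) - g x) * psi x)).
    + intros x Hx. rewrite Rmin_left, Rmax_right in Hx by lra. symmetry. apply Hcell; [exact He | lra].
    + apply (ex_RInt_continuous (V := R_CompleteNormedModule)). intros x _.
      apply (continuous_mult (K := R_AbsRing)); [|apply Cpsi].
      apply (continuous_minus (V := R_NormedModule)); [apply continuous_const | apply Cg]. }
exists (fun eps => RInt (e eps) a B). split.
- intros eps He. apply is_int_line_intro with a B; [unfold B; lra | | |].
  + intros x Hx. apply (Hleft eps x He). lra.
  + intros x Hx. rewrite Hsup; [ring|]. apply Rlt_le_trans with x; [unfold B in Hx; lra | apply Rle_abs].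
  + apply (RInt_correct (V := R_CompleteNormedModule)), Hint, He.
- apply (vanishes_at_right_0 _ eps0 Heps0). intros delta Hdelta.
  destruct (continuous_bounded psi a B Cpsi) as [P [HP0 HP]].
  set (k := delta / ((B - a) * (P + 1) + 1)).
  assert (HBa : 0 < B - a) by (unfold B; lra).
  assert (HBP : 0 <= (B - a) * (P + 1)) by (apply Rmult_le_pos; lra).
  assert (Hk : 0 < k) by (apply Rdiv_lt_0_compat; lra).
  (* The interval reaches to [B + 1] because the partition point following [x] may lie beyond [B],
     by less than 1 once the mesh is below [Rmin w 1]. *)
  destruct (uniform_continuity_2d (fun x _ => g x) a (B + 1) 0 0) with (eps := mkposreal k Hk)
    as [w Hw].
  { intros x y _ _. apply (continuity_1d_2d_pt_comp g (fun x _ => x)).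
    - apply continuity_pt_filterlim, Cg.
    - apply continuity_2d_pt_id1. }
  simpl in Hw. destruct (mesh_vanishes C (Rmin w 1) HC) as [eta [Heta Hsmall]].
  { apply Rmin_pos; [apply cond_pos | lra]. }
  exists eta. split; [exact Heta|]. intros eps He Hlt.
  assert (Hs := Hsmall eps (conj (proj1 He) Hlt)).
  assert (W1 := Rmin_l w 1). assert (W2 := Rmin_r w 1).
  apply Rle_lt_trans with ((B - a) * (k * P)).
  + apply (norm_RInt_le_const (V := R_NormedModule) (e eps) a B); [lra | |].
    * intros x Hx. change (Rabs (e eps x) <= k * P).
      destruct (Rle_lt_dec x a) as [Hxa|Hxa].
      { rewrite (Hleft eps x He Hxa), Rabs_R0. apply Rmult_le_pos; lra. }
      destruct (pt_bracket eps x He Hxa) as [i Hi].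
      rewrite (Hcell eps i x He Hi), Rabs_mult.
      apply Rmult_le_compat; try apply Rabs_pos; [|apply HP, Hx].
      assert (Hm := Hmesh eps i He).
      apply Rlt_le, (Hw x 0 (pt (d eps) (S i)) 0); try lra.
      -- rewrite Rabs_pos_eq; lra.
      -- rewrite Rminus_diag, Rabs_R0. apply cond_pos.
    * apply (RInt_correct (V := R_CompleteNormedModule)), Hint, He.
  + replace delta with (k * ((B - a) * (P + 1) + 1)) by (unfold k; field; lra).
    replace ((B - a) * (k * P)) with (k * ((B - a) * P)) by ring.
    apply Rmult_lt_compat_l; [exact Hk|]. lra.
Qed.

End InitialData.

(** * The conservation laws in the limit *)

Section Conservation.

Variables (eps0 U rmax : R) (d : R -> states) (gap : R -> R).
Hypothesis (Heps0 : 0 < eps0).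
Hypothesis Hd : forall eps, 0 < eps < eps0 -> expanding (d eps) (gap eps) U rmax.

(** The constant in [weak_value_bound] is built from [U], [rmax] and bounds of [phi] only. It can
    therefore be taken out of the quantifier over [eps]. *)
Lemma field_conservation (p : nat) (q f : R -> R -> R -> R) : p = 0%nat \/ p = 1%nat ->
  (forall eps x t, q eps x t = field_den (d eps) eps x t * field_vel (d eps) eps x t ^ p) ->
  (forall eps x t, f eps x t = field_den (d eps) eps x t * field_vel (d eps) eps x t ^ S p) ->
  approx_conservation eps0 q f.
Proof.
intros Hp Hq Hf phi [Hphi [M0 HM0]]. set (M := Rmax M0 1).
assert (Hsup : supported phi M).
{ assert (M1 := Rmax_l M0 1). assert (M2 := Rmax_r M0 1). split; [unfold M; lra|].
  intros x t Ht Hxt. apply HM0; [exact Ht|]. unfold M in Hxt. lra. }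
destruct (supported_controlled phi M Hphi Hsup) as [K HK].
assert (Hw := fun eps (He : 0 < eps < eps0) => weak_value_bound (d eps) (gap eps) U rmax eps
  (Hd eps He) (proj1 He) phi K M Hphi HK Hsup p (q eps) (f eps) Hp (Hq eps) (Hf eps)).
match type of Hw with forall eps He, exists J, _ /\ _ <= ?c * eps => set (bound := c) in Hw end.
exists (fun eps => epsilon (inhabits 0)
  (fun J => is_weak_value (q eps) (f eps) phi J /\ Rabs J <= bound * eps)).
assert (Hs := fun eps He => epsilon_spec (inhabits 0) _ (Hw eps He)). cbv beta in Hs.
split; [intros eps He; apply (Hs eps He)|].
apply (vanishes_at_right_0 _ eps0 Heps0). intros delta Hdelta.
exists (delta / (Rabs bound + 1)). assert (Hb := Rabs_pos bound).
split; [apply Rdiv_lt_0_compat; lra|]. intros eps He Hlt.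
apply Rlt_div_r in Hlt; [|lra]. apply Rle_lt_trans with (1 := proj2 (Hs eps He)).
assert (bound * eps <= Rabs bound * eps) by (apply Rmult_le_compat_r; [lra | apply Rle_abs]).
lra.
Qed.

End Conservation.

(** * Number of interactions and limit of the front speed *)

Section LongTime.

Variables (d : states) (gap U rmax eps : R).
Hypotheses (Hd : expanding d gap U rmax) (Heps : 0 < eps) (Hu : vel d 1 < vel d 0).

Lemma vL_of_state n : exists i, vL d (S n) = vel d (S i).
Proof.
unfold vL. destruct (reg d (S n)) as [[|i]|i] eqn:E; simpl.
- apply reg_St_0 in E. discriminate.
- exists i. reflexivity.
- exists i. reflexivity.
Qed.

(** A finite list of points has a latest time, whereas the interaction times are unbounded. *)
Lemma infinitely_many : (forall i, vel d (S i) < vel d 0) ->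
  infinitely_many_interactions (waves d eps).
Proof.
intros Hall l.
assert (Hlive : forall n, live d n).
{ intros [|n]; [left; reflexivity|]. right. destruct (vL_of_state n) as [i ->]. apply Hall. }
assert (Hmax : exists t, forall X T, In (X, T) l -> T <= t).
{ induction l as [|[X T] l [t IH]]; [exists 0; intros X T []|].
  exists (Rmax T t). intros X' T' [[= -> ->]|HI]; [apply Rmax_l|].
  apply Rle_trans with (1 := IH _ _ HI), Rmax_r. }
destruct Hmax as [t Ht]. destruct (T_unbounded d gap U rmax Hd t) as [N HN].
exists (edge d (S N) (front_birth d (S N))), (front_birth d (S N)). split.
- apply (waves_interaction d gap U rmax eps Hd). exists N. repeat split. apply Hlive.
- intros HI. apply Ht in HI. specialize (HN (S N) ltac:(lia) (Hlive _)). lra.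
Qed.

Lemma front_of_waves n : live d n -> front (waves d eps) (pt d 0) (front_wave d eps n).
Proof.
induction n as [|n IH]; intros Hn.
- apply front_start.
  + apply waves_front; assumption.
  + reflexivity.
  + simpl birthX. rewrite T_0. simpl. destruct (Rlt_dec _ _); simpl; ring.
  + apply T_0.
- apply front_next with (front_wave d eps n).
  + apply IH, (live_pred d gap U rmax Hd), Hn.
  + assert (Ha := arrives_front d gap U rmax eps Hd n Hn).
    destruct (front_at_meeting d gap U rmax Hd n Hn) as [E1 [_ [_ [E4 _]]]].
    rewrite <- E4, <- E1 in Ha. exact Ha.
  + apply waves_front; assumption.
Qed.

(** The state [k] is followed by [Vac k], whose right edge is at least as fast as [vel d 0]. The
    front that enters this vacuum never leaves it, and [vacuum_speed_limit] applies. *)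
Lemma interactions_stop k : vel d k < vel d 0 -> vel d 0 <= vel d (S k) ->
  exists X T us,
    front_meets_first_contact d (waves d eps) k X T /\
    last_interaction (waves d eps) X T /\
    is_front_speed (waves d eps) (pt d 0) us /\
    is_lim us p_infty (vel d 0).
Proof.
intros Hk Hk'. destruct (reg_Vac d k ltac:(lra)) as [n [En En']].
destruct n as [|n]; [injection En as <-; lra|].
assert (Hn : live d (S n)) by (right; unfold vL; rewrite En; exact Hk).
assert (Hstop : ~ live d (S (S n))).
{ intros [H|H]; [discriminate|]. unfold vL in H. rewrite En' in H. simpl in H. lra. }
exists (edge d (S n) (front_birth d (S n))), (front_birth d (S n)),
  (fun t => pspd (front_at d (front_index d t)) t).
split; [|split; [|split]].
- exists (front_wave d eps n), (contact_wave d (S n)).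
  split; [apply front_of_waves, (live_pred d gap U rmax Hd), Hn|].
  split; [apply (arrives_front d gap U rmax eps Hd), Hn|].
  split.
  { assert (Hc := contact_wave_contact d (S n)). unfold foot, vL in Hc.
    rewrite En in Hc at 1 2. exact Hc. }
  split; [exact En|]. apply (arrives_contact d gap U rmax eps Hd), Hn.
- split.
  + apply (waves_interaction d gap U rmax eps Hd). exists n. tauto.
  + intros X' T' HI. apply (waves_interaction d gap U rmax eps Hd) in HI.
    destruct HI as [j [Hj [-> ->]]].
    destruct (Nat.lt_total j n) as [H|[H|H]].
    * left. apply (T_smono d gap U rmax Hd); [lia | exact Hn].
    * right. subst j. tauto.
    * exfalso. apply Hstop, (live_le d gap U rmax Hd (S (S n)) (S j)); [lia | exact Hj].
- intros t Ht. destruct (lives_at_exists d gap U rmax Hd t Ht) as [j Hj].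
  exists (front_wave d eps j). split; [apply front_of_waves, Hj|].
  split; [split; apply Hj|]. rewrite (front_index_eq d gap U rmax Hd j t Hj). reflexivity.
- destruct (front_invariant d gap U rmax Hd Hu (S n) Hn) as [Hp [_ [_ [_ [Hm _]]]]].
  assert (Hvac : dn d (S (S n)) = 0) by (unfold dn; rewrite En'; reflexivity).
  apply (is_lim_ext_loc (pspd (front_at d (S n)))).
  + exists (front_birth d (S n)). intros t Ht.
    rewrite (front_index_eq d gap U rmax Hd (S n) t); [reflexivity|].
    split; [exact Hn|]. split; [lra|]. unfold front_end.
    destruct (Rlt_dec _ _) as [H|_]; [exfalso; apply Hstop; right; exact H | exact I].
  + apply (vacuum_speed_limit (den d 0) (vel d 0) (dn d (S (S n))) (vR d (S (S n))));
      [apply (ex_den _ _ _ _ Hd) | lra | exact Hp | exact Hvac | apply Hm; discriminate].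
Qed.

End LongTime.

Theorem theorem5p1
  (a : R) (rho u : R -> R) (rho0 u0 : R) (C eps0 : R) (Y : R -> nat -> R) (ut : R)
  (hrho : Cb_from a rho) (hu : Cb_from a u)
  (hrho_pos : forall x, a <= x -> 0 < rho x)
  (hu_incr : forall x y, a <= x -> x < y -> u x <= u y)
  (hrho0 : 0 < rho0) (hu0 : u a < u0)
  (hC : 1 <= C) (heps0 : 0 < eps0)
  (hY0 : forall eps, 0 < eps < eps0 -> Y eps 0%nat = a)
  (hY : forall eps i, 0 < eps < eps0 ->
     sqrt eps <= Y eps (S i) - Y eps i <= C * Rpower eps (1 / 3))
  (hut : forall eps, 0 < eps < eps0 ->
     is_lim_seq (fun i => u (Y eps (S i))) ut) :
  let d := fun eps => discretize (Y eps) rho0 u0 rho u in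
  (* the supremum of u equals u0 and is attained *)
  let degenerate := ut = u0 /\ exists x, a <= x /\ u x = u0 in
  exists (W : R -> wave -> Prop) (rhoE uE : R -> R -> R -> R),
    (forall eps, 0 < eps < eps0 ->
       tracking (d eps) eps (W eps) /\
       represents (d eps) eps (W eps) (rhoE eps) (uE eps) /\
       admissible (d eps) (W eps)) /\
    shadow_asymptotics eps0 W /\
    approx_conservation eps0 rhoE
      (fun eps x t => rhoE eps x t * uE eps x t) /\
    approx_conservation eps0
      (fun eps x t => rhoE eps x t * uE eps x t)
      (fun eps x t => rhoE eps x t * uE eps x t ^ 2) /\
    approx_function eps0 (fun eps x => rhoE eps x 0) (initial_datum a rho0 rho) /\
    approx_function eps0 (fun eps x => uE eps x 0) (initial_datum a u0 u) /\
    at_right 0 (fun eps =>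
      (ut <= u0 -> ~ degenerate -> infinitely_many_interactions (W eps)) /\
      (u0 < ut \/ degenerate ->
       exists (k : nat) (X T : R) (us : R -> R),
         vel (d eps) k < u0 <= vel (d eps) (S k) /\
         front_meets_first_contact (d eps) (W eps) k X T /\
         last_interaction (W eps) X T /\
         is_front_speed (W eps) a us /\
         is_lim us p_infty u0)).
Proof.
intros d degenerate.
destruct (proj2 hrho) as [Br HBr]. destruct (proj2 hu) as [Bu HBu].
assert (HYa : forall eps i, 0 < eps < eps0 -> a <= Y eps i).
{ intros eps i He. induction i as [|i IH]; [rewrite hY0 by exact He; lra|].
  destruct (hY eps i He) as [H _]. generalize (sqrt_pos eps). lra. }
assert (HYlt : forall eps i, 0 < eps < eps0 -> Y eps i < Y eps (S i)).
{ intros eps i He. destruct (hY eps i He) as [H _].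
  assert (0 < sqrt eps) by (apply sqrt_lt_R0; lra). lra. }
assert (Hu_mono : forall eps i j, 0 < eps < eps0 -> (i <= j)%nat -> u (Y eps i) <= u (Y eps j)).
{ intros eps i j He. induction 1 as [|j _ IH]; [lra|].
  apply Rle_trans with (1 := IH), hu_incr; [apply HYa, He | apply HYlt, He]. }
assert (Hd : forall eps, 0 < eps < eps0 ->
  expanding (d eps) (sqrt eps) (Rabs u0 + Bu) (rho0 + Br)).
{ intros eps He. split.
  - apply sqrt_lt_R0. lra.
  - intros i. simpl. destruct (hY eps i He). lra.
  - intros [|i]; simpl.
    + assert (H1 := HBr a (Rle_refl a)). assert (H2 := Rabs_pos (rho a)). lra.
    + assert (Hi := HYa eps (S i) He). assert (H1 := HBr _ Hi). assert (H2 := hrho_pos _ Hi).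
      rewrite Rabs_pos_eq in H1; lra.
  - intros [|i] Hi; [lia|]. apply (Hu_mono eps (S i) (S (S i)) He). lia.
  - intros [|i]; simpl.
    + assert (H1 := HBu a (Rle_refl a)). assert (H2 := Rabs_pos (u a)). lra.
    + assert (H1 := HBu _ (HYa eps (S i) He)). assert (H2 := Rabs_pos u0). lra. }
exists (fun eps => waves (d eps) eps), (fun eps => field_den (d eps) eps),
  (fun eps => field_vel (d eps) eps).
split; [|split; [|split; [|split; [|split; [|split]]]]].
- intros eps He. split; [|split].
  + apply (waves_tracking _ _ _ _ _ (Hd eps He)), He.
  + apply (waves_represents _ _ _ _ _ (Hd eps He)).
  + apply (waves_admissible _ _ _ _ _ (Hd eps He)).
- apply (waves_asymptotics eps0 d sqrt (Rabs u0 + Bu) (rho0 + Br) Hd).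
- apply (field_conservation eps0 (Rabs u0 + Bu) (rho0 + Br) d sqrt heps0 Hd 0);
    [left; reflexivity | |]; intros; simpl; ring.
- apply (field_conservation eps0 (Rabs u0 + Bu) (rho0 + Br) d sqrt heps0 Hd 1);
    [right; reflexivity | |]; intros; simpl; ring.
- apply (approx_function_ext _ (fun eps => step_datum (d eps) rho0 rho)).
  + intros eps x. unfold field_den, step_datum. destruct (Rle_dec 0 0); [reflexivity | lra].
  + apply (step_datum_approx a C eps0 rho0 (Rabs u0 + Bu) (rho0 + Br)); try assumption.
    intros eps i He. apply (hY eps i He).
- apply (approx_function_ext _ (fun eps => step_datum (d eps) u0 u)).
  + intros eps x. unfold field_vel, step_datum. destruct (Rle_dec 0 0); [reflexivity | lra].
  + apply (step_datum_approx a C eps0 u0 (Rabs u0 + Bu) (rho0 + Br)); try assumption.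
    intros eps i He. apply (hY eps i He).
(* A shadow wave starts at [a] only if [u (Y eps 1) < u0]. Continuity of [u] at [a] gives this for a
   small mesh, which is why the interactions are described for small [eps]. *)
- assert (Hnear : locally a (fun y => u (Rmax a y) < u0)).
  { apply (Cb_extension_continuous a u a hu (fun z => z < u0)).
    rewrite Rmax_left by lra. exact (open_lt u0 _ hu0). }
  destruct Hnear as [w Hw].
  destruct (mesh_vanishes C w hC (cond_pos w)) as [eta [Heta Hsmall]].
  assert (Hm : 0 < Rmin eta eps0) by (apply Rmin_pos; assumption).
  exists (mkposreal _ Hm). intros eps Hball Hpos.
  change (Rabs (eps - 0) < Rmin eta eps0) in Hball.
  rewrite Rminus_0_r, Rabs_pos_eq in Hball by lra.
  assert (M1 := Rmin_l eta eps0). assert (M2 := Rmin_r eta eps0).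
  assert (He : 0 < eps < eps0) by lra.
  assert (H1 : vel (d eps) 1 < vel (d eps) 0).
  { simpl. assert (Ha := HYa eps 1%nat He). rewrite <- (Rmax_right a (Y eps 1%nat)) by exact Ha.
    apply Hw. change (Rabs (Y eps 1%nat - a) < w).
    rewrite Rabs_pos_eq by lra. destruct (hY eps 0%nat He) as [_ H].
    rewrite (hY0 eps He) in H. specialize (Hsmall eps ltac:(lra)). lra. }
  assert (Hbelow : forall i, u (Y eps (S i)) <= ut).
  { intros i. apply (is_lim_seq_incr_compare (fun i => u (Y eps (S i)))); [apply hut, He|].
    intros n. apply Hu_mono; [exact He | lia]. }
  split.
  (* A partition point of velocity at least [u0] would force [ut = u0] with the value attained; this
     is the degenerate case, in which the front runs into a vacuum and the interactions stop. *)
  + intros Hle Hnd. apply (infinitely_many _ _ _ _ _ (Hd eps He)).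
    intros i. simpl. destruct (Rlt_le_dec (u (Y eps (S i))) u0) as [H|H]; [exact H|].
    exfalso. apply Hnd. specialize (Hbelow i).
    split; [lra|]. exists (Y eps (S i)). split; [apply HYa, He | lra].
  + intros Hcase.
    (* A limit above [u0] is approached by terms above [u0]; an attained value [u0] is reached at
       the partition point following [x]. *)
    assert (Hreach : exists j, u0 <= u (Y eps (S j))).
    { destruct Hcase as [Hlt|[_ [x [Hx Hux]]]].
      - apply NNPP. intros Hn. apply (Rlt_not_le _ _ Hlt).
        apply (is_lim_seq_le (fun i => u (Y eps (S i))) (fun _ => u0) ut u0);
          [|apply hut, He | apply is_lim_seq_const].
        intros i. apply Rlt_le, Rnot_le_lt. intros H. apply Hn. exists i. exact H.
      - destruct Hx as [Hx|<-]; [|lra].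
        destruct (pt_bracket a eps0 (Rabs u0 + Bu) (rho0 + Br) d Hd hY0 eps x He Hx) as [j [_ Hj]].
        exists j. rewrite <- Hux. destruct Hj as [Hj|Hj]; [|rewrite Hj; apply Rle_refl].
        apply hu_incr; [lra | exact Hj]. }
    (* [k] is the last index before [u0] is reached, and it is at least 1 because [vel (d eps) 1] is
       still below [u0]. *)
    assert (Hk : exists k, vel (d eps) k < u0 <= vel (d eps) (S k)).
    { destruct Hreach as [j Hj]. induction j as [|j IH].
      - simpl in H1. lra.
      - destruct (Rle_lt_dec u0 (u (Y eps (S j)))) as [H|H]; [apply IH, H|].
        exists (S j). simpl. lra. }
    destruct Hk as [k [Hk Hk']]. exists k.
    destruct (interactions_stop _ _ _ _ eps (Hd eps He) H1 k Hk Hk')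
      as [X [T [us [F1 [F2 [F3 F4]]]]]].
    exists X, T, us. split; [split; assumption|]. split; [exact F1|]. split; [exact F2|].
    split; [|exact F4]. rewrite <- (hY0 eps He). exact F3.
Qed.
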